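(* Let $\alpha\in[0,1]$, $\varepsilon>0$, and let $M^{\varepsilon}_{\alpha}$ be the infinitesimal generator in $L^2(H,\mu)$ of the semigroup $P^{\varepsilon}_{\alpha}(t)$. Then $D(M^{\varepsilon}_{\alpha})=D(L_{\alpha})$ and $$M^{\varepsilon}_{\alpha}\varphi=L_{\alpha}\varphi-\frac1\varepsilon\,V\varphi,\qquad \forall\,\varphi\in D(L_{\alpha}).$$
   Context: $H$ is an infinite-dimensional separable real Hilbert space with inner product $\langle\cdot,\cdot\rangle$ and norm $|\cdot|$; $Q$ is a bounded symmetric strictly positive operator on $H$ with finite trace, $A:=Q^{-1}$, and $\mu=\mathcal N_Q$ is the centered Gaussian measure on $H$ with covariance $Q$. $L_\alpha$: let $T_\alpha(t)\varphi(x)=\int_H\varphi(y)\,\mathcal N_{e^{-tA^\alpha/2}x,\,Q_t}(dy)$ with $Q_t=Q(I-e^{-tA^\alpha})$ be the Ornstein–Uhlenbeck semigroup; $\mu$ is invariant for it, it extends to a strongly continuous contraction semigroup in $L^2(H,\mu)$ (same symbol), and $L_\alpha$ is its infinitesimal generator in $L^2(H,\mu)$. Equivalently, $L_\alpha$ is the closure of $\mathcal L_\alpha\varphi(x)=\frac12\mathrm{Tr}[Q^{1-\alpha}D^2\varphi(x)]-\frac12\langle x,A^{\alpha}D\varphi(x)\rangle$ defined on $\mathcal E_\alpha(H)$, the linear span of the real and imaginary parts of the functions $x\mapsto e^{i\langle x,h\rangle}$, $h\in D(A^\alpha)$. $X_\alpha(t,x)$ is the (mild) solution, with a.s. continuous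 paths, of $dX_\alpha(t,x)=-\frac12A^\alpha X_\alpha(t,x)\,dt+A^{(\alpha-1)/2}dW(t)$, $X_\alpha(0,x)=x$, where $W$ is a standard cylindrical Wiener process in $H$ on a filtered probability space $(\Omega,\mathcal F,(\mathcal F_t)_{t\ge0},\mathbb P)$. $K\subset H$ is a closed set with nonempty interior (so $\mu(K)>0$) and $\mu(K^c)>0$. $V:H\to\mathbb R$ is a fixed bounded continuous function with $V=0$ on $K$ and $V>0$ on $K^c$. For $\varepsilon>0$, $$P^{\varepsilon}_\alpha(t)\varphi(x)=\mathbb E\Big[\varphi(X_\alpha(t,x))\,e^{-\frac1\varepsilon\int_0^tV(X_\alpha(s,x))ds}\Big];$$ it extends uniquely from $C_b(H)$ to a $C_0$-semigroup in $L^2(H,\mu)$, denoted by the same symbol. *)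

(* Defs.v *)
From HB Require Import structures.
From mathcomp Require Import all_boot all_order all_algebra.
From mathcomp Require Import all_classical all_reals all_analysis.

Set Implicit Arguments.
Unset Strict Implicit.
Unset Printing Implicit Defensive.
Import Order.TTheory GRing.Theory Num.Theory.
Import numFieldNormedType.Exports.
Local Open Scope classical_set_scope.
Local Open Scope ring_scope.

Notation borel H := (g_sigma_algebraType (@open H)).

Section Hilbert.
Context {R : realType} {H : completeNormedModType R}.
Variable ip : H -> H -> R.

Record inner_product : Prop := InnerProduct {
  ipC : forall x y, ip x y = ip y x ;
  ipDZl : forall a x y z, ip (a *: x + y) z = a * ip x z + ip y z ;
  ip_norm : forall x, ip x x = `|x| ^+ 2 }.

Definition infinite_dimensional : Prop :=
  forall (n : nat) (b : 'I_n -> H),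
    exists x, forall c : 'I_n -> R, x <> \sum_i c i *: b i.

Definition separable : Prop := exists D : set H, countable D /\ dense D.

Definition orthonormal_basis (e : nat -> H) : Prop :=
  (forall i j, ip (e i) (e j) = (i == j)%:R) /\
  (forall x, series (fun k => ip x (e k) *: e k) @ \oo --> x).

(* For a positive operator, the trace does not depend on the basis. *)
Definition finite_trace (Q : H -> H) : Prop :=
  exists e, orthonormal_basis e /\ cvgn (series (fun k => ip (Q (e k)) (e k))).

Record covariance_operator (Q : {linear H -> H}) : Prop := CovarianceOperator {
  cov_bounded : exists M, forall x, `|Q x| <= M * `|x| ;
  cov_symmetric : forall x y, ip (Q x) y = ip x (Q y) ;
  cov_positive : forall x, x != 0 -> 0 < ip (Q x) x ;
  cov_trace : finite_trace Q }.

Definition eigenbasis (Q : H -> H) (e : nat -> H) (lam : nat -> R) : Prop :=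
  orthonormal_basis e /\ forall k, Q (e k) = lam k *: e k.

(* f(A) x for A = Q^-1, by the spectral series
   f(A) x = \sum_k f(lam_k^-1) <x, e_k> e_k over an eigenbasis of Q; the sum
   does not depend on the eigenbasis. *)
Definition fcalc (Q : H -> H) (f : R -> R) (x : H) : H :=
  get [set y | exists e lam, eigenbasis Q e lam /\
    series (fun k => (f (lam k)^-1 * ip x (e k)) *: e k) @ \oo --> y].

(* A^s *)
Definition powA Q (s : R) : H -> H := fcalc Q (fun a => a `^ s).

(* e^(- t A^alpha) *)
Definition expA Q (alpha t : R) : H -> H :=
  fcalc Q (fun a => expR (- t * a `^ alpha)).

(* [normal_prob] is not a Dirac mass when the variance is 0. *)
Definition gauss1 (m v : R) : set R -> \bar R :=
  if v == 0 then dirac m else normal_prob m (Num.sqrt v).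

(* N_(m,C), through its one-dimensional marginals *)
Definition is_gaussian (nu : set H -> \bar R) (m : H) (C : H -> H) : Prop :=
  forall (h : H) (B : set R), measurable B ->
    nu ((fun z => ip z h) @^-1` B) = gauss1 (ip m h) (ip (C h) h) B.

Definition gaussian (m : H) (C : H -> H) : probability (borel H) R :=
  get [set nu : probability (borel H) R | is_gaussian nu m C].

(* Q_t = Q (I - e^(- t A^alpha)) *)
Definition covt (Q : H -> H) (alpha t : R) (x : H) : H :=
  Q (x - expA Q alpha t x).

Definition ou_semigroup (Q : H -> H) (alpha t : R) (phi : H -> R) (x : H) : R :=
  \int[gaussian (expA Q alpha (t / 2) x) (covt Q alpha t)]_y phi y.

End Hilbert.

Section L2.
Context {R : realType} {H : completeNormedModType R}.
Variable mu : probability (borel H) R.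

(* Elements of L^2(H, mu) are represented by square-integrable functions;
   operators on L^2(H, mu) act on representatives, up to mu-a.e. equality. *)
Definition in_L2 (f : H -> R) : Prop := (f : borel H -> R) \in Lfun mu 2%:E.

Definition L2norm (f : H -> R) : \bar R :=
  Lnorm mu 2%:E (EFin \o (f : borel H -> R)).

Definition ae_equal (f g : H -> R) : Prop := {ae mu, forall x, f x = g x}.

Record L2_bounded_operator (S : (H -> R) -> H -> R) : Prop := L2BoundedOperator {
  L2op_in : forall f, in_L2 f -> in_L2 (S f) ;
  L2op_ae : forall f g, in_L2 f -> in_L2 g -> ae_equal f g ->
    ae_equal (S f) (S g) ;
  L2op_linear : forall (a : R) f g, in_L2 f -> in_L2 g ->
    ae_equal (S (a \*: f \+ g)) (a \*: S f \+ S g) ;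
  L2op_bounded : exists M : R, forall f, in_L2 f ->
    (L2norm (S f) <= M%:E * L2norm f)%E }.

Record C0_semigroup (S : R -> (H -> R) -> H -> R) : Prop := C0Semigroup {
  C0_op : forall t : R, 0 <= t -> L2_bounded_operator (S t) ;
  C0_id : forall f, in_L2 f -> ae_equal (S 0 f) f ;
  C0_add : forall (s t : R) f, 0 <= s -> 0 <= t -> in_L2 f ->
    ae_equal (S (s + t) f) (S s (S t f)) ;
  C0_cvg : forall f, in_L2 f -> L2norm (S t f \- f) @[t --> 0^'+] --> 0%E }.

Definition Cb (phi : H -> R) : Prop :=
  continuous phi /\ exists M, forall x, `|phi x| <= M.

(* Cb(H) is dense in L^2(H, mu): S is determined by p, up to a.e. equality. *)
Definition L2_extension (p S : R -> (H -> R) -> H -> R) : Prop :=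
  C0_semigroup S /\
  forall (t : R) phi, 0 <= t -> Cb phi -> ae_equal (S t phi) (p t phi).

(* phi is in the domain of the generator of S, which maps phi to psi *)
Definition generator (S : R -> (H -> R) -> H -> R) (phi psi : H -> R) : Prop :=
  [/\ in_L2 phi, in_L2 psi &
    L2norm (t^-1 \*: (S t phi \- phi) \- psi) @[t --> 0^'+] --> 0%E].

Definition generator_domain (S : R -> (H -> R) -> H -> R) : set (H -> R) :=
  [set phi | exists psi, generator S phi psi].

End L2.

Section Process.
Context {R : realType} {H : completeNormedModType R}.
Context {d : measure_display} {Omega : measurableType d}.
Variables (ip : H -> H -> R) (P : probability Omega R).

Record filtration (F : R -> set_system Omega) : Prop := Filtration {
  filt_sigma : forall t : R, 0 <= t -> sigma_algebra setT (F t) ;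
  filt_sub : forall t : R, 0 <= t -> F t `<=` measurable ;
  filt_mono : forall s t : R, 0 <= s -> s <= t -> F s `<=` F t }.

(* W t h stands for <W(t), h>; W(t) itself is not H-valued. *)
Record cylindrical_wiener (F : R -> set_system Omega)
    (W : R -> H -> Omega -> R) : Prop := CylindricalWiener {
  wiener_adapted : forall (t : R) (h : H) (B : set R), 0 <= t ->
    measurable B -> F t (W t h @^-1` B) ;
  wiener0 : forall h, {ae P, forall w, W 0 h w = 0} ;
  wiener_linear : forall (t a : R) (h k : H), 0 <= t ->
    {ae P, forall w, W t (a *: h + k) w = a * W t h w + W t k w} ;
  wiener_gauss : forall (s t : R) (h : H) (B : set R), 0 <= s -> s <= t ->
    measurable B ->
    P [set w | B (W t h w - W s h w)] = gauss1 0 ((t - s) * ip h h) B ;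
  wiener_indep : forall (s t : R) (h : H) (A : set Omega) (B : set R),
    0 <= s -> s <= t -> F s A -> measurable B ->
    P (A `&` [set w | B (W t h w - W s h w)]) =
    (P A * P [set w | B (W t h w - W s h w)%R])%E ;
  wiener_continuous : forall h,
    {ae P, forall w, {within `[0, +oo[, continuous (fun t => W t h w)}} }.

(* A list of ((a, b), h) encodes the step function \sum 1_(]a, b]) h. *)
Definition stepfun (l : seq (R * R * H)) (s : R) : H :=
  \sum_(u <- l) \1_(`]u.1.1, u.1.2]) s *: u.2.

Definition stepint (W : R -> H -> Omega -> R) (l : seq (R * R * H))
    (w : Omega) : R :=
  \sum_(u <- l) (W u.1.2 u.2 w - W u.1.1 u.2 w).

(* I is the stochastic integral over [0, t] of <f(s), dW(s)>, for a
   deterministic f in L^2(0, t; H): the L^2(P)-limit of the integrals of step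
   functions that converge to f in L^2(0, t; H). *)
Definition wiener_integral (W : R -> H -> Omega -> R) (t : R) (f : R -> H)
    (I : Omega -> R) : Prop :=
  exists l : nat -> seq (R * R * H),
  [/\ forall n u, u \in l n -> [/\ 0 <= u.1.1, u.1.1 <= u.1.2 & u.1.2 <= t],
      (\int[lebesgue_measure]_(s in `[0%R, t])
         (`|f s - stepfun (l n) s| ^+ 2)%:E)%E @[n --> \oo] --> 0%E,
      measurable_fun setT I &
      Lnorm P 2%:E (EFin \o (I \- stepint W (l n))) @[n --> \oo] --> 0%E].

(* X t x is the mild solution
     X(t,x) = e^(-tA^alpha/2) x
              + int_0^t e^(-(t-s)A^alpha/2) A^((alpha-1)/2) dW(s),
   tested against h: < int_0^t G(s) dW(s), h > = int_0^t < G(s)^* h, dW(s) >,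
   and both factors of G(s) are symmetric. *)
Record mild_solution (Q : H -> H) (alpha : R) (W : R -> H -> Omega -> R)
    (X : R -> H -> Omega -> H) : Prop := MildSolution {
  mild_measurable : forall (t : R) x, 0 <= t ->
    measurable_fun setT (X t x : Omega -> borel H) ;
  mild_eq : forall (t : R) x h, 0 <= t -> exists I,
    wiener_integral W t
      (fun s => powA ip Q ((alpha - 1) / 2) (expA ip Q alpha ((t - s) / 2) h))
      I /\
    {ae P, forall w, ip (X t x w) h = ip (expA ip Q alpha (t / 2) x) h + I w} ;
  mild_continuous : forall x,
    {ae P, forall w, {within `[0, +oo[, continuous (fun t => X t x w)}} }.

Definition fk_semigroup (X : R -> H -> Omega -> H) (V : H -> R) (eps t : R)
    (phi : H -> R) (x : H) : R :=
  \int[P]_w (phi (X t x w) *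
    expR (- eps^-1 * \int[lebesgue_measure]_(s in `[0, t]) V (X s x w))).

End Process.

(* Main.v *)
(* For phi bounded and continuous, path continuity and X(0,x) = x give
   (P^eps(t) phi - T(t) phi)(x) / t -> - V(x) phi(x) / eps for each x, boundedly,
   hence in L^2(mu).  Jensen's inequality and the invariance of mu bound
   P^eps(t) - T(t) by C t on L^2(mu), so by density this limit holds for every
   phi in L^2(mu), and the difference quotients of the two semigroups converge
   for the same phi.

   Bounded Borel functions on H are generated by the functions
   x |-> cos (<x, h> + theta) under linear combinations and bounded pointwise
   limits.  The identity T(t) phi(x) = E phi(X(t,x)), the invariance of mu and
   the density of Cb(H) therefore reduce to these functions; their means are
   computed from the independence of the increments of W, the variance of
   <X(t,x), h> being given by an expansion in an eigenbasis of Q. *)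
Require Import Defs.
From HB Require Import structures.
From mathcomp Require Import all_boot all_order all_algebra.
From mathcomp Require Import all_classical all_reals all_analysis.
From mathcomp Require Import measurable_realfun ring lra.

Set Implicit Arguments.
Unset Strict Implicit.
Unset Printing Implicit Defensive.
Import Order.TTheory GRing.Theory Num.Theory.
Import numFieldNormedType.Exports.
Local Open Scope classical_set_scope.
Local Open Scope ring_scope.


(** * Monotone classes of bounded functions *)

(** Three objects come without a property that the argument needs, and each property is extracted
    from another hypothesis. The eigenbasis of [Q], on which [fcalc] relies, is forced by the
    existence of the extension [T]: without it [T 0] could not be the identity almost everywhere.
    The measure [gaussian m C] is a choice by [get]; the law of X(t,x) witnesses that such a measure
    exists. The initial condition X(0,x) = x follows from the law of X(0,x), a Dirac mass.

    The Gaussian characteristic function enters through [gcos] only. Invariance uses that it is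
    multiplicative in the variance: with y = e^(-tA^alpha/2) h, the variances <Q y, y> and <Q_t h,
    h> add up to <Q h, h>.

    Operators act on representatives, with null sets that depend on the time. Limits as t -> 0+ are
    therefore taken along sequences, for which countably many null sets suffice. Mean squares are
    real numbers compared by (a + b)^2 <= 2 a^2 + 2 b^2 in place of Minkowski's inequality, which is
    the origin of most constants in the perturbation argument. *)

Section MonotoneClass.
Context {T : Type} {R : realType}.
Implicit Types (C : (T -> R) -> Prop) (f g : T -> R) (A : (T -> R) -> Prop).

Record monotone_class C : Prop := MonotoneClass {
  mclass_lin : forall (a : R) f g, C f -> C g -> C (fun x => a * f x + g x) ;
  mclass_lim : forall (f_ : nat -> T -> R) f (M : R), (forall n, C (f_ n)) ->
    (forall n x, `|f_ n x| <= M) -> (forall x, f_ n x @[n --> \oo] --> f x) ->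
    C f }.

(** The smallest monotone class that contains [A], as an impredicative intersection; induction over
    it is mere application. *)
Definition mclosure A f := forall C, monotone_class C -> (forall g, A g -> C g) -> C f.

Lemma mclosure_class A : monotone_class (mclosure A).
Proof.
split=> [a f g hf hg C hC AC|f_ f M hf fM ff C hC AC].
  by apply: (mclass_lin hC); [exact: hf|exact: hg].
by apply: (mclass_lim hC _ fM ff) => n; exact: hf.
Qed.

Lemma mclosure_sub A f : A f -> mclosure A f.
Proof. by move=> Af C _; apply. Qed.

Lemma mclosure_ind A C : monotone_class C -> (forall g, A g -> C g) ->
  forall f, mclosure A f -> C f.
Proof. by move=> hC AC f; apply. Qed.

Lemma monotone_class_bounded : monotone_class (fun f => exists M : R, forall x, `|f x| <= M).
Proof.
split=> [a f g [M fM] [N gN]|f_ f M _ fM ff].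
  exists (`|a| * M + N) => x.
  by rewrite (le_trans (ler_normD _ _))// lerD// normrM ler_wpM2l.
exists M => x; apply: (cvgr_to_le (cvg_norm (ff x))).
by apply: nearW => n; exact: fM.
Qed.

Section Algebra.
Variable A : (T -> R) -> Prop.
Hypothesis A_bounded : forall f, A f -> exists M : R, forall x, `|f x| <= M.
Hypothesis A_mul : forall f g, A f -> A g -> mclosure A (fun x => f x * g x).

Let bdd f : mclosure A f -> exists M : R, forall x, `|f x| <= M.
Proof. by move=> Af; exact: (mclosure_ind monotone_class_bounded _ Af). Qed.

Let monotone_class_mul g : mclosure A g ->
  monotone_class (fun f => mclosure A (fun x => f x * g x)).
Proof.
move=> Ag; have [N gN] := bdd Ag; have mA := mclosure_class A.
split=> [a f h Af Ah|f_ f M Af fM ff].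
  have -> : (fun x => (a * f x + h x) * g x) =
            (fun x => a * (f x * g x) + h x * g x).
    by apply/funext => x; rewrite mulrDl mulrA.
  exact: (mclass_lin mA a Af Ah).
apply: (mclass_lim mA (f_ := fun n x => f_ n x * g x) (M := M * N)) => //.
- by move=> n x; rewrite normrM ler_pM.
- by move=> x; apply: cvgM; [exact: ff|exact: cvg_cst].
Qed.

(** Two passes: for a fixed [g] in the closure, the good [f] form a monotone class, which reduces
    [f] to [A]; for that [f], the same argument reduces [g] to [A], where [A_mul] applies. Members
    of the closure are bounded, which keeps the products uniformly bounded along limits. *)
Lemma mclosure_mul f g :
  mclosure A f -> mclosure A g -> mclosure A (fun x => f x * g x).
Proof.
move=> Af Ag; apply: (mclosure_ind (monotone_class_mul Ag) _ Af) => {Af} f Af.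
have Af' := mclosure_sub Af; under eq_fun do rewrite mulrC.
apply: (mclosure_ind (monotone_class_mul Af') _ Ag) => {Ag} g Ag.
by under eq_fun do rewrite mulrC; exact: A_mul.
Qed.

Hypothesis A_cst : forall a, mclosure A (fun=> a).

Lemma mclosure_scale a f : mclosure A f -> mclosure A (fun x => a * f x).
Proof.
move=> Af; under eq_fun do rewrite -[_ * _]addr0.
exact: (mclass_lin (mclosure_class A) a Af (A_cst 0)).
Qed.

Lemma mclosure_1B f : mclosure A f -> mclosure A (fun x => 1 - f x).
Proof.
move=> Af; under eq_fun do rewrite addrC -mulN1r.
exact: (mclass_lin (mclosure_class A) (-1) Af (A_cst 1)).
Qed.

Lemma mclosure_exp f n : mclosure A f -> mclosure A (fun x => f x ^+ n).
Proof.
move=> Af; elim: n => [|n ih]; first by under eq_fun do rewrite expr0; exact: A_cst.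
under eq_fun do rewrite exprS.
exact: mclosure_mul.
Qed.

End Algebra.
End MonotoneClass.

Section Threshold.
Context {R : realType}.

Lemma one_plus_mul_le_exp (h : R) n : 0 <= h -> 1 + n%:R * h <= (1 + h) ^+ n.
Proof.
move=> h0; elim: n => [|n ih]; first by rewrite mul0r addr0 expr0.
rewrite exprS (le_trans _ (ler_wpM2l _ ih))//; last by lra.
have n0 : 0 <= n%:R :> R by [].
rewrite -natr1; nra.
Qed.

Lemma one_minus_mul_le_exp (x : R) n : 0 <= x <= 1 -> 1 - n%:R * x <= (1 - x) ^+ n.
Proof.
move=> /andP[x0 x1]; elim: n => [|n ih]; first by rewrite mul0r subr0 expr0.
rewrite exprS (le_trans _ (ler_wpM2l _ ih))//; last by lra.
have n0 : 0 <= n%:R :> R by [].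
rewrite -natr1; nra.
Qed.

(** Bernoulli's inequality gives (1 - x)^n (1 + n x) <= (1 - x)^n (1 + x)^n = (1 - x^2)^n <= 1. *)
Lemma exp_one_minus_le (x : R) n : 0 <= x <= 1 -> (1 - x) ^+ n <= (1 + n%:R * x)^-1.
Proof.
move=> /andP[x0 x1]; have n0 : 0 <= n%:R :> R by [].
rewrite -[leRHS]mul1r ler_pdivlMr; last by rewrite ltr_pwDl// mulr_ge0.
rewrite (le_trans (ler_wpM2l _ (one_plus_mul_le_exp n x0)))//.
  by rewrite exprn_ge0// subr_ge0.
rewrite -exprMn -subr_sqr expr1n exprn_ile1//.
  by rewrite subr_ge0 -(expr1n _ 2) lerXn2r// ?nnegrE.
by rewrite gerBl sqr_ge0.
Qed.

Lemma cvg_natmul_exp (q : R) : 0 <= q < 1 -> n%:R * q ^+ n @[n --> \oo] --> 0.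
Proof.
move=> /andP[q0 q1].
have [->|qN0] := eqVneq q 0.
  apply: cvg_near_cst; exists 1%N => // n /= n0; by rewrite expr0n gtn_eqF// mulr0.
have {}q0 : 0 < q by rewrite lt_def qN0.
(* One factor of q^n = s^n s^n absorbs n: Bernoulli's inequality for h = 1/s - 1 gives n s^n <= 1/h,
   and the other factor tends to 0. *)
pose s := Num.sqrt q.
have s0 : 0 < s by rewrite sqrtr_gt0.
have ss : s ^+ 2 = q by rewrite sqr_sqrtr// ltW.
have s1 : s < 1 by rewrite -(ltr_pXn2r (n := 2))// ?nnegrE ?ltW// ss expr1n.
pose h := s^-1 - 1.
have h0 : 0 < h by rewrite subr_gt0 invf_gt1.
have bnd n : 0 <= n%:R * q ^+ n <= h^-1 * s ^+ n.
  rewrite mulr_ge0 ?exprn_ge0 ?(ltW q0)//= -ss -exprM mulnC exprM expr2 mulrA.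
  apply: ler_wpM2r; first by rewrite exprn_ge0// ltW.
  have hs : 1 + h = s^-1 by rewrite /h addrC subrK.
  have sn0 : 0 < s ^+ n by rewrite exprn_gt0.
  have : (1 + n%:R * h) * s ^+ n <= 1.
    by rewrite -ler_pdivlMr// mul1r -exprVn -hs one_plus_mul_le_exp// ltW.
  rewrite -[h^-1]mul1r ler_pdivlMr//; move: sn0; set y := s ^+ n; lra.
apply: (squeeze_cvgr (f := fun=> 0) (h := fun n => h^-1 * s ^+ n)).
- by apply: nearW => n; exact: bnd.
- exact: cvg_cst.
- rewrite -[X in _ --> X](mulr0 h^-1); apply: cvgM; first exact: cvg_cst.
  by apply: cvg_expr; rewrite ger0_norm// ltW.
Qed.

(** With N = n 2^n, the product N u^n = n (2u)^n tends to 0 if u < 1/2 and is at least n if u >=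
    1/2. The factor n settles the borderline u = 1/2. Bernoulli's inequality from below and
    [exp_one_minus_le] from above conclude. *)
Lemma cvg_threshold (u : R) : 0 <= u <= 1 ->
  (1 - u ^+ n) ^+ (n * 2 ^ n) @[n --> \oo] --> ((u < 2^-1)%R%:R : R).
Proof.
move=> /andP[u0 u1].
have un n : 0 <= u ^+ n <= 1 by rewrite exprn_ge0// exprn_ile1.
have e n : (n * 2 ^ n)%:R * u ^+ n = n%:R * (2 * u) ^+ n :> R.
  by rewrite natrM natrX exprMn mulrA.
case: ltP => u2.
  apply: (squeeze_cvgr (f := fun n => 1 - n%:R * (2 * u) ^+ n) (h := fun=> 1)).
  - apply: nearW => n; rewrite -e one_minus_mul_le_exp//=.
    by case/andP: (un n) => ? ?; rewrite exprn_ile1//; lra.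
  - rewrite -[X in _ --> X]subr0; apply: cvgB; first exact: cvg_cst.
    by apply: cvg_natmul_exp; lra.
  - exact: cvg_cst.
apply: (squeeze_cvgr (f := fun=> 0) (h := fun n => (1 + n%:R)^-1)).
- apply: nearW => n; case/andP: (un n) => ? ?.
  rewrite exprn_ge0 ?subr_ge0//= (le_trans (exp_one_minus_le _ (un n)))//.
  rewrite e lef_pV2// ?posrE ?ltr_pwDl// ?mulr_ge0 ?exprn_ge0//; last by lra.
  rewrite lerD2l ler_peMr// exprn_ege1//; lra.
- exact: cvg_cst.
- under eq_fun do rewrite addrC natr1; exact: cvg_harmonic.
Qed.

End Threshold.

Lemma indic_bool {T : Type} {R : pzRingType} (p : T -> bool) x :
  \1_[set x | p x] x = (p x)%:R :> R.
Proof. by rewrite indicE; congr (nat_of_bool _)%:R; apply/idP/idP; rewrite inE. Qed.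

Section IndicatorClosure.
Context {T : Type} {R : realType}.
Variable A : (T -> R) -> Prop.
Hypothesis A_bounded : forall f, A f -> exists M : R, forall x, `|f x| <= M.
Hypothesis A_mul : forall f g, A f -> A g -> mclosure A (fun x => f x * g x).
Hypothesis A_cst : forall a, mclosure A (fun=> a).

(* With u = (1 - f) / 2, the polynomials (1 - u^n)^(n 2^n) tend to the
   indicator of u < 1/2, that is, of f > 0. *)
Lemma mclosure_gt0 f : (forall x, `|f x| <= 1) -> mclosure A f ->
  mclosure A \1_[set x | 0 < f x].
Proof.
move=> f1 Af; pose u x := 2^-1 * (1 - f x).
have u01 x : 0 <= u x <= 1 by have := f1 x; rewrite ler_norml /u; lra.
have Au : mclosure A u by apply: mclosure_scale => //; exact: mclosure_1B.
apply: (mclass_lim (mclosure_class A)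
  (f_ := fun n x => (1 - u x ^+ n) ^+ (n * 2 ^ n)) (M := 1)).
- by move=> n; apply: mclosure_exp => //; apply: mclosure_1B => //; exact: mclosure_exp.
- move=> n x; have /andP[u0 u1] := u01 x.
  have uu : 0 <= u x ^+ n <= 1 by rewrite exprn_ge0// exprn_ile1.
  by rewrite normrX exprn_ile1// ger0_norm; lra.
- move=> x; have := cvg_threshold (u01 x).
  suff -> : ((u x < 2^-1)%R%:R : R) = \1_[set x | 0 < f x] x by [].
  rewrite indic_bool; congr (_%:R); congr nat_of_bool; apply/idP/idP; rewrite /u; lra.
Qed.

Lemma mclosure_sigma_algebra : sigma_algebra setT [set B | mclosure A \1_B].
Proof.
have indD B : \1_(setT `\` B) = (fun x => 1 - \1_B x) :> (T -> R).
  by apply/funext => x; rewrite setTD indicC indicE; case: (x \in B) => /=; lra.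
have clD B : mclosure A \1_B -> mclosure A \1_(setT `\` B).
  by move=> AB; rewrite indD; exact: mclosure_1B.
split=> /=; [by rewrite indic0; exact: A_cst|exact: clD|move=> F AF].
rewrite -[bigcup _ _]setCK -setTD; apply: (clD _).
(* The partial products tend to the indicator of the complement of the union, so that products and
   bounded limits suffice. *)
pose h n x : R := \prod_(k < n) \1_(setT `\` F k) x.
have h01 n x : h n x = (`[< forall k, (k < n)%N -> ~ F k x >])%:R.
  elim: n => [|n ih]; first by rewrite /h big_ord0 asboolT.
  rewrite /h big_ord_recr/= -/(h n x) ih indicE -natrM mulnb; congr (_%:R : R).
  congr nat_of_bool; apply/andP/asboolP => [[/asboolP nF]|nF].
    by rewrite inE => -[_ nFn] k; rewrite ltnS leq_eqVlt => /predU1P[->//|]; exact: nF.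
  split; first by apply/asboolP => k kn; exact/nF/ltnW.
  by rewrite inE; split => //; exact: nF.
apply: (mclass_lim (mclosure_class A) (f_ := h) (M := 1)).
- elim=> [|n ih].
    have -> : h 0%N = fun=> 1 by apply/funext => x; rewrite /h big_ord0.
    exact: A_cst.
  have -> : h n.+1 = fun x => h n x * \1_(setT `\` F n) x.
    by apply/funext => x; rewrite /h big_ord_recr.
  by apply: mclosure_mul => //; apply: (clD _); exact: AF.
- by move=> n x; rewrite h01; case: (`[< _ >]); rewrite ?normr1 ?normr0.
- move=> x; rewrite indicE; case: (pselect ((\bigcup_k F k) x)) => [Fx|nFx].
    have -> : x \in ~` (\bigcup_k F k) = false by apply/negbTE; rewrite notin_setE.
    case: Fx => k _ Fkx; apply: cvg_near_cst; exists k.+1 => // n /= kn.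
    by rewrite h01 asboolF// => /(_ k kn).
  have -> : x \in ~` (\bigcup_k F k) by rewrite inE.
  apply: cvg_near_cst; apply: nearW => n; rewrite h01 asboolT// => k _ Fk.
  by apply: nFx; exists k.
Qed.

End IndicatorClosure.

(** * Bounded measurable functions and their expectations *)

Section BoundedMeasurable.
Context d (T : measurableType d) (R : realType).
Implicit Types f g : T -> R.

Definition bdd_meas f := measurable_fun setT f /\ exists M : R, forall x, `|f x| <= M.

Lemma bdd_meas_cst a : bdd_meas (fun=> a).
Proof. by split; [exact: measurable_cst|exists `|a|]. Qed.

Lemma bdd_meas_lin a f g : bdd_meas f -> bdd_meas g -> bdd_meas (fun x => a * f x + g x).
Proof.
move=> [mf bf] [mg bg]; split; last exact: (mclass_lin monotone_class_bounded a bf bg).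
by apply: measurable_funD => //; exact: measurable_funM.
Qed.

Lemma bdd_meas_lim (f_ : nat -> T -> R) f M : (forall n, bdd_meas (f_ n)) ->
  (forall n x, `|f_ n x| <= M) -> (forall x, f_ n x @[n --> \oo] --> f x) ->
  bdd_meas f.
Proof.
move=> bf fM ff; split.
  by apply: (measurable_fun_cvg (h := f_)) => [n|x _]; [case: (bf n)|exact: ff].
by apply: (mclass_lim monotone_class_bounded _ fM ff) => n; case: (bf n).
Qed.

Lemma bdd_measM f g : bdd_meas f -> bdd_meas g -> bdd_meas (fun x => f x * g x).
Proof.
move=> [mf [M fM]] [mg [N gN]]; split; first exact: measurable_funM.
by exists (M * N) => x; rewrite normrM ler_pM.
Qed.

Lemma bdd_measD f g : bdd_meas f -> bdd_meas g -> bdd_meas (fun x => f x + g x).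
Proof.
by move=> bf bg; have := bdd_meas_lin 1 bf bg; under eq_fun do rewrite mul1r.
Qed.

Lemma bdd_measZ a f : bdd_meas f -> bdd_meas (fun x => a * f x).
Proof. by move=> bf; apply: bdd_measM => //; exact: bdd_meas_cst. Qed.

Lemma bdd_measB f g : bdd_meas f -> bdd_meas g -> bdd_meas (fun x => f x - g x).
Proof.
move=> bf bg; have := bdd_meas_lin (-1) bg bf.
by under eq_fun do rewrite mulN1r addrC.
Qed.

Lemma bdd_meas_indic B : measurable B -> bdd_meas \1_B.
Proof.
move=> mB; split; first exact: measurable_indic.
by exists 1 => x; rewrite indicE; case: (_ \in _); rewrite ?normr1 ?normr0.
Qed.

Import HBNNSimple.

(** Simple approximations from below inherit the bound of a nonnegative function, so their limit
    stays within a monotone class. *)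
Lemma bdd_meas_mclosure (A : (T -> R) -> Prop) :
  (forall a, mclosure A (fun=> a)) ->
  (forall B : set T, measurable B -> mclosure A \1_B) ->
  forall f, bdd_meas f -> mclosure A f.
Proof.
move=> A_cst A_ind; have mA := mclosure_class A.
have A_nonneg f : measurable_fun setT f -> (forall x, 0 <= f x) ->
    (exists M : R, forall x, `|f x| <= M) -> mclosure A f.
  move=> mf f0 [M fM].
  have mf' : measurable_fun setT (EFin \o f) by exact/measurable_EFinP.
  pose a := nnsfun_approx measurableT mf'.
  have cva x : a n x @[n --> \oo] --> f x.
    by apply: (@fine_cvg _ _ _ _ (EFin \o a ^~ x)); apply: cvg_nnsfun_approx => // y _; rewrite lee_fin.
  apply: (mclass_lim mA (f_ := a) (M := M)) => //.
  - move=> n.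
    have -> : (a n : T -> R) = (fun x => \sum_(y <- finmap.enum_fset (fset_set (range (a n)))) (y * \1_(a n @^-1` [set y]) x)).
      apply/funext => x; rewrite fimfunE fsbig_finite//.
    elim: (finmap.enum_fset _) => [|y s ih].
      by under eq_fun do rewrite big_nil; exact: A_cst.
    under eq_fun do rewrite big_cons.
    apply: (mclass_lin mA y _ ih); apply: A_ind.
    by rewrite -[X in measurable X]setTI; exact: measurable_funP.
  - move=> n x; rewrite ger0_norm// (le_trans _ (fM x))// ger0_norm//.
    apply: (cvgr_to_ge (cva x)); exists n => // m /= nm.
    by have /lefP/(_ x) := nd_nnsfun_approx measurableT mf' nm.
move=> f [mf [M fM]].
(* Adding the bound [M] makes the function nonnegative; the factor 1 gives the shape of
   [mclass_lin]. *)
have -> : f = (fun x => 1 * (f x + M) + (- M)) by apply/funext => x; rewrite mul1r addrK.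
apply: (mclass_lin mA 1 (f := fun x => f x + M)) (A_cst _).
apply: A_nonneg => [|x|].
- exact: measurable_funD.
- by have := fM x; rewrite ler_norml; lra.
- exists (M + M) => x; rewrite (le_trans (ler_normD _ _))// lerD//.
  by rewrite ger0_norm// (le_trans _ (fM x)).
Qed.

End BoundedMeasurable.

Section Expectation.
Context d (T : measurableType d) (R : realType) (P : probability T R).
Implicit Types f g : T -> R.

Lemma bdd_meas_integrable f : bdd_meas f -> P.-integrable setT (EFin \o f).
Proof.
move=> [mf [M fM]]; apply: measurable_bounded_integrable => //.
  by apply: (le_lt_trans (probability_le1 P _) (ltry _)).
exists M; split; [exact: num_real|move=> x Mx y _].
by rewrite /= (le_trans (fM y))// ltW.
Qed.

Lemma expect_lin a f g : bdd_meas f -> bdd_meas g ->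
  \int[P]_x (a * f x + g x) = a * \int[P]_x f x + \int[P]_x g x.
Proof.
move=> bf bg; rewrite RintegralD//; last 2 first.
- by apply: (@bdd_meas_integrable (fun x => a * f x)); exact: bdd_measZ.
- exact: bdd_meas_integrable.
by rewrite RintegralZl//; exact: bdd_meas_integrable.
Qed.

Lemma expect_cst a : \int[P]_x a = a.
Proof.
rewrite /Rintegral (_ : (fun=> a%:E) = cst a%:E)// integral_cst//=.
by rewrite probability_setT mule1.
Qed.

Lemma expectZ a f : bdd_meas f -> \int[P]_x (a * f x) = a * \int[P]_x f x.
Proof. by move=> bf; rewrite RintegralZl//; exact: bdd_meas_integrable. Qed.

Lemma expectD f g : bdd_meas f -> bdd_meas g ->
  \int[P]_x (f x + g x) = \int[P]_x f x + \int[P]_x g x.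
Proof. by move=> bf bg; rewrite RintegralD//; exact: bdd_meas_integrable. Qed.

Lemma expectB f g : bdd_meas f -> bdd_meas g ->
  \int[P]_x (f x - g x) = \int[P]_x f x - \int[P]_x g x.
Proof. by move=> bf bg; rewrite RintegralB//; exact: bdd_meas_integrable. Qed.

Lemma expect_le f g : bdd_meas f -> bdd_meas g -> (forall x, f x <= g x) ->
  \int[P]_x f x <= \int[P]_x g x.
Proof. by move=> bf bg fg; apply: le_Rintegral => //; exact: bdd_meas_integrable. Qed.

Lemma expect_norm_le f g : bdd_meas f -> bdd_meas g -> (forall x, `|f x| <= g x) ->
  `|\int[P]_x f x| <= \int[P]_x g x.
Proof.
move=> bf bg fg; rewrite ler_norml -[X in X <= _]mulN1r -expectZ//.
by apply/andP; split; apply: expect_le => //; [exact: bdd_measZ| |] => x;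
  have := fg x; rewrite ler_norml; lra.
Qed.

Lemma expect_cvg (f_ : nat -> T -> R) f (M : R) : (forall n, bdd_meas (f_ n)) ->
  (forall n x, `|f_ n x| <= M) -> (forall x, f_ n x @[n --> \oo] --> f x) ->
  \int[P]_x f_ n x @[n --> \oo] --> \int[P]_x f x.
Proof.
move=> bf fM ff; have bf' := bdd_meas_lim bf fM ff.
apply: fine_cvg; rewrite fineK; last first.
  by apply: integrable_fin_num => //; exact: bdd_meas_integrable.
apply: (@dominated_cvg _ _ _ P _ _ _ _ (cst M%:E)) => //.
- by move=> n; apply/measurable_EFinP; case: (bf n).
- by move=> x _; apply: cvg_EFin; [exact: nearW|exact: ff].
- exact: (bdd_meas_integrable (bdd_meas_cst _ M)).
- by move=> n x _ /=; rewrite lee_fin.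
Qed.

End Expectation.

Lemma same_expect_class d (T : measurableType d) (R : realType) (P1 P2 : probability T R) :
  monotone_class (fun f : T -> R => bdd_meas f /\ \int[P1]_x f x = \int[P2]_x f x).
Proof.
split=> [a f g [bf ef] [bg eg]|f_ f M ef fM ff].
  by split; [exact: bdd_meas_lin|rewrite !expect_lin// ef eg].
have bf n : bdd_meas (f_ n) by case: (ef n).
split; first exact: (bdd_meas_lim bf fM ff).
have c1 := expect_cvg (P := P1) bf fM ff; have c2 := expect_cvg (P := P2) bf fM ff.
have e : (fun n => \int[P1]_x f_ n x) = (fun n => \int[P2]_x f_ n x).
  by apply/funext => n; case: (ef n).
by rewrite e in c1; apply: (cvg_unique _ c1 c2).
Qed.

(** * Cosines of linear forms *)

Section Trig.
Context {R : realType} {V : lmodType R} {T : Type}.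
Variable ell : V -> T -> R.
Hypothesis ell_lin : forall a u v x, ell (a *: u + v) x = a * ell u x + ell v x.

(** The form [ell] is abstract, to serve both the real line and [H]. The phase [th] brings in the
    sines and makes the family stable under products, up to linear combinations. *)
Definition trig (f : T -> R) := exists v th, f = fun x => cos (ell v x + th).

Let ellD u v x : ell (u + v) x = ell u x + ell v x.
Proof. by rewrite -[u]scale1r ell_lin scale1r mul1r. Qed.

Let ell0 x : ell 0 x = 0.
Proof. by have := ellD 0 0 x; rewrite addr0; lra. Qed.

Let ellZ a v x : ell (a *: v) x = a * ell v x.
Proof. by rewrite -[_ *: _]addr0 ell_lin ell0 addr0. Qed.

Let ellB u v x : ell (u - v) x = ell u x - ell v x.
Proof. by rewrite ellD -scaleN1r ellZ mulN1r. Qed.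

Lemma trig_bounded f : trig f -> exists M : R, forall x, `|f x| <= M.
Proof. by move=> [v [th ->]]; exists 1 => x; rewrite ler_norml cos_geN1 cos_le1. Qed.

Lemma trig_cst a : mclosure trig (fun=> a).
Proof.
have mT := mclosure_class trig.
have h1 : mclosure trig (fun=> 1).
  apply: mclosure_sub; exists 0, 0; apply/funext => x.
  by rewrite ell0 addr0 cos0.
have h0 : mclosure trig (fun=> 0).
  by have := mclass_lin mT (-1) h1 h1; rewrite mulr1 addNr.
by have := mclass_lin mT a h1 h0; rewrite mulr1 addr0.
Qed.

Lemma trig_mul f g : trig f -> trig g -> mclosure trig (fun x => f x * g x).
Proof.
move=> [u [a ->]] [v [b ->]].
have e x : cos (ell u x + a) * cos (ell v x + b) =
    2^-1 * cos (ell (u + v) x + (a + b)) + 2^-1 * cos (ell (u - v) x + (a - b)).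
  have -> : ell (u + v) x + (a + b) = (ell u x + a) + (ell v x + b).
    by rewrite ellD; ring.
  have -> : ell (u - v) x + (a - b) = (ell u x + a) - (ell v x + b).
    by rewrite ellB; ring.
  move: (ell u x + a) (ell v x + b) => p q.
  by rewrite cosD cosB; field.
under eq_fun do rewrite e.
have mT := mclosure_class trig.
apply: (mclass_lin mT 2^-1); first by apply: mclosure_sub; exists (u + v), (a + b).
by apply: mclosure_scale trig_cst _ _ _; apply: mclosure_sub; exists (u - v), (a - b).
Qed.

(* The sign of sin (y / n) is the sign of y once n is large. *)
Lemma trig_gt v r : mclosure trig \1_[set x | r < ell v x].
Proof.
pose f n x := cos (ell (n.+1%:R^-1 *: v) x + (- r / n.+1%:R - pi / 2)).
have fE n x : f n x = sin ((ell v x - r) / n.+1%:R).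
  rewrite /f ellZ addrA cosBpihalf; congr sin; rewrite mulrBl mulNr mulrC.
  by [].
apply: (mclass_lim (mclosure_class trig) (f_ := fun n => \1_[set x | 0 < f n x]) (M := 1)).
- move=> n; apply: mclosure_gt0 => //; [exact: trig_bounded|exact: trig_mul|exact: trig_cst| |].
  + by move=> x; rewrite /f ler_norml cos_geN1 cos_le1.
  + by apply: mclosure_sub; exists (n.+1%:R^-1 *: v), (- r / n.+1%:R - pi / 2).
- by move=> n x; rewrite indicE; case: (_ \in _); rewrite ?normr1 ?normr0.
- move=> x; set y := ell v x - r.
  have yn : `|y| / n.+1%:R @[n --> \oo] --> 0.
    rewrite -[X in _ --> X](mulr0 `|y|); apply: cvgM; first exact: cvg_cst.
    exact: cvg_harmonic.
  apply: cvg_near_cst; near=> n.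
  have n0 : 0 < n.+1%:R :> R by [].
  have lt_pi : `|y| / n.+1%:R < pi.
    by near: n; apply: (cvgr_lt _ yn); exact: pi_gt0.
  rewrite !indic_bool fE -/y; congr (nat_of_bool _)%:R.
  rewrite -(subr_gt0 r) -/y; case: (ltP 0 y) => y0.
    by rewrite ger0_norm ?ltW// in lt_pi; rewrite sin_gt0_pi// divr_gt0.
  apply/negbTE; rewrite -leNgt -[leLHS]opprK -sinN oppr_le0 sin_ge0_pi//.
  rewrite -mulNr divr_ge0 ?oppr_ge0//=.
  by move: lt_pi; rewrite ler0_norm// => /ltW.
Unshelve. all: end_near.
Qed.

Lemma trig_sigma_algebra : sigma_algebra setT [set B | mclosure trig \1_B].
Proof.
exact: (mclosure_sigma_algebra trig_bounded trig_mul trig_cst).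
Qed.

End Trig.

(** * Bounded Borel functions on H *)

Section RealLine.
Context {R : realType}.

(** By [trig_gt] the rays ]r, +oo[ are in the closure; they generate the Borel sets, whose
    indicators generate the bounded Borel functions. *)
Lemma trig_induct_R (C : (R -> R) -> Prop) : monotone_class C ->
  (forall a th, C (fun y => cos (a * y + th))) -> forall f, bdd_meas f -> C f.
Proof.
move=> mC Ccos f bf; pose ell (a : R^o) (y : R) : R := a * y.
have ell_lin a u v x : ell (a *: u + v) x = a * ell u x + ell v x.
  by rewrite /ell mulrDl -mulrA.
suff : mclosure (trig ell) f.
  by apply: (mclosure_ind mC) => _ [a [th ->]]; exact: Ccos.
apply: bdd_meas_mclosure bf; first exact: trig_cst.
move=> B; rewrite [X in X -> _](_ : _ = (@RGenOInfty.G R).-sigma.-measurable B); last first.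
  by rewrite -RGenOInfty.measurableE.
apply: (@smallest_sub _ _ _ [set B | mclosure (trig ell) \1_B]).
  exact: trig_sigma_algebra.
move=> _ [r ->]; have /= := trig_gt ell_lin 1 r.
congr (mclosure _ (\1_ _)); apply/seteqP; split => y /=;
  by rewrite in_itv/= andbT /ell mul1r.
Qed.

End RealLine.

Section InnerProduct.
Context {R : realType} {H : completeNormedModType R} (ip : H -> H -> R).
Hypothesis ip_inner : inner_product ip.
Let ipC := ipC ip_inner.

Lemma ipDl x y z : ip (x + y) z = ip x z + ip y z.
Proof. by rewrite -[x]scale1r (ipDZl ip_inner) scale1r mul1r. Qed.

Lemma ip0l z : ip 0 z = 0.
Proof. by have := ipDl 0 0 z; rewrite addr0; lra. Qed.

Lemma ipZl a x z : ip (a *: x) z = a * ip x z.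
Proof. by rewrite -[_ *: _]addr0 (ipDZl ip_inner) ip0l addr0. Qed.

Lemma ipNl x z : ip (- x) z = - ip x z.
Proof. by rewrite -scaleN1r ipZl mulN1r. Qed.

Lemma ipBl x y z : ip (x - y) z = ip x z - ip y z.
Proof. by rewrite ipDl ipNl. Qed.

Lemma ipDr x y z : ip x (y + z) = ip x y + ip x z.
Proof. by rewrite ipC ipDl !(ipC _ x). Qed.

Lemma ip0r x : ip x 0 = 0.
Proof. by rewrite ipC ip0l. Qed.

Lemma ipZr a x y : ip x (a *: y) = a * ip x y.
Proof. by rewrite ipC ipZl ipC. Qed.

Lemma ipBr x y z : ip x (y - z) = ip x y - ip x z.
Proof. by rewrite ipC ipBl !(ipC _ x). Qed.

Lemma ip_linr a u v x : ip x (a *: u + v) = a * ip x u + ip x v.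
Proof. by rewrite ipDr ipZr. Qed.

Lemma ip_suml (I : Type) (s : seq I) (F : I -> H) z :
  ip (\sum_(i <- s) F i) z = \sum_(i <- s) ip (F i) z.
Proof.
elim: s => [|i s ih]; first by rewrite !big_nil ip0l.
by rewrite !big_cons ipDl ih.
Qed.

Lemma ip_ge0 x : 0 <= ip x x.
Proof. by rewrite (ip_norm ip_inner) sqr_ge0. Qed.

Lemma cauchy_schwarz x y : `|ip x y| <= `|x| * `|y|.
Proof.
have [->|y0] := eqVneq y 0; first by rewrite ip0r !normr0 mulr0.
have ny : 0 < `|y| by rewrite normr_gt0.
have := ip_ge0 (`|y| ^+ 2 *: x - ip x y *: y).
rewrite ipBl !ipBr !ipZl !ipZr !(ip_norm ip_inner) (ipC y x) => h.
rewrite -(ler_pXn2r (n := 2))// ?nnegrE ?mulr_ge0// real_normK ?num_real// exprMn.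
have : 0 <= `|y| ^+ 2 * (`|x| ^+ 2 * `|y| ^+ 2 - ip x y ^+ 2) by move: h; rewrite !expr2; lra.
by rewrite pmulr_rge0 ?exprn_gt0// subr_ge0.
Qed.

Lemma ip_continuous h : continuous (ip^~ h).
Proof.
move=> x; apply/cvgrPdist_le => e e0.
near=> z; rewrite -ipBl (le_trans (cauchy_schwarz _ _))//.
have h1 : 0 < `|h| + 1 by rewrite ltr_wpDl.
apply: (@le_trans _ _ (`|x - z| * (`|h| + 1))); first by rewrite ler_wpM2l// lerDl.
rewrite -ler_pdivlMr//; near: z.
by apply: cvgr_dist_le; [exact: cvg_id|rewrite divr_gt0].
Unshelve. all: end_near.
Qed.

Lemma measurable_ip h : measurable_fun setT (ip^~ h : borel H -> R).
Proof.
apply: (measurability _ (RGenOInfty.measurableE R)) => _ [_ [r ->] <-].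
rewrite setTI; apply: sub_sigma_algebra.
by apply: open_comp (rray_open r) => x _; exact: ip_continuous.
Qed.

End InnerProduct.

Section BorelH.
Context {R : realType} {H : completeNormedModType R}.

Lemma measurable_continuous (f : H -> R) : continuous f ->
  measurable_fun setT (f : borel H -> R).
Proof.
move=> cf; apply: (measurability _ (RGenOInfty.measurableE R)) => _ [_ [r ->] <-].
rewrite setTI; apply: sub_sigma_algebra.
by apply: open_comp (rray_open r) => x _; exact: cf.
Qed.

Lemma Cb_bdd_meas (f : H -> R) : Cb f -> bdd_meas (f : borel H -> R).
Proof. by move=> [cf [M fM]]; split; [exact: measurable_continuous|exists M]. Qed.

Lemma dense_sequence : separable (H := H) ->
  exists u : nat -> H, forall x (e : R), 0 < e -> exists n, `|x - u n| < e.
Proof.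
move=> [D [/countable_injP[f finj] dD]].
(* An index outside the image of [f] yields an arbitrary point, which does no harm. *)
exists (fun n => get [set x | D x /\ f x = n]) => x e e0.
have /(_ (ball x e)) := dD.
case=> [||y [xy Dy]]; [by exists x; exact: ballxx|exact: ball_open|].
exists (f y); rewrite (_ : get _ = y); first by rewrite -ball_normE in xy.
have : [set z | D z /\ f z = f y] (get [set z | D z /\ f z = f y]) by apply: getPex; exists y.
by move=> [Dz fz]; apply: finj; rewrite ?inE.
Qed.

Variable ip : H -> H -> R.
Hypothesis ip_inner : inner_product ip.
Hypothesis H_sep : separable (H := H).

(** Half-spaces are the sets that cosines of <x, h> reach; this turns a closed ball into a countable
    intersection of them. *)
Lemma norm_le_dense (u : nat -> H) (y : H) (r : R) : 0 <= r ->
  (forall x e, 0 < e -> exists n, `|x - u n| < e) ->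
  (`|y| <= r) <-> (forall n, ip y (u n) <= r * `|u n|).
Proof.
move=> r0 du; split=> [yr n|h].
  by rewrite (le_trans (ler_norm _))// (le_trans (cauchy_schwarz ip_inner _ _))// ler_wpM2r.
rewrite leNgt; apply/negP => ry.
have y0 : 0 < `|y| by exact: le_lt_trans ry.
(* The radius is the one for which |y|^2 - |y| |y - u n| > r (|y| + |y - u n|); the left side is at
   most <y, u n> and the right side at least r |u n|. *)
have [|n un] := du y (`|y| * (`|y| - r) / (`|y| + r)).
  by rewrite divr_gt0 ?mulr_gt0 ?subr_gt0// ltr_wpDr.
rewrite ltr_pdivlMr ?ltr_wpDr// in un.
have e1 : ip y (u n) = `|y| ^+ 2 - ip y (y - u n).
  by rewrite (ipBr ip_inner) (ip_norm ip_inner); ring.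
have e2 := le_trans (ler_norm _) (cauchy_schwarz ip_inner y (y - u n)).
have e3 : `|u n| <= `|y| + `|y - u n|.
  by rewrite -{1}(subKr y (u n)) (le_trans (ler_normB _ _)).
have := h n; rewrite e1; have := ler_wpM2l r0 e3.
by move: un e2; nra.
Qed.

(** Complements of closed balls are countable unions of half-spaces, and separability makes every
    open set a countable union of closed balls, with centers in the dense sequence and radii 1/(k +
    1). *)
Lemma trigH_ind_indic (B : set (borel H)) : measurable B ->
  mclosure (trig (fun h x => ip x h)) \1_B.
Proof.
have ell_lin a u v x : ip x (a *: u + v) = a * ip x u + ip x v.
  exact: ip_linr.
pose G := [set B : set H | mclosure (trig (fun h x => ip x h)) \1_B].
have [G0 GD GU] : sigma_algebra setT G by exact: trig_sigma_algebra.
have GC A : G A -> G (~` A) by move=> /GD; rewrite setTD.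
apply: (@smallest_sub _ _ _ G) => // O oO.
have [u du] := dense_sequence H_sep.
have Gball c r : 0 <= r -> G [set x | `|x - c| <= r].
  move=> r0; have -> : [set x | `|x - c| <= r] =
      ~` \bigcup_n [set x | r * `|u n| + ip c (u n) < ip x (u n)].
    apply/seteqP; split => x /=.
      move=> /(norm_le_dense _ r0 du) xr [n _ /=].
      by have := xr n; rewrite (ipBl ip_inner) => ?; rewrite ltNge; lra.
    move=> nx; apply/(norm_le_dense _ r0 du) => n; rewrite (ipBl ip_inner).
    rewrite lerBlDr leNgt; apply/negP => xn; apply: nx; exists n => //.
  by apply: GC; apply: GU => n; exact: trig_gt.
have -> : O = \bigcup_n \bigcup_k
    (if `[< [set x | `|x - u n| <= k.+1%:R^-1] `<=` O >]
     then [set x | `|x - u n| <= k.+1%:R^-1] else set0).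
  apply/seteqP; split => [x Ox|x [n _ [k _]]]; last by case: asboolP => // + xO; apply.
  have /nbhs_ballP[e /= e0 xeO] : nbhs x O by exact: open_nbhs_nbhs.
  have e20 : 0 < e / 2 by rewrite divr_gt0.
  have [k] := ltr_add_invr e20; rewrite add0r => ke.
  have k0 : 0 < k.+1%:R^-1 :> R by rewrite invr_gt0.
  have [n xn] := du x _ k0.
  exists n => //; exists k => //; rewrite asboolT; first exact/ltW.
  move=> z /= zn; apply: xeO; rewrite -ball_normE /=.
  rewrite -[x](subrK (u n)) -addrA (le_lt_trans (ler_normD _ _))//.
  by rewrite (distrC _ z) (splitr e) ltr_leD// ?(lt_trans xn) ?(le_trans zn) ?ltW.
apply: (GU) => n; apply: (GU) => k; case: asboolP => _ //.
exact: Gball.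
Qed.

Lemma trig_induct_H (C : (borel H -> R) -> Prop) : monotone_class C ->
  (forall h th, C (fun x => cos (ip x h + th))) -> forall f, bdd_meas f -> C f.
Proof.
move=> mC Ccos f bf; suff : mclosure (trig (fun h x => ip x h)) f.
  by apply: (mclosure_ind mC) => _ [h [th ->]]; exact: Ccos.
apply: bdd_meas_mclosure bf; last exact: trigH_ind_indic.
by apply: trig_cst => *; exact: ip_linr.
Qed.

End BorelH.

(** * Laws determined by means of cosines; Gaussian laws on the line *)

Section Laws.
Context {R : realType}.

Lemma indic_induct d (T : measurableType d) (C : (T -> R) -> Prop) : monotone_class C ->
  (forall B, measurable B -> C \1_B) -> forall f, bdd_meas f -> C f.
Proof.
move=> mC Cind f bf; pose A (g : T -> R) := exists2 B, measurable B & g = \1_B.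
have mA := mclosure_class A.
suff : mclosure A f by apply: (mclosure_ind mC) => _ [B mB ->]; exact: Cind.
apply: bdd_meas_mclosure bf => [a|B mB]; last by apply: mclosure_sub; exists B.
have h1 : mclosure A \1_setT by apply: mclosure_sub; exists setT.
have h0 : mclosure A \1_set0 by apply: mclosure_sub; exists set0.
have := mclass_lin mA a h1 h0; congr mclosure; apply/funext => x.
by rewrite indicT indic0 mulr1 addr0.
Qed.

Lemma expect_indic d (T : measurableType d) (P : probability T R) B : measurable B ->
  \int[P]_x \1_B x = fine (P B).
Proof. by move=> mB; rewrite /Rintegral integral_indic// setIT. Qed.

Lemma measure_eq_expect d (T : measurableType d) (P1 P2 : probability T R) :
  (forall f, bdd_meas f -> \int[P1]_x f x = \int[P2]_x f x) ->
  forall B, measurable B -> P1 B = P2 B.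
Proof.
move=> h B mB; rewrite -(fineK (fin_num_measure P1 B mB)) -(fineK (fin_num_measure P2 B mB)).
by congr EFin; rewrite -!expect_indic// h//; exact: bdd_meas_indic.
Qed.

Lemma bdd_meas_comp d d' (T : measurableType d) (T' : measurableType d') (X : T -> T')
  (f : T' -> R) : measurable_fun setT X -> bdd_meas f -> bdd_meas (fun x => f (X x)).
Proof. by move=> mX [mf [M fM]]; split; [exact: measurableT_comp|exists M => x]. Qed.

Lemma law_expect d d' (T : measurableType d) (T' : measurableType d')
  (P : probability T R) (X : T -> T') (nu : probability T' R) :
  measurable_fun setT X -> (forall B, measurable B -> P (X @^-1` B) = nu B) ->
  forall f, bdd_meas f -> \int[nu]_y f y = \int[P]_x f (X x).
Proof.
move=> mX law f bf.
pose C (f : T' -> R) := bdd_meas f /\ \int[nu]_y f y = \int[P]_x f (X x).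
suff [] : C f by [].
apply: (indic_induct (C := C) _ _ bf) => {f bf} [|B mB]; last first.
  split; first exact: bdd_meas_indic.
  have mXB : measurable (X @^-1` B) by rewrite -[X in measurable X]setTI; exact: mX.
  by rewrite expect_indic// -law// -expect_indic.
split=> [a f g [bf ef] [bg eg]|f_ f M ef fM ff].
  split; first exact: bdd_meas_lin.
  by rewrite !expect_lin ?ef ?eg//; exact: bdd_meas_comp.
have bf n : bdd_meas (f_ n) by case: (ef n).
split; first exact: (bdd_meas_lim bf fM ff).
have c1 := expect_cvg (P := nu) bf fM ff.
have c2 := expect_cvg (P := P) (fun n => bdd_meas_comp mX (bf n))
  (fun n x => fM n (X x)) (fun x => ff (X x)).
have e : (fun n => \int[nu]_x f_ n x) = (fun n => \int[P]_x f_ n (X x)).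
  by apply/funext => n; case: (ef n).
by rewrite e in c1; apply: (cvg_unique _ c1 c2).
Qed.

(** Uniqueness of characteristic functions, obtained from the monotone class of functions with equal
    means instead of Fourier inversion. *)
Lemma expect_eq_R (P1 P2 : probability R R) :
  (forall a th, \int[P1]_y cos (a * y + th) = \int[P2]_y cos (a * y + th)) ->
  forall f : R -> R, bdd_meas f -> \int[P1]_y f y = \int[P2]_y f y.
Proof.
move=> h f bf; have := trig_induct_R (same_expect_class P1 P2) _ bf.
case=> // a th; split => //; split; last by exists 1 => y; rewrite ler_norml cos_geN1 cos_le1.
apply: measurableT_comp; first by apply: continuous_measurable_fun; exact: continuous_cos.
by apply: measurable_funD => //; exact: measurable_funM.
Qed.

Lemma expect_eq_H (H : completeNormedModType R) (ip : H -> H -> R)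
  (P1 P2 : probability (borel H) R) : inner_product ip -> separable (H := H) ->
  (forall h th, \int[P1]_y cos (ip y h + th) = \int[P2]_y cos (ip y h + th)) ->
  forall f : borel H -> R, bdd_meas f -> \int[P1]_y f y = \int[P2]_y f y.
Proof.
move=> ip_inner H_sep h f bf.
have := trig_induct_H ip_inner H_sep (same_expect_class P1 P2) _ bf.
case=> // a th; split => //; split; last by exists 1 => y; rewrite ler_norml cos_geN1 cos_le1.
apply: measurableT_comp; first by apply: continuous_measurable_fun; exact: continuous_cos.
by apply: measurable_funD => //; exact: measurable_ip.
Qed.

Lemma lebesgue_measure_shift (m : R) (A : set R) : measurable A ->
  pushforward lebesgue_measure ((fun y => y + m) : _ -> measurableTypeR R) A =
  lebesgue_measure A.
Proof.
have mshift : measurable_fun setT ((fun y => y + m) : R -> measurableTypeR R).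
  exact: measurable_funD.
move=> mA; apply/esym/lebesgue_measure_unique => //= _ [[a b]] _ <-.
rewrite /pushforward.
rewrite (_ : _ @^-1` _ = `]a - m, b - m]%classic); last first.
  by apply/seteqP; split => x /=; rewrite !in_itv/= ltrBlDr lerBrDr.
by rewrite !lebesgue_measure_itv/= !lte_fin ltrD2r -!EFinD; case: ifP => // _; congr EFin; lra.
Qed.

Lemma normal_prob_shift (m s : R) (B : set R) : s != 0 -> measurable B ->
  normal_prob m s B = normal_prob 0 s ((fun y => y + m) @^-1` B).
Proof.
move=> s0 mB; rewrite /normal_prob.
have mshift : measurable_fun setT ((fun y => y + m) : R -> measurableTypeR R).
  exact: measurable_funD.
have e : (fun y => (normal_pdf m s (y + m))%:E) = (fun y => (normal_pdf 0 s y)%:E).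
  by apply/funext => y; rewrite !normal_pdfE// /normal_fun addrK subr0.
rewrite -e; pose sh (y : R) : measurableTypeR R := y + m.
transitivity (\int[pushforward lebesgue_measure sh]_(y in B)
  (normal_pdf m s y)%:E)%E.
  by apply: eq_measure_integral => //= A mA AS; exact/esym/lebesgue_measure_shift.
rewrite ge0_integral_pushforward//.
- by apply/measurable_EFinP/measurable_funTS; exact: measurable_normal_pdf.
- by move=> y _; rewrite lee_fin normal_pdf_ge0.
Qed.

(* [normal_prob] lives on [measurableTypeR R], a structure on [R] with another
   display than the canonical one. *)
Definition idR (x : measurableTypeR R) : R := x.

Lemma measurable_idR : measurable_fun setT idR.
Proof. exact: measurable_id. Qed.

HB.instance Definition _ := isMeasurableFun.Build _ _ _ _ idR measurable_idR.

(** [gauss1] bundled as a probability on the canonical [R], so that expectations can be taken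
    against it; transport along [idR] changes the display only. *)
Definition gauss_law (m v : R) : probability R R :=
  if v == 0 then (dirac m : probability R R)
  else (distribution (normal_prob m (Num.sqrt v) : probability _ _) idR : probability R R).

Lemma gauss1E (m v : R) (B : set R) : gauss1 m v B = gauss_law m v B.
Proof. by rewrite /gauss1 /gauss_law; case: ifP. Qed.

Lemma gauss_law_shift (m v : R) (B : set R) : 0 <= v -> measurable B ->
  gauss_law 0 v ((fun y => y + m) @^-1` B) = gauss_law m v B.
Proof.
move=> v0 mB; rewrite /gauss_law; case: eqVneq => [_|vN0].
  by rewrite /= /dirac !indicE; congr (_%:E); congr (nat_of_bool _)%:R;
    apply/idP/idP; rewrite !inE /= add0r.
by rewrite /= [RHS]normal_prob_shift// gt_eqF// sqrtr_gt0 lt_def vN0.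
Qed.

Lemma gauss_law_expect (m v : R) (f : R -> R) : 0 <= v -> bdd_meas f ->
  \int[gauss_law m v]_y f y = \int[gauss_law 0 v]_y f (y + m).
Proof.
move=> v0 bf; apply: (law_expect (X := fun y : R => y + m : R)) => //.
  exact: measurable_funD.
by move=> B mB; exact: gauss_law_shift.
Qed.

(** The law has a density. [eigenbasis_exists] draws its contradiction from the absence of atoms. *)
Lemma gauss_law_point (m v y : R) : 0 < v -> gauss_law m v [set y] = 0%E.
Proof.
move=> v0; rewrite /gauss_law gt_eqF//=.
by rewrite /normal_prob integral_set1.
Qed.

End Laws.

(** * Wiener integrals *)

Lemma within_continuous_seq {R : realType} {U : topologicalType} (A : set R) (f : R -> U)
  (u : nat -> R) x : {within A, continuous f} -> A x -> (forall n, A (u n)) ->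
  u n @[n --> \oo] --> x -> f (u n) @[n --> \oo] --> f x.
Proof.
move=> /subspace_continuousP cf Ax Au ux B /(cf x Ax) /ux [N _ hN].
by exists N => // n Nn; apply: (hN n Nn); exact: Au.
Qed.

Section AlmostEverywhere.
Context d (T : measurableType d) (R : realType) (P : probability T R).

Lemma expect_ae (f g : T -> R) : measurable_fun setT f -> measurable_fun setT g ->
  {ae P, forall x, f x = g x} -> \int[P]_x f x = \int[P]_x g x.
Proof.
move=> mf mg fg; congr fine; apply: ae_eq_integral => //.
- exact/measurable_EFinP.
- exact/measurable_EFinP.
- by apply: filterS fg => x -> _.
Qed.

Lemma expect_cvg_ae (f_ : nat -> T -> R) (f : T -> R) (M : R) : (forall n, measurable_fun setT (f_ n)) ->
  measurable_fun setT f -> {ae P, forall x, forall n, `|f_ n x| <= M} ->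
  {ae P, forall x, f_ n x @[n --> \oo] --> f x} ->
  \int[P]_x f_ n x @[n --> \oo] --> \int[P]_x f x.
Proof.
move=> mf_ mf fM ff.
have [|||||/= h1 h2 h3] := @dominated_convergence _ _ _ P _ measurableT
  (fun n x => (f_ n x)%:E) (EFin \o f) (cst M%:E).
- by move=> n; exact/measurable_EFinP.
- exact/measurable_EFinP.
- by apply: filterS ff => x cx _; apply: cvg_EFin => //; exact: nearW.
- exact: (bdd_meas_integrable P (bdd_meas_cst _ M)).
- by apply: filterS fM => x cx n _; rewrite lee_fin.
apply: fine_cvg; rewrite fineK; first exact: h3.
exact: integrable_fin_num.
Qed.

End AlmostEverywhere.

Section TrigMeasurable.
Context d (T : measurableType d) (R : realType).
Implicit Types f : T -> R.

Lemma bdd_meas_cos f : measurable_fun setT f -> bdd_meas (fun x => cos (f x)).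
Proof.
move=> mf; split; last by exists 1 => x; rewrite ler_norml cos_geN1 cos_le1.
apply: measurableT_comp => //; apply: continuous_measurable_fun; exact: continuous_cos.
Qed.

Lemma bdd_meas_sin f : measurable_fun setT f -> bdd_meas (fun x => sin (f x)).
Proof.
move=> mf; split; last by exists 1 => x; rewrite ler_norml sin_geN1 sin_le1.
apply: measurableT_comp => //; apply: continuous_measurable_fun; exact: continuous_sin.
Qed.

End TrigMeasurable.

Section Independence.
Context d (T : measurableType d) (R : realType) (P : probability T R).

Let factor_class d' (T' : measurableType d') (X : T -> T') (Z : T -> R) (k : R) :
  measurable_fun setT X -> bdd_meas Z -> monotone_class (fun f : T' -> R =>
    bdd_meas f /\ \int[P]_x (f (X x) * Z x) = \int[P]_x f (X x) * k).
Proof.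
move=> mX bZ; have bfZ (f : T' -> R) : bdd_meas f -> bdd_meas (fun x => f (X x) * Z x).
  by move=> bf; apply: bdd_measM => //; exact: bdd_meas_comp.
split=> [a f g [bf ef] [bg eg]|f_ f M ef fM ff].
  split; first exact: bdd_meas_lin.
  rewrite expect_lin ?mulrDl; [|exact: bdd_meas_comp|exact: bdd_meas_comp].
  rewrite -mulrA -ef -eg -expect_lin; [|exact: bfZ|exact: bfZ].
  by congr Rintegral; apply/funext => x; ring.
have bf n : bdd_meas (f_ n) by case: (ef n).
split; first exact: (bdd_meas_lim bf fM ff).
have [_ [N ZN]] := bZ.
have c1 : \int[P]_x (f_ n (X x) * Z x) @[n --> \oo] --> \int[P]_x (f (X x) * Z x).
  apply: (expect_cvg (M := M * N)); first by move=> n; exact: bfZ.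
    by move=> n x; rewrite normrM ler_pM.
  by move=> x; apply: cvgM; [exact: ff|exact: cvg_cst].
have c2 : \int[P]_x (f_ n (X x)) * k @[n --> \oo] --> \int[P]_x (f (X x)) * k.
  apply: cvgM; last exact: cvg_cst.
  by apply: (expect_cvg (M := M)) => [n|n x|x]; [exact: bdd_meas_comp|exact: fM|exact: ff].
have e : (fun n => \int[P]_x (f_ n (X x) * Z x)) = (fun n => \int[P]_x f_ n (X x) * k).
  by apply/funext => n; case: (ef n).
by rewrite e in c1; apply: (cvg_unique _ c1 c2).
Qed.

(** [factor_class] reduces [f] and then [g] to indicators; its [Z] is an arbitrary bounded random
    variable so that it applies both times. *)
Lemma expect_indep d1 (T1 : measurableType d1) d2 (T2 : measurableType d2)
  (X : T -> T1) (Y : T -> T2) (f : T1 -> R) (g : T2 -> R) :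
  measurable_fun setT X -> measurable_fun setT Y ->
  (forall A B, measurable A -> measurable B ->
    P (X @^-1` A `&` Y @^-1` B) = (P (X @^-1` A) * P (Y @^-1` B))%E) ->
  bdd_meas f -> bdd_meas g ->
  \int[P]_x (f (X x) * g (Y x)) = \int[P]_x f (X x) * \int[P]_x g (Y x).
Proof.
move=> mX mY indep bf bg; have bgY := bdd_meas_comp mY bg.
have [] // := indic_induct (factor_class (\int[P]_x g (Y x)) mX bgY) _ bf.
move=> A mA; split; first exact: bdd_meas_indic.
have mXA : measurable (X @^-1` A) by rewrite -[X in measurable X]setTI; exact: mX.
have bA := bdd_meas_indic R mXA.
have [] // := indic_induct (factor_class (\int[P]_x \1_(X @^-1` A) x) mY bA) _ bg; last first.
  move=> _; rewrite [RHS]mulrC => <-; congr Rintegral; apply/funext => x; rewrite mulrC.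
  by [].
move=> B mB; split; first exact: bdd_meas_indic.
have mYB : measurable (Y @^-1` B) by rewrite -[X in measurable X]setTI; exact: mY.
have e1 : (fun x => \1_B (Y x) * \1_(X @^-1` A) x) = \1_(X @^-1` A `&` Y @^-1` B) :> (T -> R).
  by rewrite indicI; apply/funext => x /=; rewrite mulrC.
have e2 : (fun x => \1_B (Y x)) = \1_(Y @^-1` B) :> (T -> R) by [].
rewrite e1 e2 !expect_indic//; last exact: measurableI.
by rewrite indep// fineM ?fin_num_measure// mulrC.
Qed.

End Independence.

Section Wiener.
Context {R : realType} {H : completeNormedModType R} (ip : H -> H -> R).
Context {d : measure_display} {Omega : measurableType d} (P : probability Omega R).
Variables (F : R -> set_system Omega) (W : R -> H -> Omega -> R).
Hypothesis ip_inner : inner_product ip.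
Hypothesis F_filt : filtration F.
Hypothesis W_wiener : cylindrical_wiener ip P F W.

Lemma wiener_measurable t h : 0 <= t -> measurable_fun setT (W t h).
Proof.
move=> t0 _ B mB; rewrite setTI; apply: (filt_sub F_filt t0).
exact: (wiener_adapted W_wiener h t0 mB).
Qed.

Lemma wiener_incr_measurable s t h : 0 <= s -> 0 <= t ->
  measurable_fun setT (fun w => W t h w - W s h w).
Proof. by move=> s0 t0; apply: measurable_funB; exact: wiener_measurable. Qed.

Lemma wiener_ae0 t : 0 <= t -> {ae P, forall w, W t 0 w = 0}.
Proof.
move=> t0; have := wiener_linear W_wiener 1 0 0 t0; apply: filterS => w.
rewrite scaler0 addr0; lra.
Qed.

Lemma wiener_scale t a h : 0 <= t -> {ae P, forall w, W t (a *: h) w = a * W t h w}.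
Proof.
move=> t0; apply: filterS2 (wiener_linear W_wiener a h 0 t0) (wiener_ae0 t0) => w.
by rewrite addr0 => -> ->; rewrite addr0.
Qed.

Lemma wiener_incr_expect s t h (f : R -> R) : 0 <= s -> s <= t -> bdd_meas f ->
  \int[P]_w f (W t h w - W s h w) = \int[gauss_law 0 ((t - s) * ip h h)]_y f y.
Proof.
move=> s0 st bf; apply/esym/law_expect => //.
  by apply: wiener_incr_measurable => //; exact: le_trans st.
by move=> B mB; rewrite -gauss1E -(wiener_gauss W_wiener h s0 st mB).
Qed.

(* The value exp (- v / 2) is never needed: [gcosD] follows from the independence
   of the increments of W. *)
Definition gcos (v : R) : R := \int[gauss_law 0 v]_y cos y.

Variable e : H.
Hypothesis e_unit : ip e e = 1.

Let mW v : 0 <= v -> measurable_fun setT (fun w => W v e w - W 0 e w).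
Proof. by move=> v0; exact: wiener_incr_measurable. Qed.

Let incr_e v (f : R -> R) : 0 <= v -> bdd_meas f ->
  \int[gauss_law 0 v]_y f y = \int[P]_w f (W v e w - W 0 e w).
Proof. by move=> v0 bf; rewrite (wiener_incr_expect e (lexx 0) v0 bf) e_unit subr0 mulr1. Qed.

Let bcos : bdd_meas (@cos R). Proof. by apply: (bdd_meas_cos (f := id)); exact: measurable_id. Qed.
Let bsin : bdd_meas (@sin R). Proof. by apply: (bdd_meas_sin (f := id)); exact: measurable_id. Qed.

(** The image of N(0, v) under y -> a y is read off [W]: almost surely the increment in the
    direction a e is a times the one in the direction e, and its variance is a^2 v. *)
Let scale_law v a (f : R -> R) : 0 <= v -> bdd_meas f -> 
  \int[gauss_law 0 v]_y f (a * y) = \int[gauss_law 0 (a ^+ 2 * v)]_y f y.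
Proof.
move=> v0 bf; have bfa : bdd_meas (fun y => f (a * y)).
  by apply: bdd_meas_comp bf; exact: measurable_funM.
have -> : a ^+ 2 * v = (v - 0) * ip (a *: e) (a *: e).
  by rewrite (ipZl ip_inner) (ipZr ip_inner) e_unit; ring.
apply: (etrans (incr_e v0 bfa)).
apply: (etrans _ (wiener_incr_expect (a *: e) (lexx 0) v0 bf)).
apply: expect_ae.
- by apply: measurableT_comp bfa.1 _; exact: mW.
- by apply: measurableT_comp bf.1 _; exact: wiener_incr_measurable.
- apply: filterS2 (wiener_scale a e v0) (wiener_scale a e (lexx 0)) => w -> ->.
  by rewrite mulrBr.
Qed.

(** After the rescaling, the addition formula leaves a sine, which has mean 0 because the law is
    symmetric; the symmetry is [scale_law] for the factor -1. *)
Lemma gauss_law_cos v a th : 0 <= v ->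
  \int[gauss_law 0 v]_y cos (a * y + th) = cos th * gcos (a ^+ 2 * v).
Proof.
move=> v0; have a2v : 0 <= a ^+ 2 * v by rewrite mulr_ge0// sqr_ge0.
have bcth : bdd_meas (fun y : R => cos (y + th)).
  by apply: bdd_meas_cos; exact: measurable_funD.
rewrite (scale_law a v0 bcth).
have -> : (fun y : R => cos (y + th)) = (fun y => cos th * cos y + (- sin th) * sin y).
  by apply/funext => y; rewrite cosD; ring.
have sin0 : \int[gauss_law 0 (a ^+ 2 * v)]_y sin y = 0.
  have := scale_law (-1) a2v bsin; rewrite sqrrN expr1n mul1r.
  have -> : (fun y : R => sin (-1 * y)) = (fun y => -1 * sin y).
    by apply/funext => y; rewrite !mulN1r sinN.
  by rewrite expectZ//; lra.
rewrite expect_lin//; last exact: bdd_measZ.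
by rewrite expectZ// sin0 mulr0 addr0.
Qed.

Lemma gcos0 : gcos 0 = 1.
Proof.
rewrite /gcos (incr_e (lexx 0) bcos); under eq_Rintegral do rewrite subrr cos0.
exact: expect_cst.
Qed.

(** Along the unit vector [e], W(u) and W(u + v) - W(u) are independent with variances u and v; in
    the addition formula for the cosine, the product of sines has mean 0. *)
Lemma gcosD (u v : R) : 0 <= u -> 0 <= v -> gcos (u + v) = gcos u * gcos v.
Proof.
move=> u0 v0; have uv : u <= u + v by rewrite lerDl.
have uv0 : 0 <= u + v by exact: addr_ge0.
have indep (f g : R -> R) : bdd_meas f -> bdd_meas g ->
    \int[P]_w (f (W u e w) * g (W (u + v) e w - W u e w)) =
    \int[P]_w f (W u e w) * \int[P]_w g (W (u + v) e w - W u e w).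
  apply: expect_indep; [exact: wiener_measurable|exact: wiener_incr_measurable|].
  move=> A B mA mB; apply: (wiener_indep W_wiener) => //.
  exact: (wiener_adapted W_wiener).
have W0 (f : R -> R) x : 0 <= x -> bdd_meas f ->
    \int[P]_w f (W x e w) = \int[gauss_law 0 x]_y f y.
  move=> x0 bf; rewrite (incr_e x0 bf); apply: expect_ae.
  - by apply: measurableT_comp bf.1 _; exact: wiener_measurable.
  - by apply: measurableT_comp bf.1 _; exact: mW.
  - by apply: filterS (wiener0 W_wiener e) => w ->; rewrite subr0.
have incr (f : R -> R) : bdd_meas f ->
    \int[P]_w f (W (u + v) e w - W u e w) = \int[gauss_law 0 v]_y f y.
  by move=> bf; rewrite (wiener_incr_expect e u0 uv bf) e_unit mulr1 addrAC subrr add0r.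
rewrite {1}/gcos -(W0 _ _ uv0 bcos).
have bc x : 0 <= x -> bdd_meas (fun w => cos (W x e w)).
  by move=> x0; apply: bdd_meas_cos; exact: wiener_measurable.
have bs x : 0 <= x -> bdd_meas (fun w => sin (W x e w)).
  by move=> x0; apply: bdd_meas_sin; exact: wiener_measurable.
have -> : (fun w => cos (W (u + v) e w)) = (fun w =>
   cos (W u e w) * cos (W (u + v) e w - W u e w) -
   sin (W u e w) * sin (W (u + v) e w - W u e w)).
  by apply/funext => w; rewrite -cosD; congr cos; ring.
have mU : measurable_fun setT (fun w => W (u + v) e w - W u e w).
  exact: wiener_incr_measurable.
rewrite expectB; last 2 first.
- by apply: bdd_measM; [exact: bc|exact: bdd_meas_cos].
- by apply: bdd_measM; [exact: bs|exact: bdd_meas_sin].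
rewrite !indep// !(incr _ bcos) (incr _ bsin) (W0 _ _ u0 bcos) (W0 _ _ u0 bsin) [X in _ - _ * X](_ : _ = 0) ?mulr0 ?subr0//.
(* The phase -pi/2 turns the cosine into a sine and the factor cos th into 0. *)
have := gauss_law_cos 1 (- (pi / 2)) v0; rewrite cosN cos_pihalf mul0r.
by under eq_Rintegral do rewrite mul1r cosBpihalf.
Qed.

(** Since [e] is a unit vector, variance is time, and continuity in the variance comes from
    continuity of the paths of [W]. *)
Lemma gcos_cvg (v_ : nat -> R) (v : R) : (forall n, 0 <= v_ n) -> 0 <= v ->
  v_ n @[n --> \oo] --> v -> gcos (v_ n) @[n --> \oo] --> gcos v.
Proof.
move=> v_0 v0 vv.
have e1 : gcos v = \int[P]_w cos (W v e w - W 0 e w) by exact: (incr_e v0 bcos).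
have e2 : (fun n => gcos (v_ n)) = (fun n => \int[P]_w cos (W (v_ n) e w - W 0 e w)).
  by apply/funext => n; exact: (incr_e (v_0 n) bcos).
rewrite e1 e2.
apply: (expect_cvg_ae (M := 1)).
- by move=> n; case: (bdd_meas_cos (mW (v_0 n))).
- by case: (bdd_meas_cos (mW v0)).
- by apply: aeW => w n; rewrite ler_norml cos_geN1 cos_le1.
- apply: filterS (wiener_continuous W_wiener e) => w cW.
  apply: (cvg_comp _ cos); last exact: continuous_cos.
  apply: cvgB; last exact: cvg_cst.
  apply: (within_continuous_seq cW) => //= [|n].
    by rewrite in_itv/= v0.
  by rewrite in_itv/= v_0.
Qed.

End Wiener.

(** * Cosine means of integrals of step functions *)

Section BoundedSums.
Context d (T : measurableType d) (R : realType).

Lemma bdd_meas_sum (I : Type) (s : seq I) (f : I -> T -> R) :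
  (forall i, bdd_meas (f i)) -> bdd_meas (fun x => \sum_(i <- s) f i x).
Proof.
move=> bf; elim: s => [|i s ih].
  by under eq_fun do rewrite big_nil; exact: bdd_meas_cst.
by under eq_fun do rewrite big_cons; exact: bdd_measD.
Qed.

End BoundedSums.

Lemma bdd_meas_integrable_itv (R : realType) (f : R -> R) (i : interval R) :
  (lebesgue_measure [set` i] < +oo)%E -> bdd_meas f ->
  lebesgue_measure.-integrable [set` i] (EFin \o f).
Proof.
move=> ifin [mf [M fM]]; apply: measurable_bounded_integrable => //.
  exact: measurable_funTS.
exists M; split; [exact: num_real|move=> x Mx y _].
by rewrite /= (le_trans (fM y))// ltW.
Qed.

Lemma seq_argmax (R : realType) (s : seq R) : s <> [::] ->
  exists2 x, x \in s & forall y, y \in s -> y <= x.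
Proof.
elim: s => // x s ih _; have [->|/eqP/ih[z zs zmax]] := eqVneq s [::].
  by exists x; [exact: mem_head|move=> y; rewrite inE => /eqP ->].
have [zx|xz] := leP z x.
  exists x; first exact: mem_head.
  by move=> y; rewrite inE => /predU1P[->//|ys]; exact: le_trans (zmax _ ys) zx.
exists z; first by rewrite inE zs orbT.
by move=> y; rewrite inE => /predU1P[->|]; [exact: ltW|exact: zmax].
Qed.

Section StepIntegral.
Context {R : realType} {H : completeNormedModType R} (ip : H -> H -> R).
Context {d : measure_display} {Omega : measurableType d} (P : probability Omega R).
Variables (F : R -> set_system Omega) (W : R -> H -> Omega -> R).
Hypothesis ip_inner : inner_product ip.
Hypothesis F_filt : filtration F.
Hypothesis W_wiener : cylindrical_wiener ip P F W.
Variable e : H.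
Hypothesis e_unit : ip e e = 1.

(** The squared norm expands into products of indicators with constant coefficients, so no
    measurability of [H]-valued maps is involved. *)
Lemma bdd_meas_stepfun (l : seq (R * R * H)) : bdd_meas (fun s => `|stepfun l s| ^+ 2).
Proof.
have -> : (fun s => `|stepfun l s| ^+ 2) = fun s => \sum_(u <- l) \sum_(v <- l)
    ip u.2 v.2 * (\1_(`]u.1.1, u.1.2]) s * \1_(`]v.1.1, v.1.2]) s).
  apply/funext => s; rewrite -(ip_norm ip_inner) /stepfun (ip_suml ip_inner).
  apply: eq_bigr => u _; rewrite (ipZl ip_inner) (ipC ip_inner) (ip_suml ip_inner) mulr_sumr.
  by apply: eq_bigr => v _; rewrite (ipZl ip_inner) (ipC ip_inner); ring.
apply: bdd_meas_sum => u; apply: bdd_meas_sum => v; apply: bdd_measZ.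
by apply: bdd_measM; exact: bdd_meas_indic.
Qed.

Definition stepvar (l : seq (R * R * H)) (r : R) : R :=
  \int[lebesgue_measure]_(s in `[0, r]) `|stepfun l s| ^+ 2.

(** Endpoints are cut at time [r], which turns the integral of the step function into a process in
    [r] adapted to [F]. Its law can then be followed in time, whatever the overlaps between the
    intervals of [l]. *)
Definition stopint (l : seq (R * R * H)) (r : R) (w : Omega) : R :=
  \sum_(u <- l) (W (Num.min u.1.2 r) u.2 w - W (Num.min u.1.1 r) u.2 w).

Variable l : seq (R * R * H).
Hypothesis l_wf : forall u, u \in l -> 0 <= u.1.1 /\ u.1.1 <= u.1.2.

Lemma stepvar_ge0 r : 0 <= stepvar l r.
Proof. by apply: Rintegral_ge0 => s _; rewrite sqr_ge0. Qed.

Lemma stopint_adapted r : 0 <= r ->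
  measurable_fun setT (stopint l r : g_sigma_algebraType (F r) -> R).
Proof.
move=> r0.
have mW s h : 0 <= s -> s <= r ->
    measurable_fun setT (W s h : g_sigma_algebraType (F r) -> R).
  move=> s0 sr _ B mB; rewrite setTI; apply: sub_sigma_algebra.
  apply: (filt_mono F_filt s0 sr); exact: (wiener_adapted W_wiener).
rewrite /stopint; move: l_wf; elim: l => [_|u s ih wf].
  by under eq_fun do rewrite big_nil; exact: measurable_cst.
under eq_fun do rewrite big_cons.
have [a0 ab] := wf u (mem_head _ _).
apply: measurable_funD; last first.
  by apply: ih => v vs; apply: wf; rewrite inE vs orbT.
apply: measurable_funB; apply: mW; rewrite ?ge_min ?lexx ?orbT// le_min r0 andbT//.
exact: le_trans ab.
Qed.

Lemma stopint_preimage r B : 0 <= r -> measurable B -> F r (stopint l r @^-1` B).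
Proof.
move=> r0 mB; have := stopint_adapted r0 measurableT mB; rewrite setTI.
by rewrite /measurable/= (sigma_algebra_id (filt_sigma F_filt r0)).
Qed.

Lemma stopint_measurable r : 0 <= r -> measurable_fun setT (stopint l r).
Proof.
move=> r0 _ B mB; rewrite setTI; apply: (filt_sub F_filt r0).
exact: stopint_preimage.
Qed.

Section Step.
Variables r0 r : R.
Hypotheses (r0_ge0 : 0 <= r0) (r0r : r0 < r).
Hypothesis no_endpoint : forall u, u \in l ->
  ((u.1.1 <= r0) || (r <= u.1.1)) && ((u.1.2 <= r0) || (r <= u.1.2)).

(** Without endpoints strictly between [r0] and [r], an interval either contains ]r0, r] or misses
    it; [h] is then the constant value of the step function there. *)
Let active (u : R * R * H) : bool := (u.1.1 <= r0) && (r <= u.1.2).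
Let h := \sum_(u <- l) (active u)%:R *: u.2.

Let r_ge0 : 0 <= r. Proof. exact: le_trans (ltW r0r). Qed.

Let stepfun_cst s : s \in `]r0, r] -> stepfun l s = h.
Proof.
rewrite in_itv/= => /andP[r0s sr]; apply: eq_big_seq => u ul.
rewrite indic_bool in_itv/= /active; congr ((nat_of_bool _)%:R *: _).
case/andP: (no_endpoint ul) => /orP ha /orP hb.
by apply/andP/andP => -[? ?]; split; case: ha => ?; case: hb => ?; lra.
Qed.

Let stopint_incr w : stopint l r w - stopint l r0 w =
  \sum_(u <- l) (active u)%:R * (W r u.2 w - W r0 u.2 w).
Proof.
rewrite -sumrB; apply: eq_big_seq => u ul.
have [a0 ab] := l_wf ul; have lr := ltW r0r.
have minl x : x <= r0 -> Num.min x r0 = x /\ Num.min x r = x.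
  by move=> xr; split; apply/min_idPl => //; exact: le_trans lr.
have minr x : r <= x -> Num.min x r0 = r0 /\ Num.min x r = r.
  by move=> xr; split; apply/min_idPr => //; exact: le_trans xr.
rewrite /active; case/andP: (no_endpoint ul) => /orP[ha|ha] /orP[hb|hb].
- have [-> ->] := minl _ ha; have [-> ->] := minl _ hb.
  by rewrite (lt_geF (le_lt_trans hb r0r)) andbF mul0r subrr.
- by have [-> ->] := minl _ ha; have [-> ->] := minr _ hb; rewrite ha hb mul1r; ring.
- by have := le_lt_trans (le_trans ha ab) (le_lt_trans hb r0r); rewrite ltxx.
- have [-> ->] := minr _ ha; have [-> ->] := minr _ hb.
  by rewrite (lt_geF (lt_le_trans r0r ha)) mul0r; ring.
Qed.

Let wiener_sum t : 0 <= t ->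
  {ae P, forall w, W t h w = \sum_(u <- l) (active u)%:R * W t u.2 w}.
Proof.
move=> t0; rewrite /h; suff gen s : {ae P, forall w, W t (\sum_(u <- s) (active u)%:R *: u.2) w =
    \sum_(u <- s) (active u)%:R * W t u.2 w} by exact: gen.
elim: s => [|u s ih].
  by rewrite big_nil; apply: filterS (wiener_ae0 W_wiener t0) => w ->; rewrite big_nil.
rewrite big_cons.
apply: filterS2 ih (wiener_linear W_wiener (active u)%:R u.2
  (\sum_(v <- s) (active v)%:R *: v.2) t0) => w e1 ->.
by rewrite big_cons e1.
Qed.

Let stopint_incr_ae : {ae P, forall w,
  stopint l r w - stopint l r0 w = W r h w - W r0 h w}.
Proof.
apply: filterS2 (wiener_sum r_ge0) (wiener_sum r0_ge0) => w -> ->.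
by rewrite stopint_incr -sumrB; apply: eq_bigr => u _; rewrite mulrBr.
Qed.

Let stepvar_step : stepvar l r = stepvar l r0 + (r - r0) * ip h h.
Proof.
have fint : lebesgue_measure.-integrable `[0, r] (EFin \o (fun s => `|stepfun l s| ^+ 2)).
  apply: bdd_meas_integrable_itv (bdd_meas_stepfun l).
  by rewrite lebesgue_measure_itv/=; case: ifP => _; rewrite -?EFinD ltry.
have := Rintegral_itvB (x := r0) fint; rewrite !bnd_simp => /(_ r0_ge0 (ltW r0r)).
rewrite -/(stepvar l r) -/(stepvar l r0).
have -> : \int[lebesgue_measure]_(s in `]r0, r]) (`|stepfun l s| ^+ 2) = (r - r0) * ip h h.
  transitivity (\int[lebesgue_measure]_(s in `]r0, r]) (`|h| ^+ 2)).
    by apply: eq_Rintegral => s; rewrite inE => /stepfun_cst ->.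
  have mle : fine (lebesgue_measure `]r0, r]) = r - r0.
    by rewrite lebesgue_measure_itv/= lte_fin r0r.
  by rewrite (ip_norm ip_inner) mulrC -mle Rintegral_cst.
by move=> <-; ring.
Qed.

(** From [r0] to [r] the integral gains the increment of [W] in the direction [h], independent of
    [F r0] and hence of the integral up to [r0]; the addition formula and [gcosD] then add the
    variances. *)
Lemma stopint_step : (forall th,
    \int[P]_w cos (stopint l r0 w + th) = cos th * gcos (stepvar l r0)) ->
  forall th, \int[P]_w cos (stopint l r w + th) = cos th * gcos (stepvar l r).
Proof.
move=> ih th; have hh : 0 <= (r - r0) * ip h h.
  by rewrite mulr_ge0 ?(ip_ge0 ip_inner)// subr_ge0 ltW.
have lr := ltW r0r.
have mU : measurable_fun setT (fun w => W r h w - W r0 h w).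
  exact: (wiener_incr_measurable F_filt W_wiener).
have mN := stopint_measurable r0_ge0.
have mNth th' : measurable_fun setT (fun w => stopint l r0 w + th').
  exact: measurable_funD.
have indep (f g : R -> R) : bdd_meas f -> bdd_meas g ->
    \int[P]_w (f (stopint l r0 w) * g (W r h w - W r0 h w)) =
    \int[P]_w f (stopint l r0 w) * \int[P]_w g (W r h w - W r0 h w).
  apply: expect_indep; [exact: mN|exact: mU|].
  move=> A B mA mB; apply: (wiener_indep W_wiener) => //.
  exact: stopint_preimage.
pose N w := stopint l r0 w; pose U w := W r h w - W r0 h w.
have bcth : bdd_meas (fun y : R => cos (y + th)).
  by apply: bdd_meas_cos; exact: measurable_funD.
have bsth : bdd_meas (fun y : R => sin (y + th)).
  by apply: bdd_meas_sin; exact: measurable_funD.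
have bcos : bdd_meas (@cos R) by apply: (bdd_meas_cos (f := id)); exact: measurable_id.
have bsin : bdd_meas (@sin R) by apply: (bdd_meas_sin (f := id)); exact: measurable_id.
have e1 : \int[P]_w cos (stopint l r w + th) =
    \int[P]_w (cos (N w + th) * cos (U w) - sin (N w + th) * sin (U w)).
  apply: expect_ae.
  - by case: (bdd_meas_cos (measurable_funD (stopint_measurable r_ge0) (measurable_cst th))).
  - apply: measurable_funB; apply: measurable_funM;
    [case: (bdd_meas_cos (mNth th))|case: (bdd_meas_cos mU)
    |case: (bdd_meas_sin (mNth th))|case: (bdd_meas_sin mU)] => //.
  - apply: filterS stopint_incr_ae => w ew.
    by rewrite -cosD /U -ew /N; congr cos; ring.
rewrite e1 expectB; last 2 first.
- by apply: bdd_measM; [exact: (bdd_meas_cos (mNth th))|exact: (bdd_meas_cos mU)].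
- by apply: bdd_measM; [exact: (bdd_meas_sin (mNth th))|exact: (bdd_meas_sin mU)].
have incr := wiener_incr_expect F_filt W_wiener h r0_ge0 lr.
have EU : \int[P]_w cos (U w) = gcos ((r - r0) * ip h h) by exact: (incr _ bcos).
have SU : \int[P]_w sin (U w) = 0.
  apply: (etrans (incr _ bsin)).
  have := gauss_law_cos ip_inner F_filt W_wiener e_unit 1 (- (pi / 2)) hh.
  rewrite cosN cos_pihalf mul0r => h0; apply: etrans h0.
  by congr Rintegral; apply/funext => y; rewrite mul1r cosBpihalf.
have -> : \int[P]_w (cos (N w + th) * cos (U w)) =
    cos th * gcos (stepvar l r0) * gcos ((r - r0) * ip h h).
  by apply: (etrans (indep _ _ bcth bcos)); congr (_ * _).
have -> : \int[P]_w (sin (N w + th) * sin (U w)) = 0.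
  by apply: (etrans (indep _ _ bsth bsin)); rewrite [X in _ * X]SU mulr0.
rewrite subr0 stepvar_step -mulrA -(gcosD ip_inner F_filt W_wiener e_unit)//.
exact: stepvar_ge0.
Qed.

End Step.

Lemma stopint0 w : stopint l 0 w = 0.
Proof.
apply: big1_seq => u /= ul; have [a0 ab] := l_wf ul.
have -> : Num.min u.1.1 0 = 0 by exact/min_idPr.
have -> : Num.min u.1.2 0 = 0 by apply/min_idPr; exact: le_trans ab.
by rewrite subrr.
Qed.

Let endpoints := [seq u.1.1 | u <- l] ++ [seq u.1.2 | u <- l].

(** Induction on the number of endpoints in ]0, r[: [step] carries the formula up to [r] from the
    largest of them, or from 0 if there is none. *)
Let stopint_cos_rec n (r : R) : 0 <= r ->
  (count (fun x : R => (0 < x < r)%R) endpoints <= n)%N ->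
  forall th, \int[P]_w cos (stopint l r w + th) = cos th * gcos (stepvar l r).
Proof.
have base th : \int[P]_w cos (stopint l 0 w + th) = cos th * gcos (stepvar l 0).
  have -> : stepvar l 0 = 0 by rewrite /stepvar set_itv1 Rintegral_set1.
  rewrite (gcos0 F_filt W_wiener e_unit) mulr1.
  by under eq_Rintegral do rewrite stopint0 add0r; exact: expect_cst.
have step r0 r' : 0 <= r0 -> r0 < r' -> (forall x, x \in endpoints -> ~~ (r0 < x < r')) ->
    (forall th, \int[P]_w cos (stopint l r0 w + th) = cos th * gcos (stepvar l r0)) ->
    forall th, \int[P]_w cos (stopint l r' w + th) = cos th * gcos (stepvar l r').
  move=> r00 r0r nE; apply: stopint_step => // u ul.
  have h1 : u.1.1 \in endpoints.
    by rewrite mem_cat; apply/orP; left; apply/mapP; exists u.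
  have h2 : u.1.2 \in endpoints.
    by rewrite mem_cat; apply/orP; right; apply/mapP; exists u.
  by have := nE _ h1; have := nE _ h2; rewrite !negb_and -!leNgt => -> ->.
elim: n r => [|n ih] r; rewrite le_eqVlt => /predU1P[<- _|r0]; try exact: base.
  rewrite leqn0 -leqn0 leqNgt -has_count => /hasPn nE.
  by apply: (step 0).
move=> cn; have [hE|nE] := boolP (has (fun x => 0 < x < r) endpoints); last first.
  by apply: (step 0) => //; exact/hasPn.
have [|x] := @seq_argmax _ [seq x <- endpoints | 0 < x < r].
  by move=> E0; move: hE; rewrite has_filter E0.
rewrite mem_filter => /andP[/andP[x0 xr] xE] xmax.
apply: (step x _ (ltW x0) xr).
  move=> y yE; apply/negP => /andP[xy yr].
  by have := xmax y; rewrite mem_filter yE yr (lt_trans x0 xy) leNgt xy => /(_ isT).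
apply: ih; first exact: ltW.
rewrite -ltnS (leq_trans _ cn)// -addn1.
(* The endpoints in ]0, x[ and [x] itself, which occurs at least once, are all counted in ]0, r[, so
   the count drops. *)
rewrite (@leq_trans (count (predU (fun y : R => 0 < y < x) (pred1 x)) endpoints))//; last first.
  apply: sub_count => y /= /orP[/andP[y0 yx]|/eqP ->]; last by rewrite x0.
  by rewrite y0 (lt_trans yx).
have := count_predUI (fun y : R => 0 < y < x) (pred1 x) endpoints.
rewrite (@eq_count _ (predI _ _) pred0) ?count_pred0 ?addn0 => [->|y /=]; last first.
  by apply/negP => /andP[/andP[_ yx] /eqP yE]; rewrite yE ltxx in yx.
by rewrite leq_add2l -has_count has_pred1.
Qed.

Lemma stopint_cos r th : 0 <= r ->
  \int[P]_w cos (stopint l r w + th) = cos th * gcos (stepvar l r).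
Proof. by move=> r0; exact: (stopint_cos_rec r0 (leqnn _)). Qed.

End StepIntegral.

Section StepIntegralFinal.
Context {R : realType} {H : completeNormedModType R} (ip : H -> H -> R).
Context {d : measure_display} {Omega : measurableType d} (P : probability Omega R).
Variables (F : R -> set_system Omega) (W : R -> H -> Omega -> R).
Hypothesis ip_inner : inner_product ip.
Hypothesis F_filt : filtration F.
Hypothesis W_wiener : cylindrical_wiener ip P F W.
Variable e : H.
Hypothesis e_unit : ip e e = 1.

Variables (l : seq (R * R * H)) (t : R).
Hypothesis t_ge0 : 0 <= t.
Hypothesis l_wf : forall u, u \in l -> [/\ 0 <= u.1.1, u.1.1 <= u.1.2 & u.1.2 <= t].

Let stepintE : stepint W l = stopint W l t.
Proof.
apply/funext => w; apply: eq_big_seq => u ul; have [a0 ab bt] := l_wf ul.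
by rewrite !(min_idPl _)//; exact: le_trans bt.
Qed.

Let l_wf' u : u \in l -> 0 <= u.1.1 /\ u.1.1 <= u.1.2.
Proof. by case/l_wf. Qed.

Lemma stepint_measurable : measurable_fun setT (stepint W l).
Proof. by rewrite stepintE; exact: (stopint_measurable F_filt W_wiener l_wf'). Qed.

Lemma stepint_cos th :
  \int[P]_w cos (stepint W l w + th) = cos th * gcos (stepvar l t).
Proof.
by rewrite stepintE; exact: (stopint_cos ip_inner F_filt W_wiener e_unit l_wf').
Qed.

End StepIntegralFinal.

(** * Functional calculus in an eigenbasis of Q *)

Section Spectral.
Context {R : realType} {H : completeNormedModType R} (ip : H -> H -> R).
Hypothesis ip_inner : inner_product ip.

Section Basis.
Variable e : nat -> H.
Hypothesis e_basis : orthonormal_basis ip e.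

Let e_on i j : ip (e i) (e j) = (i == j)%:R. Proof. by case: e_basis => /(_ i j). Qed.

Lemma ip_cvgl (u : nat -> H) x y : u n @[n --> \oo] --> x -> ip (u n) y @[n --> \oo] --> ip x y.
Proof. by move=> ux; apply: (cvg_comp _ (ip^~ y) ux); exact: ip_continuous. Qed.

Lemma ip_series (c : nat -> R) (v : nat -> H) x y :
  series (fun k => c k *: v k) @ \oo --> x ->
  series (fun k => c k * ip (v k) y) @ \oo --> ip x y.
Proof.
move=> sx; suff -> : series (fun k => c k * ip (v k) y) =
    (fun n => ip (series (fun k => c k *: v k) n) y) by exact: ip_cvgl.
apply/funext => n; rewrite /series/= (ip_suml ip_inner).
by apply: eq_bigr => k _; rewrite (ipZl ip_inner).
Qed.

Lemma parseval x y : series (fun k => ip x (e k) * ip y (e k)) @ \oo --> ip x y.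
Proof.
case: e_basis => _ /(_ x)/ip_series => /(_ y).
suff -> : (fun k => ip x (e k) * ip (e k) y) = (fun k => ip x (e k) * ip y (e k)) by [].
by apply/funext => k; rewrite (ipC ip_inner (e k)).
Qed.

Lemma basis_ext x y : (forall k, ip x (e k) = ip y (e k)) -> x = y.
Proof.
move=> xy; case: e_basis => _ b; have := b y.
have -> : (fun k => ip y (e k) *: e k) = (fun k => ip x (e k) *: e k).
  by apply/funext => k; rewrite xy.
by move=> h; apply: (cvg_unique _ (b x) h); exact: norm_hausdorff.
Qed.

Lemma series_coef (c : nat -> R) y : series (fun k => c k *: e k) @ \oo --> y ->
  forall j, ip y (e j) = c j.
Proof.
move=> /ip_series sy j; have := sy (e j) => h; apply: (cvg_unique _ h _) => //.
apply: cvg_near_cst; exists j.+1 => // n /= jn.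
rewrite /series/= (bigD1_seq j) ?mem_index_iota ?iota_uniq//= e_on eqxx mulr1.
rewrite big1 ?addr0// => k kj; by rewrite e_on (negbTE kj) mulr0.
Qed.

Lemma norm_sum_basis (c : nat -> R) m n :
  `|\sum_(m <= k < n) c k *: e k| ^+ 2 = \sum_(m <= k < n) c k ^+ 2.
Proof.
rewrite -(ip_norm ip_inner) (ip_suml ip_inner).
apply: eq_big_nat => k kmn.
rewrite (ipZl ip_inner) (ipC ip_inner) (ip_suml ip_inner).
rewrite (bigD1_seq k) ?mem_index_iota ?iota_uniq//= (ipZl ip_inner) e_on eqxx mulr1.
by rewrite big1 ?addr0// => j jk; rewrite (ipZl ip_inner) e_on (negbTE jk) mulr0.
Qed.

(** By orthogonality the tails of the new series have norm at most [M + 1] times that of the tails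
    for [x], and the Cauchy criterion applies; [M + 1] is positive even if [M] is 0. *)
Lemma cvg_multiplier (a : nat -> R) (M : R) x : (forall k, `|a k| <= M) ->
  exists y : H, series (fun k => (a k * ip x (e k)) *: e k) @ \oo --> y.
Proof.
move=> aM; have M0 : 0 <= M by exact: le_trans (aM 0%N).
suff : cvgn (series (fun k => (a k * ip x (e k)) *: e k)) by move/cvg_ex.
have c2 : cvgn (series (fun k => ip x (e k) * ip x (e k))).
  by apply/cvg_ex; exists (ip x x); exact: parseval.
apply/cauchy_cvgP/cauchy_seriesP => d d0.
have d2 : 0 < (d / (M + 1)) ^+ 2 by rewrite exprn_gt0// divr_gt0// ltr_wpDl.
move: c2 => /cauchy_cvgP/cauchy_seriesP/(_ _ d2); apply: filterS => -[m n]/=.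
rewrite ger0_norm; last by apply: sumr_ge0 => k _; rewrite -expr2 sqr_ge0.
move=> h; rewrite -(ltr_pXn2r (n := 2))// ?nnegrE// ?ltW// norm_sum_basis.
apply: (@le_lt_trans _ _ ((M + 1) ^+ 2 * \sum_(m <= k < n) ip x (e k) * ip x (e k))).
  rewrite mulr_sumr; apply: ler_sum => k _; rewrite exprMn -expr2.
  rewrite ler_wpM2r ?sqr_ge0// -[a k ^+ 2]real_normK ?num_real//.
  by rewrite lerXn2r// ?nnegrE// ?addr_ge0// (le_trans (aM k))// lerDl.
rewrite mulrC -ltr_pdivlMr ?exprn_gt0 ?ltr_wpDl//.
by rewrite -expr_div_n.
Qed.

End Basis.

Section Calculus.
Variable Q : {linear H -> H}.
Hypothesis Q_cov : covariance_operator ip Q.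
Variables (e : nat -> H) (lam : nat -> R).
Hypothesis e_eigen : eigenbasis ip Q e lam.

Let e_basis : orthonormal_basis ip e. Proof. by case: e_eigen. Qed.
Let e_on i j : ip (e i) (e j) = (i == j)%:R. Proof. by case: e_basis => /(_ i j). Qed.
Let Qe k : Q (e k) = lam k *: e k. Proof. by case: e_eigen. Qed.

Lemma eigenvalue_gt0 k : 0 < lam k.
Proof.
have ek0 : e k != 0.
  apply/eqP => ek0; have := e_on k k; rewrite ek0 (ip0l ip_inner) eqxx => /esym/eqP.
  by rewrite oner_eq0.
have := cov_positive Q_cov ek0.
by rewrite Qe (ipZl ip_inner) e_on eqxx mulr1.
Qed.

Lemma eigenvalue_bounded : exists2 M, 0 < M & forall k, lam k <= M.
Proof.
have [M QM] := cov_bounded Q_cov; exists (`|M| + 1); first by rewrite ltr_wpDl.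
move=> k; have ne : `|e k| = 1.
  apply/eqP; rewrite -(eqrXn2 (n := 2))// -(ip_norm ip_inner) e_on eqxx expr1n.
  by [].
have := QM (e k); rewrite Qe normrZ ne !mulr1 gtr0_norm ?eigenvalue_gt0//.
by move=> h; rewrite (le_trans h)// (le_trans (ler_norm _))// lerDl.
Qed.

Lemma ip_Q x k : ip (Q x) (e k) = lam k * ip x (e k).
Proof. by rewrite (cov_symmetric Q_cov) Qe (ipZr ip_inner). Qed.

(* Two eigenbases give the same series because eigenvectors for distinct
   eigenvalues are orthogonal. *)
Lemma fcalc_series (f : R -> R) (M : R) x : (forall k, `|f (lam k)^-1| <= M) ->
  series (fun k => (f (lam k)^-1 * ip x (e k)) *: e k) @ \oo --> fcalc ip Q f x.
Proof.
move=> fM; have [y sy] := cvg_multiplier e_basis x fM.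
suff -> : fcalc ip Q f x = y by [].
have [] : [set y | exists e lam, eigenbasis ip Q e lam /\
    series (fun k => (f (lam k)^-1 * ip x (e k)) *: e k) @ \oo --> y] (fcalc ip Q f x).
  by apply: getPex; exists y; exists e, lam.
move=> e' [lam' [[[e'_on e'_exp] Qe'] sy']].
apply: (basis_ext e_basis) => k.
rewrite (series_coef e_basis sy).
have := ip_series (y := e k) sy'.
have -> : (fun j => f (lam' j)^-1 * ip x (e' j) * ip (e' j) (e k)) =
    (fun j => f (lam k)^-1 * (ip x (e' j) * ip (e' j) (e k))).
  apply/funext => j; have [->|ne] := eqVneq (lam' j) (lam k); first by ring.
  suff -> : ip (e' j) (e k) = 0 by ring.
  have := ip_Q (e' j) k; rewrite Qe' (ipZl ip_inner) => /eqP.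
  by rewrite -subr_eq0 -mulrBl mulf_eq0 subr_eq0 (negbTE ne) => /eqP.
have h1 := ip_series (y := e k) (e'_exp x).
have : f (lam k)^-1 * series (fun j => ip x (e' j) * ip (e' j) (e k)) n @[n --> \oo] -->
    f (lam k)^-1 * ip x (e k) by apply: cvgM; [exact: cvg_cst|exact: h1].
have -> : (fun n => f (lam k)^-1 * series (fun j => ip x (e' j) * ip (e' j) (e k)) n) =
   series (fun j => f (lam k)^-1 * (ip x (e' j) * ip (e' j) (e k))).
  by apply/funext => n; rewrite /series/= mulr_sumr.
by move=> h2 h3; apply: (cvg_unique _ h3 h2).
Qed.

Lemma fcalc_coef (f : R -> R) (M : R) x k : (forall k, `|f (lam k)^-1| <= M) ->
  ip (fcalc ip Q f x) (e k) = f (lam k)^-1 * ip x (e k).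
Proof. by move=> fM; rewrite (series_coef e_basis (fcalc_series (x := x) fM)). Qed.

Lemma expA_coef alpha t x k : 0 <= t ->
  ip (expA ip Q alpha t x) (e k) = expR (- t * (lam k)^-1 `^ alpha) * ip x (e k).
Proof.
move=> t0; apply: (fcalc_coef (f := fun a => expR (- t * a `^ alpha)) (M := 1)) => j.
rewrite ger0_norm ?expR_ge0// -expR0 ler_expR mulNr oppr_le0.
by rewrite mulr_ge0// powR_ge0.
Qed.

(** Nonpositive powers of A are bounded because the eigenvalues of [Q] are. For s = (alpha - 1) / 2
    this is where alpha <= 1 enters. *)
Lemma powA_coef (s : R) x k : s <= 0 ->
  ip (powA ip Q s x) (e k) = (lam k)^-1 `^ s * ip x (e k).
Proof.
move=> s0; have [M M0 lamM] := eigenvalue_bounded.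
apply: (fcalc_coef (f := fun a => a `^ s) (M := M `^ (- s))) => j.
rewrite ger0_norm ?powR_ge0//.
have lj := ltW (eigenvalue_gt0 j); rewrite -(powR_inv1 lj) -powRrM mulN1r.
by apply: ge0_ler_powR; rewrite ?nnegrE ?oppr_ge0//; exact/ltW.
Qed.

Lemma expA0 alpha x : expA ip Q alpha 0 x = x.
Proof.
by apply: (basis_ext e_basis) => k; rewrite expA_coef// oppr0 mul0r expR0 mul1r.
Qed.

Lemma expA_symmetric alpha t x y : 0 <= t ->
  ip (expA ip Q alpha t x) y = ip x (expA ip Q alpha t y).
Proof.
move=> t0; have h1 := parseval e_basis (x := expA ip Q alpha t x) (y := y).
have h2 := parseval e_basis (x := x) (y := expA ip Q alpha t y).
have e1 : (fun k => ip (expA ip Q alpha t x) (e k) * ip y (e k)) =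
   (fun k => ip x (e k) * ip (expA ip Q alpha t y) (e k)).
  by apply/funext => k; rewrite !expA_coef//; ring.
by rewrite e1 in h1; apply: (cvg_unique _ h1 h2).
Qed.

Lemma covt_coef alpha t x k : 0 <= t -> ip (covt ip Q alpha t x) (e k) =
  lam k * (1 - expR (- t * (lam k)^-1 `^ alpha)) * ip x (e k).
Proof.
by move=> t0; rewrite ip_Q (ipBl ip_inner) expA_coef//; ring.
Qed.

Lemma covt_series alpha t x : 0 <= t ->
  series (fun k => lam k * (1 - expR (- t * (lam k)^-1 `^ alpha)) * ip x (e k) ^+ 2) @ \oo -->
  ip (covt ip Q alpha t x) x.
Proof.
move=> t0; have := parseval e_basis (x := covt ip Q alpha t x) (y := x).
under eq_fun do rewrite covt_coef// -mulrA -expr2.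
by [].
Qed.

Lemma covt_term_ge0 alpha t x k : 0 <= t ->
  0 <= lam k * (1 - expR (- t * (lam k)^-1 `^ alpha)) * ip x (e k) ^+ 2.
Proof.
move=> t0; apply: mulr_ge0 (sqr_ge0 _); apply: mulr_ge0; first exact/ltW/eigenvalue_gt0.
rewrite subr_ge0 -expR0 ler_expR mulNr oppr_le0.
by rewrite mulr_ge0// powR_ge0.
Qed.

Lemma covt_ge0 alpha t x : 0 <= t -> 0 <= ip (covt ip Q alpha t x) x.
Proof.
move=> t0; apply: (cvgr_to_ge (covt_series (alpha := alpha) (x := x) t0)).
by apply: nearW => n; apply: sumr_ge0 => k _; exact: covt_term_ge0.
Qed.

(** Coefficientwise, lam e^(-ta) + lam (1 - e^(-ta)) = lam with a = lam^(-alpha). This is the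
    balance of variances that makes [mu] invariant. *)
Lemma covt_variance alpha t x : 0 <= t ->
  ip (Q (expA ip Q alpha (t / 2) x)) (expA ip Q alpha (t / 2) x) +
  ip (covt ip Q alpha t x) x = ip (Q x) x.
Proof.
move=> t0; have t20 : 0 <= t / 2 by rewrite divr_ge0.
have h1 := parseval e_basis (x := Q (expA ip Q alpha (t / 2) x)) (y := expA ip Q alpha (t / 2) x).
have h2 := covt_series (alpha := alpha) (x := x) t0.
have h3 := parseval e_basis (x := Q x) (y := x).
set A := (fun k => _) in h1; set B := (fun k => _) in h2; set C := (fun k => _) in h3.
have h12 : series A n + series B n @[n --> \oo] -->
    ip (Q (expA ip Q alpha (t / 2) x)) (expA ip Q alpha (t / 2) x) +
    ip (covt ip Q alpha t x) x by apply: cvgD; [exact: h1|exact: h2].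
suff e3 : (fun n => series A n + series B n) = series C.
  by rewrite e3 in h12; apply: (cvg_unique _ h12 h3).
apply/funext => n.
rewrite /series/= -big_split/=; apply: eq_bigr => k _.
rewrite /A /B /C !ip_Q !expA_coef//.
have -> : expR (- t * (lam k)^-1 `^ alpha) = expR (- (t / 2) * (lam k)^-1 `^ alpha) ^+ 2.
  by rewrite expr2 -expRD; congr expR; field.
by ring.
Qed.

End Calculus.
End Spectral.

(** * Variance of the stochastic convolution *)

Section ExpIntegral.
Context {R : realType}.

Lemma integral_exp_itv (K b t : R) : 0 <= t -> 
  (\int[lebesgue_measure]_(s in `[0%R, t]) (K * b * expR (b * (s - t)))%:E =
   (K * (1 - expR (- t * b)))%:E)%E.
Proof.
(* The case t = 0 is apart: the fundamental theorem of calculus is applied on a nondegenerate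
   interval. *)
rewrite le_eqVlt => /predU1P[<-|t0].
  by rewrite set_itv1 integral_set1 oppr0 mul0r expR0 subrr mulr0.
pose F s : R := K * expR (b * (s - t)).
have dF (s : R) : is_derive s 1 F (K * b * expR (b * (s - t))).
  have h1 : is_derive s 1 (fun s => b * (s - t)) b.
    apply: is_derive_eq; rewrite /GRing.scale/= subr0; lra.
  have h2 := is_derive1_comp (f := expR) (g := fun s => b * (s - t)) (is_derive_expR _) h1.
  have := is_deriveZ K h2.
  move=> h3; apply: is_derive_eq.
  by rewrite /GRing.scale/=; ring.
have cF : continuous F.
  by move=> s; apply/differentiable_continuous/derivable1_diffP; exact: ex_derive.
rewrite (@continuous_FTC2 _ _ F)//.
- rewrite -EFinB /F subrr mulr0 expR0; congr EFin.
  have -> : b * (0 - t) = - t * b by ring.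
  by ring.
- apply: continuous_subspaceT => s.
  apply: cvgM; first exact: cvg_cst.
  apply: (cvg_comp _ expR); last exact: continuous_expR.
  apply: cvgM; first exact: cvg_cst.
  by apply: cvgB; [exact: cvg_id|exact: cvg_cst].
- split=> [s _||]; [exact: ex_derive| |].
  + by apply: cvg_at_right_filter; exact: cF.
  + by apply: cvg_at_left_filter; exact: cF.
- by move=> s _; rewrite derive1E derive_val.
Qed.

End ExpIntegral.

Section Energy.
Context {R : realType} {H : completeNormedModType R} (ip : H -> H -> R).
Hypothesis ip_inner : inner_product ip.
Variable Q : {linear H -> H}.
Hypothesis Q_cov : covariance_operator ip Q.
Variables (e : nat -> H) (lam : nat -> R).
Hypothesis e_eigen : eigenbasis ip Q e lam.
Variables (alpha t : R) (h : H).
Hypotheses (alpha_le1 : alpha <= 1) (t_ge0 : 0 <= t).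

Let f s := powA ip Q ((alpha - 1) / 2) (expA ip Q alpha ((t - s) / 2) h).

Let e_basis : orthonormal_basis ip e. Proof. by case: e_eigen. Qed.

Let g k s := (lam k)^-1 `^ ((alpha - 1) / 2) *
  (expR (- ((t - s) / 2) * (lam k)^-1 `^ alpha) * ip h (e k)).

Let f_coef s k : s <= t -> ip (f s) (e k) = g k s.
Proof.
move=> st; have a0 : (alpha - 1) / 2 <= 0 by rewrite ler_pdivrMr// mul0r subr_le0.
have s0 : 0 <= (t - s) / 2 by rewrite divr_ge0// subr_ge0.
by rewrite /f (powA_coef ip_inner Q_cov e_eigen _ _ a0) (expA_coef ip_inner Q_cov e_eigen _ _ _ s0).
Qed.

Let measurable_g k : measurable_fun setT (g k).
Proof.
apply: continuous_measurable_fun => s; apply: cvgM; first exact: cvg_cst.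
apply: cvgM; last exact: cvg_cst.
apply: (cvg_comp _ expR); last exact: continuous_expR.
apply: cvgM; last exact: cvg_cst.
apply: cvgN; apply: cvgM; last exact: cvg_cst.
by apply: cvgB; [exact: cvg_cst|exact: cvg_id].
Qed.

Lemma integrand_measurable y : measurable_fun `[0, t] (fun s => ip (f s) y).
Proof.
apply: (measurable_fun_cvg (h := fun n s => series (fun k => g k s * ip y (e k)) n)).
  move=> n; apply: measurable_funTS; rewrite /series/=.
  elim: n => [|n ih]; first by under eq_fun do rewrite big_geq//; exact: measurable_cst.
  under eq_fun do rewrite big_nat_recr//=.
  by apply: measurable_funD => //; apply: measurable_funM.
move=> s; rewrite /= in_itv/= => /andP[_ st].
have := parseval ip_inner e_basis (x := f s) (y := y).
suff -> : (fun k => ip (f s) (e k) * ip y (e k)) = (fun k => g k s * ip y (e k)) by [].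
by apply/funext => k; rewrite f_coef.
Qed.

Let norm_series s : s <= t -> (`|f s| ^+ 2)%:E = (\sum_(0 <= k <oo) (g k s ^+ 2)%:E)%E.
Proof.
move=> st; apply/esym/cvg_lim => //.
have := parseval ip_inner e_basis (x := f s) (y := f s).
have -> : (fun k => ip (f s) (e k) * ip (f s) (e k)) = (fun k => g k s ^+ 2).
  by apply/funext => k; rewrite f_coef// expr2.
rewrite (ip_norm ip_inner) => c.
have -> : (fun n => (\sum_(0 <= k < n) (g k s ^+ 2)%:E)%E) = EFin \o series (fun k => g k s ^+ 2).
  by apply/funext => n /=; rewrite sumEFin.
by apply: cvg_EFin => //; exact: nearW.
Qed.

Lemma norm_integrand_measurable : measurable_fun `[0, t] (fun s => `|f s| ^+ 2).
Proof.
apply: (measurable_fun_cvg (h := fun n s => series (fun k => g k s ^+ 2) n)).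
  move=> n; apply: measurable_funTS; rewrite /series/=.
  elim: n => [|n ih]; first by under eq_fun do rewrite big_geq//; exact: measurable_cst.
  under eq_fun do rewrite big_nat_recr//=.
  by apply: measurable_funD => //; apply: measurable_funX.
move=> s; rewrite /= in_itv/= => /andP[_ st].
have := parseval ip_inner e_basis (x := f s) (y := f s).
rewrite (ip_norm ip_inner).
suff -> : (fun k => ip (f s) (e k) * ip (f s) (e k)) = (fun k => g k s ^+ 2) by [].
by apply/funext => k; rewrite f_coef// expr2.
Qed.

(** Parseval turns the squared norm into a series of nonnegative terms, which are integrated one by
    one; the result is the series of [covt_series]. *)
Lemma integrand_energy :
  (\int[lebesgue_measure]_(s in `[0%R, t]) (`|f s| ^+ 2)%:E)%E =
  (ip (covt ip Q alpha t h) h)%:E.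
Proof.
have term k : (\int[lebesgue_measure]_(s in `[0%R, t]) (g k s ^+ 2)%:E =
    (lam k * ip h (e k) ^+ 2 * (1 - expR (- t * (lam k)^-1 `^ alpha)))%:E)%E.
  have lk := eigenvalue_gt0 ip_inner Q_cov e_eigen k.
  set b := (lam k)^-1 `^ alpha.
  have b0 : 0 < b by rewrite powR_gt0// invr_gt0.
  rewrite (_ : (fun s => _) = (fun s => (lam k * ip h (e k) ^+ 2 * b * expR (b * (s - t)))%:E)); last first.
    apply/funext => s; congr EFin; rewrite /g -/b !exprMn.
    (* Squaring leaves lam^(1 - alpha) = b lam, and the factor b is the derivative that the
       primitive of the exponential calls for. *)
    have -> : ((lam k)^-1 `^ ((alpha - 1) / 2)) ^+ 2 = b * lam k.
      have lN0 : (lam k)^-1 != 0 by rewrite invr_eq0 gt_eqF.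
      rewrite expr2 -powRD; last by rewrite lN0 implybT.
      rewrite -splitr powRD; last by rewrite lN0 implybT.
      by rewrite powR_inv1 ?invrK// invr_ge0 ltW.
    have -> : expR (- ((t - s) / 2) * b) ^+ 2 = expR (b * (s - t)).
      by rewrite expr2 -expRD; congr expR; field.
    by ring.
  by rewrite integral_exp_itv.
transitivity (\int[lebesgue_measure]_(s in `[0%R, t]) (\sum_(0 <= k <oo) (g k s ^+ 2)%:E))%E.
  by apply: eq_integral => s; rewrite inE/= in_itv/= => /andP[_ st]; exact: norm_series.
rewrite integral_nneseries//; last 2 first.
- by move=> k; apply/measurable_EFinP; apply: measurable_funTS; apply: measurable_funX; exact: measurable_g.
- by move=> k s _; rewrite lee_fin sqr_ge0.
rewrite (eq_eseriesr (fun k _ => term k)).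
apply/cvg_lim => //.
have := covt_series ip_inner Q_cov e_eigen (alpha := alpha) (x := h) t_ge0.
set c := (fun k => _) => cc.
rewrite (_ : (fun n => _) = EFin \o series c).
  by apply: cvg_EFin => //; exact: nearW.
apply/funext => n /=; rewrite sumEFin /series/=; congr EFin; apply: eq_bigr => k _.
by rewrite /c; ring.
Qed.

End Energy.

(** * Convergence in L^2 through integrals of squares *)

Lemma cvge0_lt (R : realType) I (F : set_system I) (FF : Filter F) (N : I -> \bar R) :
  N i @[i --> F] --> 0%E -> forall c : R, 0 < c -> \forall i \near F, (N i < c%:E)%E.
Proof.
move=> h c c0; apply: (h [set y | (y < c%:E)%E]).
by apply: open_ereal_lt'; rewrite lte_fin.
Qed.

Section SquareNorm.
Context d (T : measurableType d) (R : realType) (P : {measure set T -> \bar R}).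
Implicit Types g : T -> R.

Lemma Lnorm2_sq g :
  (Lnorm P 2%:E (EFin \o g) `^ 2 = \int[P]_x (g x ^+ 2)%:E)%E.
Proof.
rewrite poweR_Lnorm//; apply: eq_integral => x _ /=.
by rewrite powR_mulrn// real_normK ?num_real.
Qed.

Lemma Lnorm2_le g (c : R) : 0 <= c ->
  (Lnorm P 2%:E (EFin \o g) <= c%:E)%E <-> (\int[P]_x (g x ^+ 2)%:E <= (c ^+ 2)%:E)%E.
Proof.
move=> c0; rewrite -Lnorm2_sq; set N := Lnorm _ _ _.
have N0 : (0 <= N)%E by exact: Lnorm_ge0.
have c2 : ((c ^+ 2)%:E = c%:E `^ 2)%E by rewrite poweR_EFin powR_mulrn.
rewrite c2; split=> h.
  by apply: gt0_ler_poweR => //; rewrite in_itv/= ?N0 ?lee_fin ?c0 ?leey.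
have := @gt0_ler_poweR R 2^-1 _ (N `^ 2)%E (c%:E `^ 2)%E.
rewrite -!poweRrM divff// !poweRe1//; apply=> //;
  by rewrite in_itv; apply/andP; split; [exact: poweR_ge0|exact: leey].
Qed.

(** It trades the extended norm and its square root for eventual real bounds on integrals of
    squares, the form in which L^2 limits are handled. *)
Lemma Lnorm2_cvg0 I (F : set_system I) (FF : Filter F) (g : I -> T -> R) :
  Lnorm P 2%:E (EFin \o g i) @[i --> F] --> 0%E <->
  forall c : R, 0 < c -> \forall i \near F, (\int[P]_x (g i x ^+ 2)%:E <= c%:E)%E.
Proof.
split=> [h c c0|h].
  have s0 : 0 < Num.sqrt c by rewrite sqrtr_gt0.
  by apply: filterS (cvge0_lt FF h s0) => i /ltW hi;
    have := (Lnorm2_le (g i) (ltW s0)).1 hi; rewrite (sqr_sqrtr (ltW c0)).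
have hN (c : R) : 0 < c -> \forall i \near F, (Lnorm P 2%:E (EFin \o g i) <= c%:E)%E.
  move=> c0; have := h (c ^+ 2); rewrite exprn_gt0// => /(_ isT).
  by apply: filterS => i; exact: (Lnorm2_le _ (ltW c0)).2.
have N0 i : (0 <= Lnorm P 2%:E (EFin \o g i))%E by exact: Lnorm_ge0.
apply/fine_cvgP; split.
  apply: filterS (hN 1 ltr01) => i Ni; rewrite ge0_fin_numE//.
  exact: le_lt_trans Ni (ltry _).
apply/cvgrPdist_le => c c0; apply: filterS (hN c c0) => i Ni /=.
rewrite sub0r normrN ger0_norm ?fine_ge0// -lee_fin fineK// ge0_fin_numE//.
exact: le_lt_trans Ni (ltry _).
Qed.

End SquareNorm.

Lemma cos_lipschitz (R : realType) (a b : R) : `|cos a - cos b| <= `|a - b|.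
Proof.
wlog ab : a b / b <= a.
  move=> h; have [|/ltW ba] := leP b a; first exact: h.
  by rewrite distrC (distrC a) h.
have [|c _ ->] := @MVT_segment R (@cos R) (fun x => - sin x) b a ab (fun x _ => is_derive_cos x).
  by apply: continuous_subspaceT; exact: continuous_cos.
by rewrite normrM normrN ler_piMl// sin_max.
Qed.

(** * From step functions to Wiener integrals *)

Section WienerIntegral.
Context {R : realType} {H : completeNormedModType R} (ip : H -> H -> R).
Context {d : measure_display} {Omega : measurableType d} (P : probability Omega R).
Variables (F : R -> set_system Omega) (W : R -> H -> Omega -> R).
Hypothesis ip_inner : inner_product ip.
Hypothesis F_filt : filtration F.
Hypothesis W_wiener : cylindrical_wiener ip P F W.
Variable e : H.
Hypothesis e_unit : ip e e = 1.

(** Young's inequality for the cross term 2 |x| |x - y|. The small factor [c] falls on |x|^2, whose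
    integral will be the known [v], so the step functions need no bound of their own. *)
Lemma sqr_norm_dist (x y : H) (c : R) : 0 < c ->
  `| `|x| ^+ 2 - `|y| ^+ 2 | <= c * `|x| ^+ 2 + (1 + c^-1) * `|x - y| ^+ 2.
Proof.
move=> c0; have := ler_distD 0 y x; rewrite !subr0 sub0r normrN => h0.
have nx := normr_ge0 x; have ny := normr_ge0 y; have nd := normr_ge0 (x - y).
have h1 : `|x| <= `|y| + `|x - y| by rewrite addrC -{1}(subrK y x) ler_normD.
have h2 : `|y| <= `|x| + `|x - y| by rewrite distrC addrC -{1}(subrK x y) ler_normD.
set a := `|x| in nx h1 h2 *; set b := `|y| in ny h1 h2 *; set u := `|x - y| in nd h1 h2 *.
have amgm : 2 * a * u <= c * a ^+ 2 + c^-1 * u ^+ 2.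
  have : 0 <= c^-1 * (c * a - u) ^+ 2 by rewrite mulr_ge0 ?sqr_ge0// invr_ge0 ltW.
  rewrite (_ : c^-1 * _ = c * a ^+ 2 - 2 * a * u + c^-1 * u ^+ 2); first lra.
  by field; rewrite gt_eqF.
rewrite ler_norml; apply/andP; split; nra.
Qed.

Variables (t v : R) (f : R -> H) (I : Omega -> R).
Hypothesis t_ge0 : 0 <= t.
Hypothesis f_meas : forall y, measurable_fun `[0, t] (fun s => ip (f s) y).
Hypothesis f_norm_meas : measurable_fun `[0, t] (fun s => `|f s| ^+ 2).
Hypothesis f_energy : (\int[lebesgue_measure]_(s in `[0%R, t]) (`|f s| ^+ 2)%:E = v%:E)%E.

Let v_ge0 : 0 <= v.
Proof. by rewrite -lee_fin -f_energy; apply: integral_ge0 => s _; rewrite lee_fin sqr_ge0. Qed.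

Let dist_meas l : measurable_fun `[0, t] (fun s => `|f s - stepfun l s| ^+ 2).
Proof.
have -> : (fun s => `|f s - stepfun l s| ^+ 2) = (fun s => `|f s| ^+ 2 -
    2 * (\sum_(u <- l) \1_(`]u.1.1, u.1.2]) s * ip (f s) u.2) + `|stepfun l s| ^+ 2).
  apply/funext => s; rewrite -!(ip_norm ip_inner) (ipBl ip_inner) !(ipBr ip_inner).
  have -> : ip (f s) (stepfun l s) = \sum_(u <- l) \1_(`]u.1.1, u.1.2]) s * ip (f s) u.2.
    rewrite (ipC ip_inner) (ip_suml ip_inner); apply: eq_bigr => u _.
    by rewrite (ipZl ip_inner) (ipC ip_inner).
  have -> : ip (stepfun l s) (f s) = \sum_(u <- l) \1_(`]u.1.1, u.1.2]) s * ip (f s) u.2.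
    rewrite (ip_suml ip_inner); apply: eq_bigr => u _.
    by rewrite (ipZl ip_inner) (ipC ip_inner).
  by ring.
apply: measurable_funD; last by apply: measurable_funTS; case: (bdd_meas_stepfun ip_inner l).
apply: measurable_funB => //; apply: measurable_funM => //.
by apply: measurable_sum => u; apply: measurable_funM.
Qed.

Let stepvar_dist l (c D : R) : 0 < c ->
  (\int[lebesgue_measure]_(s in `[0%R, t]) (`|f s - stepfun l s| ^+ 2)%:E <= D%:E)%E ->
  `|v - stepvar l t| <= c * v + (1 + c^-1) * D.
Proof.
move=> c0 hD; have mI : measurable (`[0, t]%classic : set (measurableTypeR R)) by exact: measurable_itv.
have i1 : lebesgue_measure.-integrable `[0, t] (EFin \o (fun s => `|f s| ^+ 2)).
  apply/integrableP; split; first exact/measurable_EFinP.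
  under eq_integral do rewrite /= ger0_norm ?sqr_ge0//.
  by rewrite f_energy ltry.
have i2 : lebesgue_measure.-integrable `[0, t] (EFin \o (fun s => `|stepfun l s| ^+ 2)).
  apply: bdd_meas_integrable_itv (bdd_meas_stepfun ip_inner l).
  by rewrite lebesgue_measure_itv/=; case: ifP => _; rewrite -?EFinD ltry.
have i3 : lebesgue_measure.-integrable `[0, t] (EFin \o (fun s => `|f s - stepfun l s| ^+ 2)).
  apply/integrableP; split; first by apply/measurable_EFinP; exact: dist_meas.
  under eq_integral do rewrite /= ger0_norm ?sqr_ge0//.
  exact: le_lt_trans hD (ltry _).
have vE : v = \int[lebesgue_measure]_(s in `[0, t]) (`|f s| ^+ 2).
  by rewrite /Rintegral f_energy.
rewrite {1}vE /stepvar -RintegralB//.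
have i12 : lebesgue_measure.-integrable `[0, t]
    (EFin \o (fun s => `|f s| ^+ 2 - `|stepfun l s| ^+ 2)).
  by have := integrableB mI i1 i2.
apply: (le_trans (le_normr_Rintegral mI i12)).
have ic1 : lebesgue_measure.-integrable `[0, t] (EFin \o (fun s => c * `|f s| ^+ 2)).
  by have := integrableZl mI c i1.
have ic2 : lebesgue_measure.-integrable `[0, t]
    (EFin \o (fun s => (1 + c^-1) * `|f s - stepfun l s| ^+ 2)).
  by have := integrableZl mI (1 + c^-1) i3.
apply: (@le_trans _ _ (\int[lebesgue_measure]_(s in `[0, t])
   (c * `|f s| ^+ 2 + (1 + c^-1) * `|f s - stepfun l s| ^+ 2))).
  apply: le_Rintegral => //.
  - by have := integrable_abse i12.
  - by have := integrableD mI ic1 ic2.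
  - by move=> s _; exact: sqr_norm_dist.
rewrite RintegralD// !RintegralZl// -vE lerD2l ler_wpM2l//.
  by rewrite addr_ge0// invr_ge0 ltW.
rewrite -lee_fin /Rintegral fineK//.
exact: integrable_fin_num.
Qed.

(** The cosine means of the step integrals have two limits: one because their variances tend to [v]
    and [gcos] is continuous, the other because the integrals tend to [I] in L^2(P) and the cosine
    is Lipschitz. *)
Lemma wiener_integral_cos th : wiener_integral P W t f I ->
  \int[P]_w cos (I w + th) = cos th * gcos v.
Proof.
move=> [l [l_wf l_cvg mI I_cvg]].
have vl : stepvar (l n) t @[n --> \oo] --> v.
  apply/cvgrPdist_le => d0 d0_gt0.
  (* This makes c v <= d0 / 2, [v + 1] avoiding a division by 0; below, [D] makes the distance term
     equal to d0 / 2. *)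
  pose c := d0 / (2 * (v + 1)).
  have v1 : 0 < v + 1 by rewrite ltr_wpDl.
  have c0 : 0 < c by rewrite divr_gt0// mulr_gt0.
  have k0 : 0 < 1 + c^-1 by rewrite ltr_wpDr// invr_ge0 ltW.
  pose D := d0 / 2 / (1 + c^-1).
  have D0 : 0 < D by rewrite !divr_gt0.
  apply: filterS (cvge0_lt _ l_cvg D0) => n /ltW hn; apply: (le_trans (stepvar_dist c0 hn)).
  have -> : (1 + c^-1) * D = d0 / 2 by rewrite /D mulrC divfK// gt_eqF.
  have : c * v <= d0 / 2.
    rewrite /c -(ler_pM2r v1).
    have -> : d0 / (2 * (v + 1)) * v * (v + 1) = d0 / 2 * v by field; rewrite gt_eqF.
    by rewrite ler_wpM2l ?divr_ge0 ?ltW//; lra.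
  lra.
have c1 : \int[P]_w cos (stepint W (l n) w + th) @[n --> \oo] --> cos th * gcos v.
  have -> : (fun n => \int[P]_w cos (stepint W (l n) w + th)) =
      (fun n => cos th * gcos (stepvar (l n) t)).
    apply/funext => n.
    exact: (stepint_cos ip_inner F_filt W_wiener e_unit t_ge0 (l_wf n)).
  apply: cvgM; first exact: cvg_cst.
  exact: (gcos_cvg F_filt W_wiener e_unit (fun n => stepvar_ge0 (l n) t) v_ge0 vl).
have mS n := stepint_measurable F_filt W_wiener t_ge0 (l_wf n).
have bI : bdd_meas (fun w => cos (I w + th)).
  by apply: bdd_meas_cos; exact: measurable_funD.
have bS n : bdd_meas (fun w => cos (stepint W (l n) w + th)).
  by apply: bdd_meas_cos; exact: measurable_funD.
have c2 : \int[P]_w cos (stepint W (l n) w + th) @[n --> \oo] --> \int[P]_w cos (I w + th).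
  apply/cvgrPdist_le => d0 d0_gt0.
  have d2 : 0 < d0 ^+ 2 by rewrite exprn_gt0.
  have near_hn : \forall n \near \oo,
      (\int[P]_w ((I w - stepint W (l n) w) ^+ 2)%:E <= (d0 ^+ 2)%:E)%E.
    exact: ((Lnorm2_cvg0 P _ _).1 I_cvg _ d2).
  apply: filterS near_hn => n hn.
  rewrite -expectB//.
  pose q w := (I w - stepint W (l n) w) ^+ 2.
  have mq : measurable_fun setT q by apply: measurable_funX; exact: measurable_funB.
  have iq : P.-integrable setT (EFin \o q).
    apply/integrableP; split; first exact/measurable_EFinP.
    under eq_integral do rewrite /= ger0_norm ?sqr_ge0//.
    exact: le_lt_trans hn (ltry _).
  have ihq : P.-integrable setT (EFin \o (fun w => (2 * d0)^-1 * q w)).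
    by have := integrableZl measurableT (2 * d0)^-1 iq.
  have ib : P.-integrable setT (EFin \o (fun w => cos (I w + th) - cos (stepint W (l n) w + th))).
    by apply: bdd_meas_integrable; exact: bdd_measB.
  have ic := bdd_meas_integrable P (bdd_meas_cst Omega (d0 / 2)).
  apply: (le_trans (le_normr_Rintegral measurableT ib)).
  (* The inequality x <= d0 / 2 + x^2 / (2 d0) bounds the mean distance by the mean square without a
     square root. *)
  apply: (@le_trans _ _ (\int[P]_w (d0 / 2 + (2 * d0)^-1 * q w))).
    apply: le_Rintegral => //.
    - by have := integrable_abse ib.
    - by have := integrableD measurableT ic ihq.
    - move=> w _.
      have := cos_lipschitz (I w + th) (stepint W (l n) w + th).
      have -> : I w + th - (stepint W (l n) w + th) = I w - stepint W (l n) w by ring.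
      move=> /le_trans; apply; rewrite /q -[(_ - _) ^+ 2]real_normK ?num_real//.
      set x := `|_|; rewrite -subr_ge0.
      have -> : d0 / 2 + (2 * d0)^-1 * x ^+ 2 - x = (2 * d0)^-1 * (d0 - x) ^+ 2.
        by field; rewrite gt_eqF.
      by rewrite mulr_ge0 ?sqr_ge0// invr_ge0 mulr_ge0// ltW.
  have -> : \int[P]_w (d0 / 2 + (2 * d0)^-1 * q w) = d0 / 2 + (2 * d0)^-1 * \int[P]_w q w.
    by rewrite RintegralD//; congr (_ + _); [exact: expect_cst|exact: RintegralZl].
  have : \int[P]_w q w <= d0 ^+ 2.
    by rewrite -lee_fin /Rintegral fineK//; exact: integrable_fin_num.
  rewrite -(ler_pM2l (x := (2 * d0)^-1)) ?invr_gt0 ?mulr_gt0// => h.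
  rewrite (le_trans (lerD (lexx _) h))//.
  have -> : d0 / 2 + (2 * d0)^-1 * d0 ^+ 2 = d0 by field; rewrite gt_eqF.
  exact: lexx.
exact: (cvg_unique _ c2 c1).
Qed.

End WienerIntegral.

(** * The law of the mild solution *)

Lemma law_exists d d' (T : measurableType d) (T' : measurableType d') (R : realType)
  (P : probability T R) (f : T -> T') : measurable_fun setT f ->
  exists nu : probability T' R, forall B, nu B = P (f @^-1` B).
Proof.
move=> mf; pose m := isMeasurableFun.Build _ _ _ _ f mf.
pose f' : {mfun T >-> T'} := HB.pack f m.
by exists (distribution P f').
Qed.

Section MildLaw.
Context {R : realType} {H : completeNormedModType R} (ip : H -> H -> R).
Context {d : measure_display} {Omega : measurableType d} (P : probability Omega R).
Variables (F : R -> set_system Omega) (W : R -> H -> Omega -> R).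
Hypothesis ip_inner : inner_product ip.
Hypothesis H_sep : separable (H := H).
Hypothesis F_filt : filtration F.
Hypothesis W_wiener : cylindrical_wiener ip P F W.
Variable e0 : H.
Hypothesis e0_unit : ip e0 e0 = 1.
Variable Q : {linear H -> H}.
Hypothesis Q_cov : covariance_operator ip Q.

Lemma gaussian_cos (nu : probability (borel H) R) (m : H) (C : H -> H) h th :
  is_gaussian ip nu m C -> 0 <= ip (C h) h ->
  \int[nu]_y cos (ip y h + th) = cos (ip m h + th) * gcos (ip (C h) h).
Proof.
move=> nu_gauss v0.
have bth x : bdd_meas (fun y : R => cos (y + x)).
  by apply: bdd_meas_cos; exact: measurable_funD.
have law := law_expect (nu := gauss_law (ip m h) (ip (C h) h))
  (measurable_ip ip_inner h) (P := nu) _ (bth th).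
rewrite -law; last by move=> B mB; rewrite -gauss1E; exact: nu_gauss.
apply: (etrans (gauss_law_expect (ip m h) v0 (bth th))).
have := gauss_law_cos ip_inner F_filt W_wiener e0_unit 1 (ip m h + th) v0.
rewrite expr1n mul1r => <-; congr Rintegral; apply/funext => y.
by congr cos; ring.
Qed.

(** Since a <y, h> = <y, a h>, the cosine means on [H] give all those of the marginal along h, and
    [expect_eq_R] identifies it. Homogeneity of the quadratic form is assumed because [C] is a bare
    function. *)
Lemma gaussian_law (nu : probability (borel H) R) (m : H) (C : H -> H) :
  (forall a h, ip (C (a *: h)) (a *: h) = a ^+ 2 * ip (C h) h) ->
  (forall h, 0 <= ip (C h) h) ->
  (forall h th, \int[nu]_y cos (ip y h + th) = cos (ip m h + th) * gcos (ip (C h) h)) ->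
  is_gaussian ip nu m C.
Proof.
move=> C2 C0 nu_cos h B mB; rewrite gauss1E.
have [nuh nuhE] := law_exists nu (measurable_ip ip_inner h).
rewrite -nuhE; apply: measure_eq_expect mB; apply: expect_eq_R => a th.
have ba : bdd_meas (fun y : R => cos (a * y + th)).
  by apply: bdd_meas_cos; apply: measurable_funD => //; exact: measurable_funM.
have law := law_expect (nu := nuh) (measurable_ip ip_inner h) (P := nu) _ ba.
rewrite law => [|A mA]; last by rewrite nuhE.
transitivity (cos (a * ip m h + th) * gcos (a ^+ 2 * ip (C h) h)).
  rewrite -C2 -(ipZr ip_inner) -nu_cos; congr Rintegral; apply/funext => y.
  by rewrite (ipZr ip_inner).
apply/esym; apply: (etrans (gauss_law_expect (ip m h) (C0 h) ba)).
rewrite -(gauss_law_cos ip_inner F_filt W_wiener e0_unit a _ (C0 h)).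
by congr Rintegral; apply/funext => y; congr cos; ring.
Qed.

Variables (e : nat -> H) (lam : nat -> R).
Hypothesis e_eigen : eigenbasis ip Q e lam.
Variables (alpha : R) (X : R -> H -> Omega -> H).
Hypothesis alpha_le1 : alpha <= 1.
Hypothesis X_mild : mild_solution ip P Q alpha W X.

Let mX t x : 0 <= t -> measurable_fun setT (X t x : Omega -> borel H).
Proof. by move=> t0; exact: (mild_measurable X_mild). Qed.

Let mipX t x h : 0 <= t -> measurable_fun setT (fun w => ip (X t x w) h).
Proof. by move=> t0; exact: (measurableT_comp (measurable_ip ip_inner h) (mX x t0)). Qed.

(** The stochastic convolution has the variance of [integrand_energy], and the deterministic part
    only shifts the phase. *)
Lemma mild_cos t x h th : 0 <= t ->
  \int[P]_w cos (ip (X t x w) h + th) =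
  cos (ip (expA ip Q alpha (t / 2) x) h + th) * gcos (ip (covt ip Q alpha t h) h).
Proof.
move=> t0; have [I [I_int XI]] := mild_eq X_mild x h t0.
set m := ip (expA _ _ _ _ _) _ in XI *.
have energy := integrand_energy ip_inner Q_cov e_eigen h alpha_le1 t0.
pose f s := powA ip Q ((alpha - 1) / 2) (expA ip Q alpha ((t - s) / 2) h).
have meas y : measurable_fun `[0, t] (fun s => ip (f s) y).
  exact: (integrand_measurable ip_inner Q_cov e_eigen).
have nmeas : measurable_fun `[0, t] (fun s => `|f s| ^+ 2).
  exact: (norm_integrand_measurable ip_inner Q_cov e_eigen).
have <- := wiener_integral_cos ip_inner F_filt W_wiener e0_unit t0 meas nmeas energy (m + th) I_int.
have [_ [_ _ mI _]] := I_int.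
apply: expect_ae.
- by case: (bdd_meas_cos (measurable_funD (mipX x h t0) (measurable_cst th))).
- by case: (bdd_meas_cos (measurable_funD mI (measurable_cst (m + th)))).
- by apply: filterS XI => w ->; congr cos; ring.
Qed.

Lemma covtZ t a h : 0 <= t ->
  ip (covt ip Q alpha t (a *: h)) (a *: h) = a ^+ 2 * ip (covt ip Q alpha t h) h.
Proof.
move=> t0; have -> : covt ip Q alpha t (a *: h) = a *: covt ip Q alpha t h.
  have [e_basis _] := e_eigen.
  apply: (basis_ext e_basis) => k; rewrite (ipZl ip_inner).
  by rewrite !(covt_coef ip_inner Q_cov e_eigen)// (ipZl ip_inner); ring.
by rewrite (ipZl ip_inner) (ipZr ip_inner); ring.
Qed.

(** The set from which [gaussian] chooses is inhabited by the law of X(t,x); equality of cosine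
    means then identifies the chosen measure with that law. *)
Lemma ou_semigroupE t x (phi : H -> R) : 0 <= t -> bdd_meas (phi : borel H -> R) ->
  ou_semigroup ip Q alpha t phi x = \int[P]_w phi (X t x w).
Proof.
move=> t0 bphi; rewrite /ou_semigroup.
set m := expA ip Q alpha (t / 2) x; set C := covt ip Q alpha t.
have C0 h : 0 <= ip (C h) h by exact: (covt_ge0 ip_inner Q_cov e_eigen).
have [nu nuE] := law_exists P (mX x t0).
have nu_expect (f : borel H -> R) : bdd_meas f -> \int[nu]_y f y = \int[P]_w f (X t x w).
  by move=> bf; apply: (law_expect (mX x t0)) => // B mB; rewrite nuE.
have bcos h th : bdd_meas (fun y : borel H => cos (ip y h + th)).
  by apply: bdd_meas_cos; apply: measurable_funD => //; exact: measurable_ip.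
have nu_cos h th : \int[nu]_y cos (ip y h + th) = cos (ip m h + th) * gcos (ip (C h) h).
  by rewrite (nu_expect _ (bcos h th)) mild_cos.
have nu_gauss : is_gaussian ip nu m C.
  by apply: gaussian_law => // a h; exact: covtZ.
have g_gauss : is_gaussian ip (gaussian ip m C) m C.
  by rewrite /gaussian; apply: (@getPex _ [set nu : probability (borel H) R | is_gaussian ip nu m C]); exists nu.
rewrite -(nu_expect _ bphi); apply: (expect_eq_H ip_inner H_sep) => // h th.
by rewrite (gaussian_cos _ g_gauss (C0 h)) nu_cos.
Qed.

(** At t = 0 the covariance vanishes, so the cosine means are those of the Dirac mass at [x]; the
    closed set {x} then has full measure. *)
Lemma mild_start x : {ae P, forall w, X 0 x w = x}.
Proof.
have [nu nuE] := law_exists P (mX x (lexx 0)).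
have nu_expect (f : borel H -> R) : bdd_meas f -> \int[nu]_y f y = \int[P]_w f (X 0 x w).
  by move=> bf; apply: (law_expect (mX x (lexx 0))) => // B mB; rewrite nuE.
pose dx : probability (borel H) R := @dirac _ (borel H) x R.
have dx_expect (f : borel H -> R) : bdd_meas f -> \int[dx]_y f y = f x.
  move=> [mf _]; rewrite /Rintegral integral_dirac//; last exact/measurable_EFinP.
  by rewrite diracT mul1e.
have bcos h th : bdd_meas (fun y : borel H => cos (ip y h + th)).
  by apply: bdd_meas_cos; apply: measurable_funD => //; exact: measurable_ip.
have mx : measurable ([set x] : set (borel H)).
  rewrite -[X in measurable X]setCK; apply: measurableC; apply: sub_sigma_algebra.
  by apply: closed_openC; apply: accessible_closed_set1; apply: hausdorff_accessible; exact: norm_hausdorff.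
have nux : nu [set x] = dx [set x].
  apply: measure_eq_expect mx => f; apply: (expect_eq_H ip_inner H_sep) => h th.
  rewrite dx_expect// nu_expect// mild_cos// mul0r (expA0 ip_inner Q_cov e_eigen).
  have -> : covt ip Q alpha 0 h = 0.
    by rewrite /covt (expA0 ip_inner Q_cov e_eigen) subrr linear0.
  by rewrite (ip0l ip_inner) (gcos0 F_filt W_wiener e0_unit) mulr1.
exists (~` (X 0 x @^-1` [set x])); split => //.
  apply: measurableC; rewrite -[X in measurable X]setTI.
  exact: (mX x (lexx 0)).
rewrite probability_setC; last first.
  by rewrite -[X in measurable X]setTI; exact: (mX x (lexx 0)).
have dx1 : @dirac _ (borel H) x R [set x] = 1%E by rewrite diracE mem_set.
by rewrite -nuE nux [X in (_ - X)%E]dx1 subee.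
Qed.

Variable mu : probability (borel H) R.
Hypothesis mu_gauss : is_gaussian ip mu 0 Q.

Lemma mu_cos h th : \int[mu]_y cos (ip y h + th) = cos th * gcos (ip (Q h) h).
Proof.
rewrite (gaussian_cos _ mu_gauss) ?(ip0l ip_inner) ?add0r//.
have [->|h0] := eqVneq h 0; first by rewrite (ip0r ip_inner).
exact/ltW/(cov_positive Q_cov).
Qed.

(** Measurability of x -> E f(X(t,x)) is carried along in the class, as [X] is only known to be
    measurable in w for each x. For a cosine, the mean is a constant times a cosine in x, with h
    replaced by e^(-tA^alpha/2) h, and [covt_variance] concludes. *)
Lemma mild_invariant t (f : borel H -> R) : 0 <= t -> bdd_meas f ->
  bdd_meas (fun x : borel H => \int[P]_w f (X t x w)) /\
  \int[mu]_x (\int[P]_w f (X t x w)) = \int[mu]_x f x.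
Proof.
move=> t0 bf; have t20 : 0 <= t / 2 by rewrite divr_ge0.
pose S (f : borel H -> R) (x : borel H) := \int[P]_w f (X t x w).
pose C (f : borel H -> R) := bdd_meas f /\ (bdd_meas (S f) /\
  \int[mu]_x S f x = \int[mu]_x f x).
suff [] : C f by [].
have bX (g : borel H -> R) x : bdd_meas g -> bdd_meas (fun w => g (X t x w)).
  by move=> bg; apply: bdd_meas_comp (mX x t0) bg.
apply: (trig_induct_H ip_inner H_sep (C := C)) => // {f bf}.
  split=> [a f g [bf [bSf ef]] [bg [bSg eg]]|f_ f M Cf fM ff].
    have SE : S (fun x => a * f x + g x) = (fun x => a * S f x + S g x).
      by apply/funext => x; rewrite /S expect_lin//; exact: bX.
    split; first exact: bdd_meas_lin.
    rewrite SE; split; first exact: bdd_meas_lin.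
    by rewrite !expect_lin// ef eg.
  have bf n : bdd_meas (f_ n) by case: (Cf n).
  have bSf n : bdd_meas (S (f_ n)) by case: (Cf n) => _ [].
  have SfM n x : `|S (f_ n) x| <= M.
    rewrite -[leRHS](expect_cst P); apply: expect_norm_le.
    - exact: bX.
    - exact: bdd_meas_cst.
    - by move=> w; exact: fM.
  have Sff x : S (f_ n) x @[n --> \oo] --> S f x.
    apply: (expect_cvg (M := M)); first by move=> n; exact: bX.
      by move=> n w; exact: fM.
    by move=> w; exact: ff.
  split; first exact: (bdd_meas_lim bf fM ff).
  split; first exact: (bdd_meas_lim bSf SfM Sff).
  have c1 := expect_cvg (P := mu) bSf SfM Sff.
  have c2 := expect_cvg (P := mu) bf fM ff.
  have e12 : (fun n => \int[mu]_x S (f_ n) x) = (fun n => \int[mu]_x f_ n x).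
    by apply/funext => n; case: (Cf n) => _ [].
  by rewrite e12 in c1; apply: (cvg_unique _ c1 c2).
move=> h th; set f := (fun x => _).
have bcos h' th' : bdd_meas (fun y : borel H => cos (ip y h' + th')).
  by apply: bdd_meas_cos; apply: measurable_funD => //; exact: measurable_ip.
have SE : S f = (fun x => gcos (ip (covt ip Q alpha t h) h) *
    cos (ip x (expA ip Q alpha (t / 2) h) + th)).
  apply/funext => x; rewrite /S /f mild_cos// (expA_symmetric ip_inner Q_cov e_eigen)//.
  by rewrite mulrC.
split; first exact: bcos.
rewrite SE; split; first exact/bdd_measZ/bcos.
rewrite expectZ// /f !mu_cos mulrCA; congr (_ * _).
rewrite mulrC -(gcosD ip_inner F_filt W_wiener e0_unit).
- by rewrite (covt_variance ip_inner Q_cov e_eigen).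
- set y := expA _ _ _ _ _; have [->|y0] := eqVneq y 0; first by rewrite (ip0r ip_inner).
  exact/ltW/(cov_positive Q_cov).
- exact: (covt_ge0 ip_inner Q_cov e_eigen).
Qed.

End MildLaw.

(** * The Feynman-Kac functional *)

Section NonmeasurableIntegral.
Context d (T : measurableType d) (R : realType) (P : {measure set T -> \bar R}).
Import HBNNSimple.

(** Both integrals are suprema over simple functions. One below [f] is below [g] almost everywhere;
    conversely [g] may be set to 0 on [N], and a simple function below the result is below [f]. *)
Let ge0_integral_ae (f g : T -> \bar R) (N : set T) : measurable N -> P N = 0%E ->
  measurable_fun setT g -> (forall x, 0 <= f x)%E -> (forall x, 0 <= g x)%E ->
  (forall x, ~ N x -> f x = g x) -> (\int[P]_x f x = \int[P]_x g x)%E.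
Proof.
move=> mN PN mg f0 g0 fg; apply/eqP; rewrite eq_le; apply/andP; split.
  rewrite [leLHS]ge0_integralTE//; apply: ge_ereal_sup => _ [h hf <-].
  rewrite -integralT_nnsfun; apply: ae_ge0_le_integral => //.
  - by move=> x _; rewrite lee_fin.
  - exact/measurable_EFinP.
  - exists N; split => // x; apply: contra_notP => Nx _.
    by rewrite -fg//; exact: hf.
have e1 : (\int[P]_x g x = \int[P]_x (g \_ (~` N)) x)%E.
  apply: ge0_ae_eq_integral => //.
  - apply/(measurable_restrictT _ (measurableC mN)).1; exact: measurable_funTS.
  - by move=> x _; rewrite patchE; case: ifP.
  - exists N; split => // x; apply: contra_notP => Nx _.
    by rewrite patchE mem_set.
rewrite e1 !ge0_integralTE//; last by move=> x; rewrite patchE; case: ifP.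
apply: le_ereal_sup => _ [h hg <-]; exists h => // x.
apply: (le_trans (hg x)); rewrite patchE; case: ifP => // /set_mem Nx.
by rewrite fg.
Qed.

(* Only [g] is assumed to be measurable: paths of the process are continuous
   outside a null set only, so that the Feynman-Kac functional may fail to be
   measurable on that set. *)
Lemma integral_ae_measurable (f g : T -> R) (N : set T) : measurable N -> P N = 0%E ->
  measurable_fun setT g -> (forall x, ~ N x -> f x = g x) ->
  \int[P]_x f x = \int[P]_x g x.
Proof.
move=> mN PN mg fg; congr fine; rewrite integralE [RHS]integralE.
have mg' : measurable_fun setT (EFin \o g) by exact/measurable_EFinP.
congr (_ - _)%E; apply: (@ge0_integral_ae _ _ N) => //.
- exact: measurable_funepos.
- by move=> x Nx; rewrite !funeposE /= fg.
- exact: measurable_funeneg.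
- by move=> x Nx; rewrite !funenegE /= fg.
Qed.

End NonmeasurableIntegral.

Lemma measurable_fun_nat_param d1 d2 d3 (T1 : measurableType d1) (T2 : measurableType d2)
  (T3 : measurableType d3) (k : T1 -> nat) (Z : nat -> T2 -> T3) :
  (forall n, measurable (k @^-1` [set n])) -> (forall n, measurable_fun setT (Z n)) ->
  measurable_fun setT (fun x : T1 * T2 => Z (k x.1) x.2).
Proof.
move=> mk mZ _ B mB; rewrite setTI.
have -> : (fun x : T1 * T2 => Z (k x.1) x.2) @^-1` B =
    \bigcup_n ((k @^-1` [set n]) `*` (Z n @^-1` B)).
  apply/seteqP; split=> [[x y] /= Bxy|[x y] [n _ /= [kn Bn]]].
    by exists (k x).
  by rewrite kn.
apply: bigcup_measurable => n _; apply: measurableX => //.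
by rewrite -[X in measurable X]setTI; exact: mZ.
Qed.

Section TimeGrid.
Context {R : realType}.

(** Time is discretized from below with step 1/(n + 1); [truncn] is 0 on negative numbers, hence the
    limit [max 0 s] in [cvg_grid]. *)
Definition grid (n : nat) (s : R) : nat := Num.truncn (n.+1%:R * s).

Lemma measurable_grid n k : measurable (grid n @^-1` [set k] : set (measurableTypeR R)).
Proof.
have mg : measurable_fun setT (fun s : R => (grid n s)%:R : R).
  apply: nondecreasing_measurable => // s s' ss'.
  by rewrite ler_nat; apply: Num.Theory.le_truncn; rewrite ler_wpM2l.
have := mg measurableT [set k%:R] (measurable_set1 _); rewrite setTI.
suff -> : (fun s : R => (grid n s)%:R : R) @^-1` [set k%:R] = grid n @^-1` [set k] by [].
apply/seteqP; split=> s /=; last by move=> ->.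
by move=> /eqP; rewrite eqr_nat => /eqP.
Qed.

Lemma cvg_grid (s : R) : (grid n s)%:R / n.+1%:R @[n --> \oo] --> Num.max 0 s.
Proof.
have [s0|s0] := leP 0 s; last first.
  apply: cvg_near_cst; apply: nearW => n.
  suff -> : grid n s = 0%N by rewrite mul0r.
  apply/eqP; rewrite -leqn0 leqNgt Num.Theory.truncn_gt0 -ltNge.
  by rewrite (@le_lt_trans _ _ 0)// pmulr_rle0// ltW.
apply: (squeeze_cvgr (f := fun n => s - n.+1%:R^-1) (h := fun=> s)).
- apply: nearW => n; have n0 : 0 < n.+1%:R :> R by [].
  have ns : 0 <= n.+1%:R * s by rewrite mulr_ge0.
  have /andP[h1 h2] := Num.Theory.truncn_itv ns.
  rewrite ler_pdivrMr// ler_pdivlMr// mulrBl mulVf ?gt_eqF// mulrC lerBlDr natr1.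
  by apply/andP; split; [exact: ltW|exact: h1].
- rewrite -[X in _ --> X]subr0; apply: cvgB; [exact: cvg_cst|exact: cvg_harmonic].
- exact: cvg_cst.
Qed.

End TimeGrid.

Section Path.
Context {R : realType} {H : completeNormedModType R}.
Context {d : measure_display} {Omega : measurableType d} (P : probability Omega R).
Variables (V : H -> R) (M : R) (x : H) (Y : R -> Omega -> H) (N : set Omega).
Hypothesis V_cont : continuous V.
Hypothesis V_ge0 : forall z, 0 <= V z.
Hypothesis V_le : forall z, V z <= M.
Hypothesis mY : forall t : R, 0 <= t -> measurable_fun setT (Y t : Omega -> borel H).
Hypothesis mN : measurable N.
Hypothesis Y_good : forall w, ~ N w ->
  Y 0 w = x /\ {within `[0, +oo[, continuous (fun t => Y t w)}.

Let M_ge0 : 0 <= M. Proof. exact: le_trans (V_le 0). Qed.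

(** The potential along the path, set to 0 on the null set [N] where the path may be discontinuous
    and constant in time before 0. This version is jointly measurable in (s, w), as a limit over the
    time grid. *)
Let pot (s : R) (w : Omega) : R := \1_(~` N) w * V (Y (Num.max 0 s) w).

Let pot_bounds s w : 0 <= pot s w <= M.
Proof.
rewrite /pot indicE; case: (_ \in _) => /=; last by rewrite mul0r lexx M_ge0.
by rewrite mul1r V_ge0 V_le.
Qed.

Let mpot : measurable_fun setT (fun z : measurableTypeR R * Omega => pot z.1 z.2).
Proof.
apply: (measurable_fun_cvg (h := fun n (z : measurableTypeR R * Omega) =>
    \1_(~` N) z.2 * V (Y ((grid n z.1)%:R / n.+1%:R) z.2))).
  move=> n; apply: (measurable_fun_nat_param (k := grid n)
    (Z := fun k w => \1_(~` N) w * V (Y (k%:R / n.+1%:R) w))).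
    by move=> k; exact: measurable_grid.
  move=> k; apply: measurable_funM; first by apply: measurable_indic; exact: measurableC.
  by apply: (measurableT_comp (measurable_continuous V_cont)); apply: mY; rewrite divr_ge0.
move=> [s w] _ /=; rewrite /pot !indicE; case: (boolP (w \in ~` N)) => /=; last first.
  by move=> _; under eq_fun do rewrite mul0r; rewrite mul0r; exact: cvg_cst.
rewrite inE => /Y_good[_ cY]; rewrite mul1r; under eq_fun do rewrite mul1r.
have cYs : Y ((grid n s)%:R / n.+1%:R) w @[n --> \oo] --> Y (Num.max 0 s) w.
  apply: (within_continuous_seq (u := fun n => (grid n s)%:R / n.+1%:R) cY _ _ (@cvg_grid R s)) => [|n] /=.
    by rewrite in_itv/= andbT le_max lexx.
  by rewrite in_itv/= andbT divr_ge0.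
by apply: (cvg_comp _ V cYs); exact: V_cont.
Qed.

Let mpots w : measurable_fun setT (fun s : measurableTypeR R => pot s w).
Proof. exact: (measurable_fun_pair1 (f := fun z : measurableTypeR R * Omega => pot z.1 z.2)). Qed.

Definition action (t : R) (w : Omega) : R := \int[lebesgue_measure]_(s in `[0, t]) pot s w.

Let fint (t : R) w : lebesgue_measure.-integrable `[0, t] (EFin \o (pot^~ w)).
Proof.
apply: bdd_meas_integrable_itv.
  by rewrite lebesgue_measure_itv/=; case: ifP => _; rewrite -?EFinD ltry.
split; first exact: mpots.
by exists M => s; have /andP[h0 h1] := pot_bounds s w; rewrite ger0_norm.
Qed.

Lemma measurable_action t : measurable_fun setT (action t).
Proof.
pose f (z : measurableTypeR R * Omega) : \bar R := (\1_(`[0, t]%classic) z.1 * pot z.1 z.2)%:E.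
have mf : measurable_fun setT f.
  apply/measurable_EFinP; apply: measurable_funM; last exact: mpot.
  have m1 : measurable_fun [set: measurableTypeR R]
      (\1_(`[0, t]%classic : set (measurableTypeR R)) : measurableTypeR R -> R).
    exact: measurable_indic.
  exact: (measurableT_comp m1).
have f0 z : (0 <= f z)%E.
  by rewrite lee_fin mulr_ge0//; have /andP[] := pot_bounds z.1 z.2.
have : measurable_fun setT (fubini_G lebesgue_measure f).
  exact: measurable_fun_fubini_tonelli_G.
move=> /(measurableT_comp (fine_measurable measurableT)).
suff -> : action t = fine \o fubini_G lebesgue_measure f by [].
apply/funext => w; rewrite /action /= /fubini_G Rintegral_mkcond; congr fine.
by apply: eq_integral => s _; rewrite /f patchE indicE/=; case: ifP => _;
  rewrite ?mul1r ?mul0r.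
Qed.

Lemma actionE t w : ~ N w ->
  action t w = \int[lebesgue_measure]_(s in `[0, t]) V (Y s w).
Proof.
move=> Nw; apply: eq_Rintegral => s; rewrite inE/= in_itv/= => /andP[s0 _].
by rewrite /pot indicE mem_set//= mul1r (max_idPr s0).
Qed.

Let lebesgue0t (t : R) : 0 <= t -> fine (lebesgue_measure `[0, t]) = t.
Proof.
rewrite lebesgue_measure_itv/= lte_fin; case: ltP => [_ _|t0 t0']; first by rewrite -EFinB/= subr0.
by apply/eqP; rewrite eq_le t0' t0.
Qed.

Let cst_int (t c : R) : 0 <= t -> \int[lebesgue_measure]_(s in `[0, t]) c = c * t.
Proof. by move=> t0; rewrite Rintegral_cst// [X in _ * X]lebesgue0t. Qed.

Let cst_fint (t c : R) : lebesgue_measure.-integrable `[0, t] (EFin \o (fun=> c)).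
Proof.
apply: bdd_meas_integrable_itv (bdd_meas_cst _ c).
by rewrite lebesgue_measure_itv/=; case: ifP => _; rewrite -?EFinD ltry.
Qed.

Lemma action_bounds t w : 0 <= t -> 0 <= action t w <= M * t.
Proof.
move=> t0; apply/andP; split.
  by apply: Rintegral_ge0 => s _; have /andP[] := pot_bounds s w.
rewrite -cst_int//; apply: le_Rintegral => //.
by move=> s _; have /andP[] := pot_bounds s w.
Qed.

(** The path is right continuous at 0 and [V] is continuous, so the time averages over [0, t n]
    approach the value at the starting point. *)
Lemma action_cvg (t : nat -> R) w : ~ N w -> (forall n, 0 < t n) ->
  t n @[n --> \oo] --> 0 -> action (t n) w / t n @[n --> \oo] --> V x.
Proof.
move=> Nw t0 tcvg; have [Y0 cY] := Y_good Nw.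
apply/cvgrPdist_le => c c0.
have [r r0 hr] : exists2 r, 0 < r & forall s, 0 <= s -> s < r -> `|V x - V (Y s w)| <= c.
  move/subspace_continuousP: cY => /(_ 0); rewrite /= in_itv/= lexx => /(_ isT) cY0.
  have : \forall z \near nbhs (Y 0 w), `|V x - V z| <= c.
    rewrite Y0; have Vx : V z @[z --> x] --> V x by exact: V_cont.
    exact: ((cvgrPdist_le _ _).1 Vx c c0).
  move=> /cY0 /nbhs_ballP[r /= r0 hr]; exists r => // s s0 sr.
  apply: (hr s) => /=; last by rewrite in_itv/= s0.
  by rewrite -ball_normE/= sub0r normrN ger0_norm.
near=> n.
have tn0 := t0 n.
have tr : t n < r by near: n; exact: (cvgr_lt _ tcvg).
rewrite -(ler_pM2r tn0) -[X in _ * X <= _]gtr0_norm// -normrM mulrBl divfK ?gt_eqF//.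
rewrite -(cst_int (V x) (ltW tn0)) /action -RintegralB//.
have i12 : lebesgue_measure.-integrable `[0, t n] (EFin \o (fun s => V x - pot s w)).
  by apply: (eq_integrable _ _ _ _ (integrableB _ (cst_fint (t n) (V x)) (fint (t n) w))).
apply: (le_trans (le_normr_Rintegral _ i12)) => //.
rewrite -(cst_int c (ltW tn0)); apply: le_Rintegral => //.
  by have := integrable_abse i12.
move=> s /=; rewrite in_itv/= => /andP[s0 st].
rewrite /pot indicE mem_set//= mul1r (max_idPr s0).
by apply: hr => //; exact: le_lt_trans tr.
Unshelve. all: end_near.
Qed.

End Path.

Lemma expRN_sub1 {R : realType} (u : R) : 0 <= u -> `|expR (- u) - 1| <= u.
Proof.
move=> u0; rewrite distrC ger0_norm; last first.
  by rewrite subr_ge0 -expR0 ler_expR oppr_le0.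
by rewrite lerBlDr -lerBlDl; exact: expR_ge1Dx.
Qed.

(** After multiplication by 1 + u, the bound e^(-u) (1 + u) <= 1 leaves at most 1 + (u - 1)(1 + u) =
    u^2. *)
Lemma expRN_sub1D {R : realType} (u : R) : 0 <= u -> `|expR (- u) - 1 + u| <= u ^+ 2.
Proof.
move=> u0; have e0 := expR_ge1Dx (- u).
rewrite ger0_norm; last by lra.
have e1 : expR (- u) * (1 + u) <= 1.
  apply: (le_trans (ler_wpM2l (expR_ge0 _) (expR_ge1Dx u))).
  by rewrite -expRD addNr expR0.
have e2 : (expR (- u) - 1 + u) * (1 + u) <= u ^+ 2 * (1 + u) by nra.
by rewrite -(@ler_pM2r _ (1 + u))//; lra.
Qed.

Section FeynmanKac.
Context {R : realType} {H : completeNormedModType R}.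
Context {d : measure_display} {Omega : measurableType d} (P : probability Omega R).
Variables (V : H -> R) (M : R) (X : R -> H -> Omega -> H) (eps : R) (x : H).
Hypothesis V_cont : continuous V.
Hypothesis V_ge0 : forall z, 0 <= V z.
Hypothesis V_le : forall z, V z <= M.
Hypothesis mX : forall t x, 0 <= t -> measurable_fun setT (X t x : Omega -> borel H).
Hypothesis X_start : {ae P, forall w, X 0 x w = x}.
Hypothesis X_cont : {ae P, forall w, {within `[0, +oo[, continuous (fun t => X t x w)}}.
Hypothesis eps_gt0 : 0 < eps.

Let M_ge0 : 0 <= M. Proof. exact: le_trans (V_le 0). Qed.

Let exists_null : exists N, [/\ measurable N, P N = 0%E & forall w, ~ N w ->
  X 0 x w = x /\ {within `[0, +oo[, continuous (fun t => X t x w)}].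
Proof.
case: X_start => N1 [m1 P1 h1]; case: X_cont => N2 [m2 P2 h2].
exists (N1 `|` N2); split; first exact: measurableU.
  by apply: null_set_setU.
by move=> w /not_orP[n1 n2]; split; [exact: contra_notP (h1 w) n1|exact: contra_notP (h2 w) n2].
Qed.

Let N := projT1 (cid exists_null).
Let mN : measurable N. Proof. by rewrite /N; case: cid => ? []. Qed.
Let PN : P N = 0%E. Proof. by rewrite /N; case: cid => ? []. Qed.
Let X_good w : ~ N w ->
  X 0 x w = x /\ {within `[0, +oo[, continuous (fun t => X t x w)}.
Proof. by rewrite /N; case: cid => ? [? ? h]; exact: h. Qed.

Let mXx t : 0 <= t -> measurable_fun setT (X t x : Omega -> borel H).
Proof. exact: mX. Qed.

Let u (t : R) w : R := eps^-1 * action V (X^~ x) N t w.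

Let u_bounds t w : 0 <= t -> 0 <= u t w <= eps^-1 * M * t.
Proof.
move=> t0; have /andP[h0 h1] := action_bounds V_cont V_ge0 V_le mXx mN X_good w t0.
by rewrite /u mulr_ge0 ?invr_ge0 ?(ltW eps_gt0)//= -mulrA ler_pM2l ?invr_gt0.
Qed.

Let u_meas t : measurable_fun setT (u t).
Proof.
apply: measurable_funM => //.
exact: (measurable_action V_cont V_ge0 V_le mXx mN X_good).
Qed.

Section Observable.
Variable phi : H -> R.
Hypothesis phi_Cb : Cb phi.

Let bphi t : 0 <= t -> bdd_meas (fun w => phi (X t x w)).
Proof. by move=> t0; exact: bdd_meas_comp (mX x t0) (Cb_bdd_meas phi_Cb). Qed.

Let bexp t : 0 <= t -> bdd_meas (fun w => expR (- u t w)).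
Proof.
move=> t0; split.
  apply: measurableT_comp; first exact: measurable_expR.
  exact: measurableT_comp.
exists 1 => w; rewrite ger0_norm ?expR_ge0// -expR0 ler_expR oppr_le0.
by have /andP[] := u_bounds w t0.
Qed.

Let fk_semigroupE t : 0 <= t ->
  fk_semigroup P X V eps t phi x = \int[P]_w (phi (X t x w) * expR (- u t w)).
Proof.
move=> t0; apply: (integral_ae_measurable mN PN).
  by have [] := bdd_measM (bphi t0) (bexp t0).
by move=> w Nw; rewrite /u (actionE V (X^~ x) t Nw) mulNr.
Qed.

Let fk_diff t : 0 <= t ->
  fk_semigroup P X V eps t phi x - \int[P]_w phi (X t x w) =
  \int[P]_w (phi (X t x w) * (expR (- u t w) - 1)).
Proof.
move=> t0; rewrite fk_semigroupE//.
rewrite -(expectB P (bdd_measM (bphi t0) (bexp t0)) (bphi t0)).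
by congr Rintegral; apply/funext => w; rewrite mulrBr mulr1.
Qed.

Let bdiff t : 0 <= t -> bdd_meas (fun w => phi (X t x w) * (expR (- u t w) - 1)).
Proof.
move=> t0; apply: bdd_measM (bphi t0) _; apply: bdd_measB (bexp t0) _.
exact: bdd_meas_cst.
Qed.

Let bnorm t : 0 <= t -> bdd_meas (fun w => `|phi (X t x w)|).
Proof.
move=> t0; have [mp [C pC]] := bphi t0; split; first exact: measurableT_comp.
by exists C => w; rewrite normr_id.
Qed.

Let diff_le t w : 0 <= t ->
  `|phi (X t x w) * (expR (- u t w) - 1)| <= eps^-1 * M * t * `|phi (X t x w)|.
Proof.
move=> t0; rewrite normrM mulrC ler_wpM2r//.
have /andP[u0 uM] := u_bounds w t0; apply: le_trans uM; exact: expRN_sub1.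
Qed.

(** Pathwise, 1 - e^(-u) <= u <= eps^-1 M t. *)
Lemma fk_diff_le t : 0 <= t ->
  `|fk_semigroup P X V eps t phi x - \int[P]_w phi (X t x w)| <=
  eps^-1 * M * t * \int[P]_w `|phi (X t x w)|.
Proof.
move=> t0; rewrite fk_diff// -(expectZ P _ (bnorm t0)).
apply: expect_norm_le (bdiff t0) _ _ => [|w]; last exact: diff_le.
exact: bdd_measZ (bnorm t0).
Qed.

(** Path by path, the exponent divided by t tends to V(x) / eps by [action_cvg]; [diff_le] dominates
    the quotients. *)
Lemma fk_diff_cvg (t : nat -> R) : (forall n, 0 < t n) -> t n @[n --> \oo] --> 0 ->
  (t n)^-1 * (fk_semigroup P X V eps (t n) phi x - \int[P]_w phi (X (t n) x w))
    @[n --> \oo] --> - (eps^-1 * (V x * phi x)).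
Proof.
move=> t0 tcvg; have t0' n := ltW (t0 n).
have [phi_cont [C phiC]] := phi_Cb.
under eq_fun => n do rewrite (fk_diff (t0' n)) -(expectZ P _ (bdiff (t0' n))).
rewrite -(expect_cst P (- (eps^-1 * (V x * phi x)))).
apply: (expect_cvg_ae (M := eps^-1 * M * C)).
- by move=> n; have [] := bdd_measZ (t n)^-1 (bdiff (t0' n)).
- exact: measurable_cst.
- apply: aeW => w n; rewrite normrM gtr0_norm ?invr_gt0// mulrC ler_pdivrMr//.
  apply: (le_trans (diff_le w (t0' n))); rewrite mulrAC ler_wpM2r//.
  by rewrite ler_wpM2l// mulr_ge0// invr_ge0 ltW.
- exists N; split => // w; apply: contra_notP => Nw.
  have [X0 cX] := X_good Nw.
  have uc : (t n)^-1 * u (t n) w @[n --> \oo] --> eps^-1 * V x.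
    under eq_fun => n do rewrite /u mulrCA.
    apply: cvgMr; under eq_fun => n do rewrite mulrC.
    exact: (action_cvg V_cont V_ge0 V_le mXx mN X_good Nw t0 tcvg).
  have phic : phi (X (t n) x w) @[n --> \oo] --> phi x.
    have cXs : X (t n) x w @[n --> \oo] --> X 0 x w.
      apply: (within_continuous_seq (u := t) cX _ _ tcvg) => [|n] /=.
        by rewrite in_itv/= lexx.
      by rewrite in_itv/= andbT.
    by rewrite X0 in cXs; apply: (cvg_comp _ phi cXs); exact: phi_cont.
  (* Adding and subtracting [u] leaves a remainder of at most (u / t)^2 t, which vanishes because u
     / t converges. *)
  have ec : (t n)^-1 * (expR (- u (t n) w) - 1) @[n --> \oo] --> - (eps^-1 * V x).
    under eq_fun => n do rewrite -[X in _ * X](addrK (u (t n) w)) mulrBr.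
    rewrite -(sub0r (eps^-1 * V x)); apply: (cvgB _ uc).
    apply: norm_cvg0; apply: (squeeze_cvgr (f := fun=> 0)
      (h := fun n => ((t n)^-1 * u (t n) w) ^+ 2 * t n)).
    - apply: nearW => n; rewrite normr_ge0/=.
      have /andP[u0 _] := u_bounds w (t0' n).
      have tn0 := t0 n; have := expRN_sub1D u0.
      move: (t n) (u (t n) w) tn0 => r U r0 hU.
      have -> : (r^-1 * U) ^+ 2 * r = r^-1 * U ^+ 2.
        by field; exact: lt0r_neq0.
      by rewrite normrM gtr0_norm ?invr_gt0// ler_pM2l// invr_gt0.
    - exact: cvg_cst.
    - rewrite -[X in _ --> X](mulr0 ((eps^-1 * V x) ^+ 2)); apply: cvgM tcvg.
      exact: (cvgM uc uc).
  rewrite /= (_ : - (eps^-1 * (V x * phi x)) = phi x * - (eps^-1 * V x)); last by ring.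
  by under eq_fun => n do rewrite mulrCA; exact: cvgM phic ec.
Qed.

End Observable.
End FeynmanKac.

(** * Mean squares *)

Section SquareMean.
Context {R : realType} {H : completeNormedModType R} (mu : probability (borel H) R).
Implicit Types f g h : H -> R.

Lemma ae_mono (A B : H -> Prop) : (forall x, A x -> B x) ->
  {ae mu, forall x, A x} -> {ae mu, forall x, B x}.
Proof. by move=> AB [N [mN N0 AN]]; exists N; split => // x nB; apply: AN => /AB. Qed.

Lemma ae_mono2 (A B C : H -> Prop) : (forall x, A x -> B x -> C x) ->
  {ae mu, forall x, A x} -> {ae mu, forall x, B x} -> {ae mu, forall x, C x}.
Proof.
move=> ABC [N [mN N0 AN]] [M [mM M0 BM]].
exists (N `|` M); split; [exact: measurableU|exact: null_set_setU|move=> x nC].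
have [Ax|/AN] := pselect (A x); last by left.
by right; apply: BM => Bx; apply: nC; exact: ABC.
Qed.

(** This real number is 0 when the integral is infinite, hence the [in_L2] hypotheses in the
    comparisons. *)
Definition sqmean f : R := \int[mu]_x ((f : borel H -> R) x ^+ 2).

Lemma in_L2P f : in_L2 mu f <-> measurable_fun setT (f : borel H -> R) /\
  mu.-integrable setT (EFin \o ((fun x => f x ^+ 2) : borel H -> R)).
Proof.
have Nsq := Lnorm2_sq mu (f : borel H -> R).
have N0 := Lnorm_ge0 mu 2%:E (EFin \o (f : borel H -> R)).
split.
  move=> /andP[/set_mem/= mf /set_mem/= ff]; split; first exact: mf.
  apply/integrableP; split; first by apply/measurable_EFinP; exact: measurable_funX.
  under eq_integral do rewrite /= ger0_norm ?sqr_ge0//.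
  rewrite -Nsq; move: ff N0; rewrite /finite_norm.
  by case: (Lnorm _ _ _) => [r _ _|//|//]; rewrite poweR_EFin ltry.
move=> [mf /integrableP[_ fi]]; apply/andP; split; apply/mem_set => //=.
move: fi; under eq_integral do rewrite /= ger0_norm ?sqr_ge0//.
rewrite -Nsq /finite_norm; move: N0.
case: (Lnorm _ _ _) => [r _ _| |//]; first exact: ltry.
by rewrite poweRyr// ltxx.
Qed.

Lemma in_L2_measurable f : in_L2 mu f -> measurable_fun setT (f : borel H -> R).
Proof. by move=> /in_L2P[]. Qed.

Lemma sqmeanE f : in_L2 mu f ->
  (\int[mu]_x ((f : borel H -> R) x ^+ 2)%:E = (sqmean f)%:E)%E.
Proof.
by move=> /in_L2P[_ fi]; rewrite /sqmean /Rintegral fineK//; exact: integrable_fin_num fi.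
Qed.

Lemma sqmean_ge0 f : 0 <= sqmean f.
Proof. by apply: Rintegral_ge0 => x _; exact: sqr_ge0. Qed.

Lemma bdd_meas_L2 f : bdd_meas (f : borel H -> R) -> in_L2 mu f.
Proof.
move=> bf; apply/in_L2P; split; first by case: bf.
apply: bdd_meas_integrable; under eq_fun do rewrite expr2; exact: bdd_measM.
Qed.

Let two_ineq (a b c : R) : `|c| <= `|a| + `|b| -> c ^+ 2 <= 2 * a ^+ 2 + 2 * b ^+ 2.
Proof.
move=> h; rewrite -(real_normK (num_real c)) -(real_normK (num_real a)).
rewrite -(real_normK (num_real b)).
apply: (@le_trans _ _ ((`|a| + `|b|) ^+ 2)); first by rewrite lerXn2r// nnegrE addr_ge0.
rewrite -subr_ge0 (_ : _ - _ = (`|a| - `|b|) ^+ 2) ?sqr_ge0//; ring.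
Qed.

Let sum_int f g : in_L2 mu f -> in_L2 mu g -> mu.-integrable setT
  (EFin \o ((fun x => 2 * f x ^+ 2 + 2 * g x ^+ 2) : borel H -> R)).
Proof.
move=> /in_L2P[_ fi] /in_L2P[_ gi].
by have := integrableD measurableT (integrableZl measurableT 2 fi) (integrableZl measurableT 2 gi).
Qed.

Lemma in_L2_le f g h : measurable_fun setT (h : borel H -> R) ->
  in_L2 mu f -> in_L2 mu g -> {ae mu, forall x, `|h x| <= `|f x| + `|g x|} -> in_L2 mu h.
Proof.
move=> mh f2 g2 hfg; apply/in_L2P; split => //; apply/integrableP; split.
  by apply/measurable_EFinP; exact: measurable_funX.
have /integrableP[mi] := sum_int f2 g2; apply: le_lt_trans.
apply: ae_ge0_le_integral => //.
- by apply: measurableT_comp => //; apply/measurable_EFinP; exact: measurable_funX.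
- exact: measurableT_comp.
- apply: ae_mono hfg => x hx _ /=.
  rewrite lee_fin ger0_norm ?sqr_ge0//; apply: (le_trans (two_ineq hx)).
  exact: ler_norm.
Qed.

(** The inequality (a + b)^2 <= 2 a^2 + 2 b^2 stands in for the triangle inequality, which would
    bring back square roots. *)
Lemma sqmean_le f g h : in_L2 mu f -> in_L2 mu g -> in_L2 mu h ->
  {ae mu, forall x, `|h x| <= `|f x| + `|g x|} -> sqmean h <= 2 * sqmean f + 2 * sqmean g.
Proof.
move=> f2 g2 h2 hfg; rewrite -lee_fin -(sqmeanE h2).
have /in_L2P[_ fi] := f2; have /in_L2P[_ gi] := g2; have /in_L2P[mh _] := h2.
have -> : 2 * sqmean f + 2 * sqmean g =
    \int[mu]_x ((fun y => 2 * f y ^+ 2 + 2 * g y ^+ 2) : borel H -> R) x.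
  have i1 := integrableZl measurableT 2 fi; have i2 := integrableZl measurableT 2 gi.
  by rewrite RintegralD// !RintegralZl.
rewrite /Rintegral fineK; last exact: (integrable_fin_num measurableT (sum_int f2 g2)).
apply: ae_ge0_le_integral => //.
- by move=> x _; rewrite lee_fin sqr_ge0.
- by apply/measurable_EFinP; exact: measurable_funX.
- by move=> x _; rewrite lee_fin addr_ge0// mulr_ge0// sqr_ge0.
- by have /integrableP[] := sum_int f2 g2.
- by apply: ae_mono hfg => x hx _ /=; rewrite lee_fin; exact: two_ineq.
Qed.

Lemma in_L2_0 : in_L2 mu (fun=> 0).
Proof. exact: bdd_meas_L2 (bdd_meas_cst _ _). Qed.

Lemma in_L2D f g : in_L2 mu f -> in_L2 mu g -> in_L2 mu (fun x => f x + g x).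
Proof.
move=> f2 g2; apply: (in_L2_le _ f2 g2); last by apply: aeW => x; exact: ler_normD.
by apply: measurable_funD; exact: in_L2_measurable.
Qed.

Lemma sqmeanZ c f : in_L2 mu f -> sqmean (fun x => c * f x) = c ^+ 2 * sqmean f.
Proof.
move=> /in_L2P[_ fi]; rewrite /sqmean -RintegralZl//.
by congr Rintegral; apply/funext => x; rewrite exprMn.
Qed.

Lemma in_L2Z c f : in_L2 mu f -> in_L2 mu (fun x => c * f x).
Proof.
move=> /in_L2P[mf fi]; apply/in_L2P; split; first exact: measurable_funM.
have := integrableZl measurableT (c ^+ 2) fi; congr integrable.
by apply/funext => x /=; rewrite exprMn.
Qed.

Lemma in_L2B f g : in_L2 mu f -> in_L2 mu g -> in_L2 mu (fun x => f x - g x).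
Proof.
move=> f2 g2; have := in_L2D f2 (in_L2Z (-1) g2).
by under eq_fun do rewrite mulN1r.
Qed.

Lemma in_L2_bddM v f : bdd_meas (v : borel H -> R) -> in_L2 mu f -> in_L2 mu (fun x => v x * f x).
Proof.
move=> [mv [M vM]] f2; apply: (in_L2_le _ (in_L2Z M f2) in_L2_0).
  by apply: measurable_funM => //; exact: in_L2_measurable.
apply: aeW => x; rewrite normr0 addr0 !normrM ler_wpM2r//.
by apply: le_trans (vM x) _; exact: ler_norm.
Qed.

Lemma sqmean_bddM v f (M : R) : bdd_meas (v : borel H -> R) -> (forall x, `|v x| <= M) ->
  in_L2 mu f -> sqmean (fun x => v x * f x) <= M ^+ 2 * sqmean f.
Proof.
move=> bv vM f2; have /in_L2P[mf fi] := f2; have /in_L2P[mvf vfi] := in_L2_bddM bv f2.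
rewrite /sqmean -RintegralZl//; apply: le_Rintegral => //.
  exact: (integrableZl measurableT (M ^+ 2) fi).
move=> x _; rewrite exprMn ler_wpM2r ?sqr_ge0// -(real_normK (num_real (v x))).
by rewrite lerXn2r ?nnegrE// (le_trans _ (vM x)).
Qed.

Lemma L2norm_cvg0 I (F : set_system I) (FF : Filter F) (g : I -> H -> R) :
  (\forall i \near F, in_L2 mu (g i)) ->
  L2norm mu (g i) @[i --> F] --> 0%E <->
  forall c : R, 0 < c -> \forall i \near F, sqmean (g i) <= c.
Proof.
move=> g2; rewrite /L2norm (Lnorm2_cvg0 mu FF (fun i => (g i : borel H -> R))).
split=> h c c0; have := h c c0 => hc; near=> i.
  by rewrite -lee_fin -sqmeanE; near: i.
by rewrite sqmeanE ?lee_fin; near: i.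
Unshelve. all: end_near.
Qed.

Lemma L2_bounded_sqmean (S : (H -> R) -> H -> R) : L2_bounded_operator mu S ->
  exists2 C, 0 <= C & forall f, in_L2 mu f -> sqmean (S f) <= C * sqmean f.
Proof.
move=> hS; have [M SM] := L2op_bounded hS.
exists (M ^+ 2); first exact: sqr_ge0.
move=> f f2; have Sf2 := L2op_in hS f2.
set s := Num.sqrt (sqmean f).
have s2 : s ^+ 2 = sqmean f by rewrite sqr_sqrtr// sqmean_ge0.
have Nf : (L2norm mu f <= s%:E)%E.
  by apply/(Lnorm2_le mu (f : borel H -> R) (sqrtr_ge0 _)); rewrite sqmeanE// -/s s2.
(* The constant [M] may be negative, hence its absolute value. *)
have : (L2norm mu (S f) <= (`|M| * s)%:E)%E.
  apply: (le_trans (SM f f2)); rewrite EFinM.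
  apply: (@le_trans _ _ (`|M|%:E * L2norm mu f)%E).
    by apply: lee_wpmul2r; [exact: Lnorm_ge0|rewrite lee_fin ler_norm].
  by apply: lee_wpmul2l => //; rewrite lee_fin.
rewrite /L2norm (Lnorm2_le mu (S f : borel H -> R)); last by rewrite mulr_ge0// sqrtr_ge0.
by rewrite sqmeanE// lee_fin exprMn s2 real_normK// num_real.
Qed.

End SquareMean.

(** * Density of bounded continuous functions *)

Section Density.
Context {R : realType} {H : completeNormedModType R} (ip : H -> H -> R).
Variable mu : probability (borel H) R.
Hypothesis ip_inner : inner_product ip.
Hypothesis H_sep : separable (H := H).

Lemma Cb_cos h th : Cb (fun x => cos (ip x h + th)).
Proof.
split; last by exists 1 => x; rewrite ler_norml cos_geN1 cos_le1.
move=> x; apply: (cvg_comp _ cos); last exact: continuous_cos.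
by apply: cvgD; [exact: (ip_continuous ip_inner)|exact: cvg_cst].
Qed.

Lemma CbD f g : Cb f -> Cb g -> Cb (fun x : H => f x + g x).
Proof.
move=> [cf [M fM]] [cg [N gN]]; split; first by move=> x; apply: cvgD; [exact: cf|exact: cg].
by exists (M + N) => x; apply: le_trans (ler_normD _ _) _; exact: lerD.
Qed.

Lemma CbZ a f : Cb f -> Cb (fun x : H => a * f x).
Proof.
move=> [cf [M fM]]; split; first by move=> x; apply: cvgMr; exact: cf.
by exists (`|a| * M) => x; rewrite normrM ler_wpM2l.
Qed.

Lemma sqmean_cvg0_ae (f_ : nat -> H -> R) (M : R) : (forall n, in_L2 mu (f_ n)) ->
  {ae mu, forall x, forall n, `|f_ n x| <= M} ->
  {ae mu, forall x, f_ n x @[n --> \oo] --> 0} ->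
  sqmean mu (f_ n) @[n --> \oo] --> 0.
Proof.
move=> f2 fM ff; rewrite -(expect_cst mu 0); apply: (expect_cvg_ae (M := M ^+ 2)).
- by move=> n; apply: measurable_funX; exact: in_L2_measurable.
- exact: measurable_cst.
- apply: ae_mono fM => x hx n; rewrite normrX lerXn2r// nnegrE.
  exact: le_trans (hx n).
- by apply: ae_mono ff => x hx; rewrite -(mulr0 0); exact: (cvgM hx hx).
Qed.

(** The functions that [Cb] approximates form a monotone class, since a bounded limit is close in
    mean square to one of its terms. Cosines are in [Cb] already, so no approximation of sets is
    involved. *)
Lemma Cb_dense_bdd (f : borel H -> R) : bdd_meas f -> forall c, 0 < c ->
  exists2 psi : H -> R, Cb psi & sqmean mu (fun x => f x - psi x) <= c.
Proof.
move=> bf; pose C (f : borel H -> R) := bdd_meas f /\ (forall c, 0 < c ->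
  exists2 psi : H -> R, Cb psi & sqmean mu (fun x => f x - psi x) <= c).
suff [] : C f by [].
have L2B (g psi : H -> R) : bdd_meas (g : borel H -> R) -> Cb psi ->
    in_L2 mu (fun x => g x - psi x).
  by move=> bg /Cb_bdd_meas bpsi; apply: bdd_meas_L2; exact: bdd_measB.
apply: (trig_induct_H ip_inner H_sep (C := C)) bf => {f}.
  split=> [a f g [bf df] [bg dg]|f_ f M Cf fM ff].
    split=> [|c c0]; first exact: bdd_meas_lin.
    have k0 : 0 < 2 * a ^+ 2 + 2 by rewrite ltr_wpDl// mulr_ge0// sqr_ge0.
    have c1 : 0 < c / (2 * a ^+ 2 + 2) by exact: divr_gt0.
    have [p Cp fp] := df _ c1; have [q Cq gq] := dg _ c1.
    exists (fun x => a * p x + q x); first by apply: CbD Cq; exact: CbZ.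
    have h1 : sqmean mu (fun x => a * f x + g x - (a * p x + q x)) <=
        2 * sqmean mu (fun x => a * (f x - p x)) + 2 * sqmean mu (fun x => g x - q x).
      apply: sqmean_le; [exact: in_L2Z (L2B _ _ bf Cp)|exact: L2B| |].
        by apply: L2B; [exact: bdd_meas_lin|apply: CbD Cq; exact: CbZ].
      apply: aeW => x; rewrite (_ : _ - _ = a * (f x - p x) + (g x - q x)); last by ring.
      exact: ler_normD.
    apply: (le_trans h1); rewrite (sqmeanZ _ (L2B _ _ bf Cp)).
    have -> : c = 2 * (a ^+ 2 * (c / (2 * a ^+ 2 + 2))) + 2 * (c / (2 * a ^+ 2 + 2)).
      by field; exact: lt0r_neq0.
    by rewrite lerD// ler_wpM2l// ler_wpM2l// sqr_ge0.
  have bf n : bdd_meas (f_ n) by case: (Cf n).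
  have bfl := bdd_meas_lim bf fM ff.
  split=> // c c0; have c4 : 0 < c / 4 by rewrite divr_gt0.
  have d2 n : in_L2 mu (fun x => f x - f_ n x).
    by apply: bdd_meas_L2; exact: bdd_measB.
  have : sqmean mu (fun x => f x - f_ n x) @[n --> \oo] --> 0.
    apply: (sqmean_cvg0_ae (M := M + M)) => //; apply: aeW => x.
      move=> n; apply: le_trans (ler_normB _ _) _; rewrite lerD//.
      apply: (cvgr_to_le (cvg_norm (ff x))).
      by apply: nearW => m; exact: fM.
    by rewrite -(subrr (f x)); apply: cvgB; [exact: cvg_cst|exact: ff].
  move=> /(cvgr_lt (0 : R))/(_ _ c4)[n _ /(_ n (leqnn n))/= hn].
  have [_ /(_ _ c4)[psi Cpsi hpsi]] := Cf n; exists psi => //.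
  have h1 : sqmean mu (fun x => f x - psi x) <= 2 * sqmean mu (fun x => f x - f_ n x) +
      2 * sqmean mu (fun x => f_ n x - psi x).
    apply: sqmean_le; [exact: d2|exact: L2B|exact: L2B|].
    by apply: aeW => x; rewrite -[in leLHS](subrKA (f_ n x)) ler_normD.
  lra.
move=> h th; split; first exact: (Cb_bdd_meas (Cb_cos h th)).
move=> c c0; exists (fun x => cos (ip x h + th)); first exact: Cb_cos.
suff -> : (fun x => cos (ip x h + th) - cos (ip x h + th)) = fun=> 0.
  by rewrite /sqmean expr0n/= expect_cst ltW.
by apply/funext => x; rewrite subrr.
Qed.

(** Cutting [f] off outside the set where |f| <= n reduces to bounded functions; f^2 dominates the
    squared errors. *)
Lemma Cb_dense (f : H -> R) : in_L2 mu f -> forall c, 0 < c ->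
  exists2 psi, Cb psi & sqmean mu (fun x => f x - psi x) <= c.
Proof.
move=> f2 c c0; have mf := in_L2_measurable f2; have /in_L2P[_ fi] := f2.
pose A n : set (borel H) := [set x | `|f x| <= n%:R].
have mA n : measurable (A n).
  have mnf : measurable_fun setT (fun x : borel H => `|f x|) by exact: measurableT_comp.
  have := mnf measurableT _ (measurable_itv `]-oo, n%:R]); rewrite setTI.
  by congr measurable; apply/seteqP; split => x /=; rewrite in_itv.
pose g n x := f x * \1_(A n) x.
have bg n : bdd_meas (g n : borel H -> R).
  split; first by apply: measurable_funM => //; exact: measurable_indic.
  exists n%:R => x; rewrite /g indicE; case: (boolP (x \in A n)) => /=.
    by rewrite inE mulr1.
  by rewrite mulr0 normr0.
have d2 n : in_L2 mu (fun x => f x - g n x) by apply: in_L2B => //; exact: bdd_meas_L2.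
have dcvg x : (f x - g n x) ^+ 2 @[n --> \oo] --> 0.
  apply: cvg_near_cst; near=> n; rewrite /g indicE mem_set ?mulr1 ?subrr ?expr0n//.
  by rewrite /A /=; near: n; exact: nbhs_infty_ger.
have : sqmean mu (fun x => f x - g n x) @[n --> \oo] --> 0.
  rewrite -(expect_cst mu 0) /sqmean; apply: fine_cvg.
  rewrite fineK; last exact: (integrable_fin_num _ (bdd_meas_integrable mu (bdd_meas_cst _ 0))).
  apply: (@dominated_cvg _ _ _ mu _ _ _ _ (EFin \o ((fun x => f x ^+ 2) : borel H -> R))) => //.
  - by move=> n; have /in_L2P[m2 _] := d2 n; apply/measurable_EFinP; exact: measurable_funX.
  - by move=> x _; apply: cvg_EFin; [exact: nearW|exact: dcvg].
  - move=> n x _ /=; rewrite lee_fin ger0_norm ?sqr_ge0// /g indicE.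
    by case: (_ \in _) => /=; rewrite ?mulr1 ?mulr0 ?subrr ?subr0// expr0n sqr_ge0.
have c4 : 0 < c / 4 by rewrite divr_gt0.
move=> /(cvgr_lt (0 : R))/(_ _ c4)[n _ /(_ n (leqnn n))/= hn].
have [psi Cpsi hpsi] := Cb_dense_bdd (bg n) c4; exists psi => //.
have bpsi := Cb_bdd_meas Cpsi.
have h1 : sqmean mu (fun x => f x - psi x) <= 2 * sqmean mu (fun x => f x - g n x) +
    2 * sqmean mu (fun x => g n x - psi x).
  apply: sqmean_le; [exact: d2| | |].
  - by apply: bdd_meas_L2; exact: bdd_measB.
  - by apply: in_L2B => //; exact: bdd_meas_L2.
  - by apply: aeW => x; rewrite -[in leLHS](subrKA (g n x)) ler_normD.
lra.
Unshelve. all: end_near.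
Qed.

End Density.

(** * Bounded perturbation of a generator *)

Section Perturbation.
Context {R : realType} {H : completeNormedModType R} (mu : probability (borel H) R).

(** The difference quotient of [B] is that of [A] plus (B t phi - A t phi) / t, which tends to -w.
    [A] and [B] play no fixed roles, so that both inclusions of domains come from here. *)
Lemma generator_shift (A B : R -> (H -> R) -> H -> R) (phi psi w : H -> R) :
  (forall t, 0 <= t -> L2_bounded_operator mu (A t)) ->
  (forall t, 0 <= t -> L2_bounded_operator mu (B t)) -> in_L2 mu w ->
  (forall c : R, 0 < c -> \forall t \near 0^'+,
     sqmean mu (fun x => t^-1 * (B t phi x - A t phi x) + w x) <= c) ->
  generator mu A phi psi -> generator mu B phi (fun x => psi x - w x).
Proof.
move=> hA hB w2 hBA [phi2 psi2 gA]; split => //; first exact: in_L2B.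
have L2q (S : R -> (H -> R) -> H -> R) (g : H -> R) t :
    (forall t, 0 <= t -> L2_bounded_operator mu (S t)) -> in_L2 mu g -> 0 < t ->
    in_L2 mu (t^-1 \*: (S t phi \- phi) \- g).
  move=> hS g2 t0; apply: in_L2B => //; apply: in_L2Z; apply: in_L2B => //.
  exact: (L2op_in (hS t (ltW t0))).
have L2A : \forall t \near 0^'+, in_L2 mu (t^-1 \*: (A t phi \- phi) \- psi).
  by near=> t; apply: (L2q A).
have L2B : \forall t \near 0^'+, in_L2 mu (t^-1 \*: (B t phi \- phi) \- (fun x => psi x - w x)).
  by near=> t; apply: (L2q B) => //; exact: in_L2B.
apply/(L2norm_cvg0 _ L2B) => c c0; have c4 : 0 < c / 4 by rewrite divr_gt0.
have qA : \forall t \near 0^'+, sqmean mu (t^-1 \*: (A t phi \- phi) \- psi) <= c / 4.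
  exact: ((L2norm_cvg0 _ L2A).1 gA _ c4).
have qBA := hBA _ c4; near=> t; have t0 : 0 < t by [].
have h1 : sqmean mu (t^-1 \*: (A t phi \- phi) \- psi) <= c / 4 by near: t.
have h2 : sqmean mu (fun x => t^-1 * (B t phi x - A t phi x) + w x) <= c / 4 by near: t.
have h3 : sqmean mu (t^-1 \*: (B t phi \- phi) \- (fun x => psi x - w x)) <=
    2 * sqmean mu (t^-1 \*: (A t phi \- phi) \- psi) +
    2 * sqmean mu (fun x => t^-1 * (B t phi x - A t phi x) + w x).
  apply: sqmean_le; [exact: (L2q A)| |apply: (L2q B) => //; exact: in_L2B|].
    apply: in_L2D => //; apply: in_L2Z; apply: in_L2B.
      exact: (L2op_in (hB t (ltW t0))).
    exact: (L2op_in (hA t (ltW t0))).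
  apply: aeW => x /=.
  rewrite (_ : _ - (psi x - w x) = (t^-1 *: (A t phi x - phi x) - psi x) +
    (t^-1 * (B t phi x - A t phi x) + w x)); first exact: ler_normD.
  by rewrite -[t^-1 *: (B t phi x - phi x)]/(t^-1 * (B t phi x - phi x))
    -[t^-1 *: (A t phi x - phi x)]/(t^-1 * (A t phi x - phi x)); ring.
lra.
Unshelve. all: end_near.
Qed.

Variables (T S : R -> (H -> R) -> H -> R) (v : H -> R) (M : R).
Hypothesis T_op : forall t, 0 <= t -> L2_bounded_operator mu (T t).
Hypothesis S_op : forall t, 0 <= t -> L2_bounded_operator mu (S t).
Hypothesis v_meas : bdd_meas (v : borel H -> R).
Hypothesis v_le : forall x, `|v x| <= M.
Hypothesis Cb_approx : forall f, in_L2 mu f -> forall c, 0 < c ->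
  exists2 psi, Cb psi & sqmean mu (fun x => f x - psi x) <= c.
Hypothesis Cb_bound : forall t phi, 0 <= t -> Cb phi ->
  sqmean mu (fun x => S t phi x - T t phi x) <= (M * t) ^+ 2 * sqmean mu phi.

(** The error of the first-order expansion S t f = T t f - t v f, divided by t. *)
Definition defect (t : R) (f : H -> R) (x : H) := t^-1 * (S t f x - T t f x) + v x * f x.

Hypothesis Cb_cvg : forall phi, Cb phi -> forall c, 0 < c ->
  \forall t \near 0^'+, sqmean mu (defect t phi) <= c.

Let Cb_L2 psi : Cb psi -> in_L2 mu psi.
Proof. by move=> Cpsi; apply: bdd_meas_L2; exact: Cb_bdd_meas. Qed.

Let op_split (A : (H -> R) -> H -> R) f psi : L2_bounded_operator mu A ->
  in_L2 mu f -> in_L2 mu psi ->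
  {ae mu, forall x, A f x = A psi x + A (fun y => f y - psi y) x}.
Proof.
move=> hA f2 psi2; have := L2op_linear hA 1 psi2 (in_L2B f2 psi2).
rewrite (_ : 1 \*: psi \+ _ = f); last first.
  by apply/funext => x /=; rewrite scale1r addrC subrK.
by apply: ae_mono => x ->; rewrite /= scale1r.
Qed.

Let diff_L2 t f : 0 <= t -> in_L2 mu f -> in_L2 mu (fun x => S t f x - T t f x).
Proof.
by move=> t0 f2; apply: in_L2B; [exact: (L2op_in (S_op t0))|exact: (L2op_in (T_op t0))].
Qed.

(** The bounds [C1] and [C2] of the operators may depend on [t], but they multiply the approximation
    error only, which is arbitrarily small. What remains is the constant on [Cb], times 4 for two
    nested uses of [sqmean_le]. *)
Lemma diff_bound t f : 0 <= t -> in_L2 mu f ->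
  sqmean mu (fun x => S t f x - T t f x) <= 4 * (M * t) ^+ 2 * sqmean mu f.
Proof.
move=> t0 f2; set m := (M * t) ^+ 2; have m0 : 0 <= m by exact: sqr_ge0.
have [C1 C10 SC] := L2_bounded_sqmean (S_op t0).
have [C2 C20 TC] := L2_bounded_sqmean (T_op t0).
(* [K] is the total coefficient of the error: 4 m from the return from [psi] to [f], the rest from
   the operators applied to [g]. *)
apply/ler_addgt0Pr => e e0; set K := 4 * m + 4 * C1 + 4 * C2.
have K0 : 0 <= K by rewrite /K; lra.
have K1 : 0 < K + 1 by lra.
have [psi Cpsi hpsi] := Cb_approx f2 (divr_gt0 e0 K1).
set c := e / (K + 1) in hpsi.
have Kc : K * c <= e.
  by rewrite /c mulrA ler_pdivrMr// mulrC ler_wpM2l ?(ltW e0)//; lra.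
have psi2 := Cb_L2 Cpsi; have g2 := in_L2B f2 psi2.
set g := (fun x => f x - psi x) in hpsi g2 *.
have h1 : sqmean mu (fun x => S t f x - T t f x) <=
    2 * sqmean mu (fun x => S t psi x - T t psi x) + 2 * sqmean mu (fun x => S t g x - T t g x).
  apply: sqmean_le; [exact: diff_L2|exact: diff_L2|exact: diff_L2|].
  apply: (ae_mono2 _ (op_split (S_op t0) f2 psi2) (op_split (T_op t0) f2 psi2)) => x -> ->.
  by rewrite opprD addrACA ler_normD.
have h2 : sqmean mu (fun x => S t g x - T t g x) <= 2 * sqmean mu (S t g) + 2 * sqmean mu (T t g).
  apply: sqmean_le; [exact: (L2op_in (S_op t0))|exact: (L2op_in (T_op t0))|exact: diff_L2|].
  by apply: aeW => x; exact: ler_normB.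
have h3 : sqmean mu psi <= 2 * sqmean mu f + 2 * sqmean mu g.
  apply: sqmean_le => //; apply: aeW => x.
  by rewrite [in leLHS](_ : psi x = f x - g x) ?ler_normB// /g opprB addrC subrK.
have h4 := Cb_bound t0 Cpsi; have h5 := SC _ g2; have h6 := TC _ g2.
have h7 : m * sqmean mu psi <= m * (2 * sqmean mu f + 2 * c) by rewrite ler_wpM2l//; lra.
have h8 : C1 * sqmean mu g <= C1 * c by rewrite ler_wpM2l.
have h9 : C2 * sqmean mu g <= C2 * c by rewrite ler_wpM2l.
rewrite -/m in h4; rewrite /K in Kc; lra.
Qed.

Let defect_L2 t f : 0 < t -> in_L2 mu f -> in_L2 mu (defect t f).
Proof.
move=> t0 f2; apply: in_L2D; last exact: in_L2_bddM.
by apply: in_L2Z; exact: diff_L2 (ltW t0) f2.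
Qed.

(** The t^2 of [diff_bound] cancels the squared factor 1/t, so the bound is uniform in time; 10 is 2
    times 4, plus 2. *)
Let defect_bound t f : 0 < t -> in_L2 mu f ->
  sqmean mu (defect t f) <= 10 * M ^+ 2 * sqmean mu f.
Proof.
move=> t0 f2; have dL := diff_L2 (ltW t0) f2; have vL := in_L2_bddM v_meas f2.
have h1 : sqmean mu (defect t f) <=
    2 * sqmean mu (fun x => t^-1 * (S t f x - T t f x)) + 2 * sqmean mu (fun x => v x * f x).
  apply: sqmean_le; [exact: in_L2Z|exact: vL|exact: defect_L2|].
  by apply: aeW => x; exact: ler_normD.
have h2 := sqmean_bddM v_meas v_le f2.
have h3 : sqmean mu (fun x => t^-1 * (S t f x - T t f x)) <= 4 * M ^+ 2 * sqmean mu f.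
  rewrite sqmeanZ//; apply: (le_trans (ler_wpM2l (sqr_ge0 _) (diff_bound (ltW t0) f2))).
  rewrite le_eqVlt; apply/orP; left; apply/eqP; field.
  exact: lt0r_neq0.
have := sqmean_ge0 mu f; lra.
Qed.

Lemma defect_cvg f : in_L2 mu f -> forall c, 0 < c ->
  \forall t \near 0^'+, sqmean mu (defect t f) <= c.
Proof.
move=> f2 c c0; have m0 : 0 <= M ^+ 2 by exact: sqr_ge0.
(* The factor 40 makes 2 times 10 M^2 times the mean square of [g] at most c / 2; [psi] accounts for
   the other half. *)
have K0 : 0 < 40 * M ^+ 2 + 1 by lra.
have [psi Cpsi hpsi] := Cb_approx f2 (divr_gt0 c0 K0).
have c4 : 0 < c / 4 by rewrite divr_gt0.
have psi2 := Cb_L2 Cpsi; have g2 := in_L2B f2 psi2.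
set g := (fun x => f x - psi x) in hpsi g2.
have cpsi := Cb_cvg Cpsi c4; near=> t.
have t0 : 0 < t by [].
have h1 : sqmean mu (defect t psi) <= c / 4 by near: t.
have h2 : sqmean mu (defect t f) <= 2 * sqmean mu (defect t psi) + 2 * sqmean mu (defect t g).
  apply: sqmean_le; [exact: defect_L2|exact: defect_L2|exact: defect_L2|].
  apply: (ae_mono2 _ (op_split (S_op (ltW t0)) f2 psi2) (op_split (T_op (ltW t0)) f2 psi2)).
  move=> x; rewrite /defect => -> ->; rewrite -/g.
  rewrite (_ : t^-1 * _ + v x * f x = (t^-1 * (S t psi x - T t psi x) + v x * psi x) +
    (t^-1 * (S t g x - T t g x) + v x * g x)); first exact: ler_normD.
  by rewrite /g; ring.
have h3 := defect_bound t0 g2.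
have h4 : 40 * M ^+ 2 * sqmean mu g <= c.
  apply: (le_trans (ler_wpM2l _ hpsi)); first by lra.
  by rewrite mulrA ler_pdivrMr// mulrC ler_wpM2l ?(ltW c0)//; lra.
lra.
Unshelve. all: end_near.
Qed.

Lemma generator_perturbation : generator_domain mu S = generator_domain mu T /\
  (forall phi Lphi, generator mu T phi Lphi ->
     generator mu S phi (fun x => Lphi x - v x * phi x)).
Proof.
have TS phi Lphi : generator mu T phi Lphi ->
    generator mu S phi (fun x => Lphi x - v x * phi x).
  move=> gT; have [phi2 _ _] := gT; apply: generator_shift gT => //.
    exact: in_L2_bddM.
  exact: defect_cvg.
split=> //; apply/seteqP; split=> [phi [psi gS]|phi [psi /TS gS]]; last by eexists; exact: gS.
(* Exchanging [S] and [T] reverses the sign of the limit, hence the factor -1. *)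
have [phi2 _ _] := gS; exists (fun x => psi x - (-1) * (v x * phi x)).
apply: (generator_shift (A := S) (w := fun x => -1 * (v x * phi x))) gS => //.
  by apply: in_L2Z; exact: in_L2_bddM.
move=> c c0; near=> t; have t0 : 0 < t by [].
have -> : (fun x => t^-1 * (T t phi x - S t phi x) + -1 * (v x * phi x)) =
    (fun x => -1 * defect t phi x).
  by apply/funext => x; rewrite /defect; ring.
rewrite sqmeanZ ?sqrrN ?expr1n ?mul1r; last exact: defect_L2.
by near: t; exact: defect_cvg.
Unshelve. all: end_near.
Qed.

End Perturbation.

(** A failure would give a counterexample in ]0, 1/(n + 1)[ for each n. Sequences are needed because
    almost-everywhere identities, one for each time, combine only countably often. *)
Lemma near_right_seq {R : realType} (A : R -> Prop) :
  (forall u : nat -> R, (forall n, 0 < u n) -> u n @[n --> \oo] --> 0 -> exists n, A (u n)) ->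
  \forall t \near 0^'+, A t.
Proof.
move=> hA; apply: contrapT => nA.
have ex n : exists t, [/\ 0 < t, t < n.+1%:R^-1 & ~ A t].
  apply: contrapT => nex; apply: nA; near=> t.
  have tn : t < n.+1%:R^-1 by near: t; apply: nbhs_right_lt; rewrite invr_gt0.
  by apply: contrapT => nAt; apply: nex; exists t.
have [u hu] := choice ex.
have [||n An] := hA u; first by move=> n; case: (hu n).
  apply: (squeeze_cvgr (f := fun=> 0) (h := fun n => n.+1%:R^-1)).
  - by apply: nearW => n; have [u0 un _] := hu n; rewrite !ltW.
  - exact: cvg_cst.
  - exact: cvg_harmonic.
by have [_ _] := hu n.
Unshelve. all: end_near.
Qed.

(** Nonnegativity of the variance. *)
Lemma sqr_expect_le d (T : measurableType d) (R : realType) (P : probability T R) (f : T -> R) :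
  bdd_meas f -> (\int[P]_x f x) ^+ 2 <= \int[P]_x (f x ^+ 2).
Proof.
move=> bf; set m := \int[P]_x f x.
have bf2 : bdd_meas (fun x => f x ^+ 2) by under eq_fun do rewrite expr2; exact: bdd_measM.
have b0 : bdd_meas (fun x => (f x - m) ^+ 2).
  have bm := bdd_measB bf (bdd_meas_cst T m).
  by under eq_fun do rewrite expr2; exact: bdd_measM.
have : 0 <= \int[P]_x ((f x - m) ^+ 2) by apply: Rintegral_ge0 => x _; exact: sqr_ge0.
have -> : \int[P]_x ((f x - m) ^+ 2) = \int[P]_x ((- (2 * m) * f x + m ^+ 2) + f x ^+ 2).
  by congr Rintegral; apply/funext => x; ring.
rewrite (expectD P (bdd_meas_lin _ bf (bdd_meas_cst T _)) bf2).
rewrite (expect_lin P _ bf (bdd_meas_cst T _)) expect_cst -/m.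
by move: (\int[P]_x _) => E; nra.
Qed.

(** * Mean-square estimates for the Feynman-Kac semigroup *)

Section FeynmanKacL2.
Context {R : realType} {H : completeNormedModType R} (mu : probability (borel H) R).
Context {d : measure_display} {Omega : measurableType d} (P : probability Omega R).
Variables (V : H -> R) (M : R) (X : R -> H -> Omega -> H) (eps : R).
Variables (T S : R -> (H -> R) -> H -> R).
Hypothesis V_cont : continuous V.
Hypothesis V_ge0 : forall z, 0 <= V z.
Hypothesis V_le : forall z, V z <= M.
Hypothesis mX : forall t x, 0 <= t -> measurable_fun setT (X t x : Omega -> borel H).
Hypothesis X_start : forall x, {ae P, forall w, X 0 x w = x}.
Hypothesis X_cont : forall x,
  {ae P, forall w, {within `[0, +oo[, continuous (fun t => X t x w)}}.
Hypothesis X_inv : forall t (f : borel H -> R), 0 <= t -> bdd_meas f ->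
  bdd_meas (fun x : borel H => \int[P]_w f (X t x w)) /\
  \int[mu]_x (\int[P]_w f (X t x w)) = \int[mu]_x f x.
Hypothesis eps_gt0 : 0 < eps.
Hypothesis T_op : forall t, 0 <= t -> L2_bounded_operator mu (T t).
Hypothesis S_op : forall t, 0 <= t -> L2_bounded_operator mu (S t).
Hypothesis T_mean : forall t phi, 0 <= t -> Cb phi ->
  ae_equal mu (T t phi) (fun x => \int[P]_w phi (X t x w)).
Hypothesis S_fk : forall t phi, 0 <= t -> Cb phi ->
  ae_equal mu (S t phi) (fk_semigroup P X V eps t phi).

Let M_ge0 : 0 <= M. Proof. exact: le_trans (V_le 0). Qed.

Let Cb_L2 phi : Cb phi -> in_L2 mu phi.
Proof. by move=> Cphi; apply: bdd_meas_L2; exact: Cb_bdd_meas. Qed.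

Let fk_le t phi x : 0 <= t -> Cb phi ->
  `|fk_semigroup P X V eps t phi x - \int[P]_w phi (X t x w)| <=
  eps^-1 * M * t * \int[P]_w `|phi (X t x w)|.
Proof.
move=> t0 Cphi.
exact: (fk_diff_le V_cont V_ge0 V_le mX (X_start x) (X_cont x) eps_gt0 Cphi t0).
Qed.

Let diff_L2 t phi : 0 <= t -> Cb phi -> in_L2 mu (fun x => S t phi x - T t phi x).
Proof.
by move=> t0 /Cb_L2 phi2; apply: in_L2B; [exact: (L2op_in (S_op t0))|exact: (L2op_in (T_op t0))].
Qed.

(* The factor 2 makes room for the constant of [sqmean_le]. *)
Lemma fk_sqmean_bound t phi : 0 <= t -> Cb phi ->
  sqmean mu (fun x => S t phi x - T t phi x) <= (2 * (eps^-1 * M) * t) ^+ 2 * sqmean mu phi.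
Proof.
move=> t0 Cphi; set m := eps^-1 * M * t.
have m0 : 0 <= m by rewrite !mulr_ge0// invr_ge0 ltW.
have [cphi [C phiC]] := Cphi.
have Cnorm : Cb (fun x => `|phi x|).
  split; last by exists C => x; rewrite normr_id.
  by move=> x; apply: cvg_norm; exact: cphi.
have [bE _] := X_inv t0 (Cb_bdd_meas Cnorm).
have E2 := bdd_meas_L2 mu bE.
have bphi2 : bdd_meas ((fun x => phi x ^+ 2) : borel H -> R).
  by under eq_fun do rewrite expr2; apply: bdd_measM; exact: Cb_bdd_meas.
have [bE2 EE2] := X_inv t0 bphi2.
have h1 : sqmean mu (fun x => S t phi x - T t phi x) <=
    2 * sqmean mu (fun x => m * \int[P]_w `|phi (X t x w)|) + 2 * sqmean mu (fun=> 0).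
  apply: sqmean_le; [exact: in_L2Z|exact: in_L2_0|exact: diff_L2|].
  apply: (ae_mono2 _ (S_fk t0 Cphi) (T_mean t0 Cphi)) => x -> ->.
  rewrite normr0 addr0; apply: le_trans (fk_le x t0 Cphi) _; exact: ler_norm.
(* Jensen's inequality under [P] for each x, then invariance of [mu] for phi^2. *)
have h2 : sqmean mu (fun x => \int[P]_w `|phi (X t x w)|) <= sqmean mu phi.
  rewrite /sqmean -EE2; apply: expect_le => //.
    by under eq_fun do rewrite expr2; exact: bdd_measM.
  move=> x; have bn := bdd_meas_comp (mX x t0) (Cb_bdd_meas Cnorm).
  apply: le_trans (sqr_expect_le P bn) _; rewrite le_eqVlt; apply/orP; left; apply/eqP.
  by congr Rintegral; apply/funext => w; rewrite real_normK// num_real.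
move: h1; rewrite sqmeanZ// (_ : sqmean mu (fun=> 0) = 0); last first.
  by rewrite /sqmean expr0n expect_cst.
rewrite (_ : 2 * (eps^-1 * M) * t = 2 * m); last by rewrite /m; ring.
have h3 : m ^+ 2 * sqmean mu (fun x => \int[P]_w `|phi (X t x w)|) <= m ^+ 2 * sqmean mu phi.
  by rewrite ler_wpM2l// sqr_ge0.
have h4 : 0 <= m ^+ 2 * sqmean mu phi by rewrite mulr_ge0 ?sqr_ge0 ?sqmean_ge0.
clearbody m; rewrite (_ : (2 * m) ^+ 2 * _ = 4 * (m ^+ 2 * sqmean mu phi)); last by ring.
lra.
Qed.

Lemma fk_defect_cvg phi : Cb phi -> forall c : R, 0 < c ->
  \forall t \near 0^'+, sqmean mu (defect T S (fun x => eps^-1 * V x) t phi) <= c.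
Proof.
move=> Cphi c c0; apply: near_right_seq => u u0 ucvg.
have u0' n := ltW (u0 n).
have [cphi [C phiC]] := Cphi.
(* One null set serves all times of the sequence. *)
have aeS : {ae mu, forall x, forall n, S (u n) phi x = fk_semigroup P X V eps (u n) phi x}.
  by apply/ae_foralln => n; exact: S_fk.
have aeT : {ae mu, forall x, forall n, T (u n) phi x = \int[P]_w phi (X (u n) x w)}.
  by apply/ae_foralln => n; exact: T_mean.
have bV : bdd_meas ((fun x => eps^-1 * V x) : borel H -> R).
  apply: bdd_measZ; apply: Cb_bdd_meas; split=> //.
  by exists M => x; rewrite ger0_norm.
have vc : sqmean mu (defect T S (fun x => eps^-1 * V x) (u n) phi) @[n --> \oo] --> 0.
  apply: (sqmean_cvg0_ae (M := eps^-1 * M * C + eps^-1 * M * C)).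
  - move=> n; apply: in_L2D; first by apply: in_L2Z; exact: diff_L2.
    by apply: in_L2_bddM => //; exact: Cb_L2.
  - apply: (ae_mono2 _ aeS aeT) => x hS hT n.
    rewrite /defect hS hT; apply: le_trans (ler_normD _ _) _; apply: lerD.
      rewrite normrM gtr0_norm ?invr_gt0// mulrC ler_pdivrMr//.
      apply: (le_trans (fk_le x (u0' n) Cphi)); rewrite mulrAC ler_wpM2r//.
      rewrite ler_wpM2l ?mulr_ge0 ?invr_ge0 ?(ltW eps_gt0)//.
      have bphi := bdd_meas_comp (mX x (u0' n)) (Cb_bdd_meas Cphi).
      have bn : bdd_meas (fun w => `|phi (X (u n) x w)|).
        by case: bphi => mp [D pD]; split; [exact: measurableT_comp|exists D => w; rewrite normr_id].
      rewrite -[leRHS](expect_cst P); apply: expect_le => //; exact: bdd_meas_cst.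
    rewrite !normrM [`|eps^-1|]gtr0_norm ?invr_gt0// ler_pM//.
      by rewrite mulr_ge0// invr_ge0 ltW.
    by rewrite ler_pM2l ?invr_gt0// ger0_norm.
  - apply: (ae_mono2 _ aeS aeT) => x hS hT.
    rewrite (_ : 0 = - (eps^-1 * (V x * phi x)) + eps^-1 * (V x * phi x)); last by rewrite addNr.
    under eq_fun => n do rewrite /defect hS hT -mulrA.
    apply: cvgD; last exact: cvg_cst.
    exact: (fk_diff_cvg V_cont V_ge0 V_le mX (X_start x) (X_cont x) eps_gt0 Cphi u0 ucvg).
move: vc => /(cvgr_lt (0 : R))/(_ _ c0)[n _ /(_ n (leqnn n))/= hn].
by exists n; exact: ltW.
Qed.

End FeynmanKacL2.

(** * Existence of an eigenbasis *)

Section NoEigenbasis.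
Context {R : realType} {H : completeNormedModType R} (ip : H -> H -> R).
Variables (Q : {linear H -> H}) (mu : probability (borel H) R) (alpha : R).
Hypothesis ip_inner : inner_product ip.
Hypothesis Q_cov : covariance_operator ip Q.
Hypothesis mu_gauss : is_gaussian ip mu 0 Q.
Variable e0 : H.
Hypothesis e0_unit : ip e0 e0 = 1.

(** [T] is tied to [ou_semigroup] on [Cb] only, so the linear form <x, e0> is replaced by a bounded
    injective function of it. *)
Lemma Cb_atan : Cb (fun x => atan (ip x e0)).
Proof.
split=> [x|]; first by apply: (cvg_comp _ atan);
  [exact: (ip_continuous ip_inner)|exact: continuous_atan].
exists (pi / 2) => x; rewrite ler_norml.
by rewrite (ltW (atan_gtNpi2 _)) (ltW (atan_ltpi2 _)).
Qed.

(* Without an eigenbasis [fcalc] is a junk constant, so that [ou_semigroup] sends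
   each function to a constant. *)
Lemma eigenbasis_exists (T : R -> (H -> R) -> H -> R) :
  L2_extension mu (ou_semigroup ip Q alpha) T ->
  exists e lam, eigenbasis ip Q e lam.
Proof.
move=> [T_C0 T_ou]; apply: contrapT => no_basis.
have fcalcE f x : fcalc ip Q f x = get set0.
  rewrite /fcalc (_ : [set y | _] = set0)//; apply/seteqP; split=> // y [e [lam [el _]]].
  by apply: no_basis; exists e, lam.
pose phi x := atan (ip x e0).
have phi2 : in_L2 mu phi by apply: bdd_meas_L2; exact: Cb_bdd_meas Cb_atan.
pose K := ou_semigroup ip Q alpha 0 phi 0.
have KE x : ou_semigroup ip Q alpha 0 phi x = K.
  have expE : expA ip Q alpha (0 / 2) x = expA ip Q alpha (0 / 2) 0 by rewrite /expA !fcalcE.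
  by rewrite /K /ou_semigroup expE.
(* [T 0] is the identity almost everywhere, while [ou_semigroup] returns the constant [K]: the
   nondegenerate Gaussian variable <x, e0> would have an atom at tan K. *)
have aeK : {ae mu, forall x, ip x e0 = tan K}.
  apply: (ae_mono2 _ (T_ou 0 phi (lexx 0) Cb_atan) (C0_id T_C0 phi2)) => x.
  by rewrite KE => -> hK; rewrite hK /phi atanK.
pose B := [set y : R | y = tan K].
have muB : mu ((fun z => ip z e0) @^-1` B) = 0%E.
  rewrite mu_gauss; last exact: measurable_set1.
  rewrite gauss1E gauss_law_point//; apply: (cov_positive Q_cov).
  by apply/eqP => e00; move: e0_unit; rewrite e00 (ip0l ip_inner) => /eqP; rewrite eq_sym oner_eq0.
have mB : measurable ((fun z => ip z e0) @^-1` B : set (borel H)).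
  rewrite -[X in measurable X]setTI.
  by apply: (measurable_ip ip_inner e0) => //; exact: measurable_set1.
have [N [mN N0 BN]] := aeK.
have BN_T : (ip^~ e0 @^-1` B) `|` N = [set: borel H].
  by apply/seteqP; split => // x _; have [Bx|nB] := pselect (B (ip x e0)); [left|right; exact: BN].
have mu0 : mu [set: borel H] = 0%E by rewrite -BN_T; exact: null_set_setU.
have mu1 : mu [set: borel H] = 1%E by exact: probability_setT.
by move: mu1; rewrite mu0 => /esym /eqP; rewrite onee_eq0.
Qed.

End NoEigenbasis.

Lemma exists_unit {R : realType} {H : completeNormedModType R} (ip : H -> H -> R) :
  inner_product ip -> infinite_dimensional (H := H) -> exists e0, ip e0 e0 = 1.
Proof.
(* The only linear combination of the empty family is 0. *)
move=> ip_inner H_inf; have [x hx] := H_inf 0%N (fun=> 0).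
have x0 : x != 0 by apply/eqP => x0; apply: (hx (fun=> 0)); rewrite big_ord0.
exists (`|x|^-1 *: x).
rewrite (ip_norm ip_inner) normrZ normfV normr_id mulVf ?expr1n//.
by rewrite normr_eq0.
Qed.

Theorem proposition3p3 (R : realType) (H : completeNormedModType R)
  (ip : H -> H -> R) (Q : {linear H -> H}) (mu : probability (borel H) R)
  (d : measure_display) (Omega : measurableType d) (P : probability Omega R)
  (F : R -> set_system Omega) (W : R -> H -> Omega -> R)
  (K : set H) (V : H -> R) (alpha eps : R)
  (X : R -> H -> Omega -> H) (T Peps : R -> (H -> R) -> H -> R)
  (ip_inner : inner_product ip) (H_sep : separable (H := H))
  (H_inf : infinite_dimensional (H := H))
  (Q_cov : covariance_operator ip Q) (mu_gauss : is_gaussian ip mu 0 Q)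
  (F_filt : filtration F) (W_wiener : cylindrical_wiener ip P F W)
  (K_closed : closed K) (K_int : K° !=set0) (K_compl : (0 < mu (~` K))%E)
  (V_Cb : Cb V) (V_K : forall x, K x -> V x = 0)
  (V_Kc : forall x, ~ K x -> 0 < V x)
  (alpha_ge0 : 0 <= alpha) (alpha_le1 : alpha <= 1) (eps_gt0 : 0 < eps)
  (X_mild : mild_solution ip P Q alpha W X)
  (T_ext : L2_extension mu (ou_semigroup ip Q alpha) T)
  (Peps_ext : L2_extension mu (fk_semigroup P X V eps) Peps) :
  generator_domain mu Peps = generator_domain mu T /\
  (forall phi Lphi : H -> R, generator mu T phi Lphi ->
     generator mu Peps phi (fun x => Lphi x - eps^-1 * (V x * phi x))).
Proof.
have [e0 e0_unit] := exists_unit ip_inner H_inf.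
have [e [lam e_eigen]] := eigenbasis_exists ip_inner Q_cov mu_gauss e0_unit T_ext.
have [T_C0 T_ou] := T_ext; have [Peps_C0 Peps_fk] := Peps_ext.
have [V_cont [M V_M]] := V_Cb.
have V_ge0 z : 0 <= V z.
  by have [/V_K->|/V_Kc/ltW] := pselect (K z).
have V_le z : V z <= M by apply: le_trans (ler_norm _) (V_M z).
have M_ge0 : 0 <= M := le_trans (V_ge0 0) (V_le 0).
have mX t x : 0 <= t -> measurable_fun setT (X t x : Omega -> borel H).
  exact: (mild_measurable X_mild).
have X_start := mild_start ip_inner H_sep F_filt W_wiener e0_unit Q_cov e_eigen alpha_le1 X_mild.
have X_inv t f := mild_invariant ip_inner H_sep F_filt W_wiener e0_unit Q_cov e_eigen
  alpha_le1 X_mild mu_gauss (t := t) (f := f).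
have T_mean t phi : 0 <= t -> Cb phi ->
    ae_equal mu (T t phi) (fun x => \int[P]_w phi (X t x w)).
  move=> t0 Cphi; apply: ae_mono (T_ou t phi t0 Cphi) => x ->.
  exact: (ou_semigroupE ip_inner H_sep F_filt W_wiener e0_unit Q_cov e_eigen alpha_le1 X_mild
    x t0 (Cb_bdd_meas Cphi)).
have bV : bdd_meas ((fun x => eps^-1 * V x) : borel H -> R).
  by apply: bdd_measZ; exact: Cb_bdd_meas.
(* A single constant must bound the potential and the difference of the semigroups; the factor 2 is
   the one of [fk_sqmean_bound]. *)
have V_le2 x : `|eps^-1 * V x| <= 2 * (eps^-1 * M).
  rewrite ger0_norm ?mulr_ge0 ?invr_ge0 ?(ltW eps_gt0)//.
  have h : eps^-1 * V x <= eps^-1 * M by rewrite ler_pM2l ?invr_gt0.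
  have : 0 <= eps^-1 * M by rewrite mulr_ge0// invr_ge0 ltW.
  lra.
have [dom gen] := generator_perturbation (C0_op T_C0) (C0_op Peps_C0) bV V_le2
  (Cb_dense ip_inner H_sep (mu := mu))
  (fk_sqmean_bound V_cont V_ge0 V_le mX X_start (mild_continuous X_mild) X_inv eps_gt0
    (C0_op T_C0) (C0_op Peps_C0) T_mean Peps_fk)
  (fk_defect_cvg V_cont V_ge0 V_le mX X_start (mild_continuous X_mild) eps_gt0
    (C0_op T_C0) (C0_op Peps_C0) T_mean Peps_fk).
split=> // phi Lphi /gen; congr generator.
by apply/funext => x; rewrite mulrA.
Qed.
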